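(* Consider the $2$-periodic Lyness recurrence $$u_{n+2}=\frac{a_n+u_{n+1}}{u_n},\quad n\ge 1,\qquad a_n=\begin{cases}a & n \text{ odd},\\ b & n\text{ even},\end{cases}$$ with $a>0$, $b>0$ and positive initial conditions $u_1,u_2$. (i) If $(a,b)\neq(1,1)$, then there exists a value $p_0(a,b)\in\mathbb{N}$ such that for any $p>p_0(a,b)$ there exist continua of initial conditions $(u_1,u_2)$ giving rise to $2p$-periodic sequences. Moreover, when $\sigma(a,b)\neq 2/5$ the number $p_0(a,b)$ is computable. (ii) The set of prime periods arising when all $(a,b)\in(0,\infty)^2$ and all positive initial conditions are considered contains all the even positive integers except $4,6,8,12$ and $20$ (and these five do not arise). If $a\neq b$, then no odd period other than $1$ appears.
   Context: ''Prime period'' means minimal period of the sequence $\{u_n\}$. For $a,b>0$, $(x_c,y_c)$ denotes the unique solution with $x,y>0$ of $x^2=a+y$, $y^2=b+x$, and $\sigma(a,b)=\frac{1}{2\pi}\arccos\left(\frac12\left[-2+\frac{1}{x_cy_c}\right]\right)$. ''Computable'' means that a value $p_0(a,b)$ can be obtained by an explicit finite procedure from the numbers $\sigma(a,b)$ and $2/5$. *)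

(* Defs.v *)
From HB Require Import structures.
From mathcomp Require Import all_boot all_order all_algebra.
From mathcomp Require Import all_classical all_reals all_analysis.

Set Implicit Arguments.
Unset Strict Implicit.
Unset Printing Implicit Defensive.

Import Order.TTheory GRing.Theory Num.Theory.
Import numFieldNormedType.Exports.

Local Open Scope classical_set_scope.
Local Open Scope ring_scope.

Section Lyness.
Context {R : realType}.
Implicit Types (a b : R) (u : nat -> R) (k n : nat).

Definition lyness_coef a b n : R := if odd n then a else b.

(* Sequences are indexed from 1; the value u 0 is irrelevant throughout. *)
Definition lyness_sequence a b u : Prop :=
  [/\ 0 < u 1%N, 0 < u 2%N &
      forall n, (1 <= n)%N -> u n.+2 = (lyness_coef a b n + u n.+1) / u n].

Definition is_period u k : Prop := forall n, (1 <= n)%N -> u (n + k)%N = u n.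

Definition prime_period u k : Prop :=
  [/\ (0 < k)%N, is_period u k &
      forall j, (0 < j)%N -> is_period u j -> (k <= j)%N].

Definition initial_conditions_of_period a b k : set (R * R) :=
  [set z | exists u, [/\ lyness_sequence a b u, (u 1%N, u 2%N) = z &
                         prime_period u k]].

(* Nondegenerate continua: a single point is excluded. *)
Definition continuum (C : set (R * R)) : Prop :=
  [/\ compact C, connected C & exists z w, [/\ C z, C w & z <> w]].

Definition lyness_prime_periods : set nat :=
  [set k | exists a b u, [/\ 0 < a, 0 < b, lyness_sequence a b u &
                             prime_period u k]].

(* For a, b > 0 the set below is a singleton, so the default is never used. *)
Definition critical_point a b : R * R :=
  xget (0, 0) [set z : R * R | [/\ 0 < z.1, 0 < z.2,
                                   z.1 ^+ 2 = a + z.2 & z.2 ^+ 2 = b + z.1]].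

Definition sigma a b : R :=
  let: (xc, yc) := critical_point a b in
  (2 * pi)^-1 * acos (2^-1 * (- 2 + (xc * yc)^-1)).

End Lyness.

(* Finite procedures on real numbers: while programs over registers holding   *)
(* exact reals, with field operations and order tests (the real RAM, or       *)
(* Blum-Shub-Smale, model). The syntax does not depend on R and 1 is the only *)
(* constant, so that no noncomputable real can be hidden inside a program.    *)
Inductive rexpr : Type :=
  | RReg of nat
  | ROne
  | RAdd of rexpr & rexpr
  | RSub of rexpr & rexpr
  | RMul of rexpr & rexpr
  | RDiv of rexpr & rexpr.

Inductive rprog : Type :=
  | PAssign of nat & rexpr
  | PSeq of rprog & rprog
  | PIfLt of rexpr & rexpr & rprog & rprog
  | PWhileLt of rexpr & rexpr & rprog.

Section Semantics.
Context {R : realType}.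
Implicit Types (s : nat -> R) (e : rexpr) (c : rprog).

Fixpoint reval s e : R :=
  match e with
  | RReg i => s i
  | ROne => 1
  | RAdd e1 e2 => reval s e1 + reval s e2
  | RSub e1 e2 => reval s e1 - reval s e2
  | RMul e1 e2 => reval s e1 * reval s e2
  | RDiv e1 e2 => reval s e1 / reval s e2
  end.

Definition reg_update s (i : nat) (v : R) : nat -> R :=
  fun j => if j == i then v else s j.

(* exec c s s' : started in s, the program c halts in s'. *)
Inductive exec : rprog -> (nat -> R) -> (nat -> R) -> Prop :=
  | exec_assign s i e : exec (PAssign i e) s (reg_update s i (reval s e))
  | exec_seq s s' s'' c1 c2 :
      exec c1 s s' -> exec c2 s' s'' -> exec (PSeq c1 c2) s s''
  | exec_if_true s s' e1 e2 c1 c2 :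
      reval s e1 < reval s e2 -> exec c1 s s' -> exec (PIfLt e1 e2 c1 c2) s s'
  | exec_if_false s s' e1 e2 c1 c2 :
      ~~ (reval s e1 < reval s e2) -> exec c2 s s' ->
      exec (PIfLt e1 e2 c1 c2) s s'
  | exec_while_true s s' s'' e1 e2 c :
      reval s e1 < reval s e2 -> exec c s s' ->
      exec (PWhileLt e1 e2 c) s' s'' -> exec (PWhileLt e1 e2 c) s s''
  | exec_while_false s e1 e2 c :
      ~~ (reval s e1 < reval s e2) -> exec (PWhileLt e1 e2 c) s s.

(* The inputs are placed in registers 0, 1, ... (all others being 0) and the  *)
(* output is read in register 0.                                              *)
Definition computes c (inputs : seq R) (m : nat) : Prop :=
  exists s, exec c (fun i => inputs`_i) s /\ s 0%N = m%:R.

End Semantics.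

(* Main.v *)
(* In logarithmic coordinates the invariant of the map is strictly convex, so  *)
(* its level curves are star-shaped about the critical point c, and a point z  *)
(* is fixed by the p-th iterate exactly when the angle about c swept by its    *)
(* first p iterates is a whole number q of turns.  Per step this angle tends   *)
(* to 2 pi sigma at c and to 2 pi (2/5) at infinity, where the map is          *)
(* asymptotic to a globally 5-periodic piecewise linear one, so every q/p      *)
(* strictly between sigma and 2/5 is realized by the intermediate value        *)
(* theorem.  An area form invariant up to the level makes the whole level      *)
(* curve of such a point periodic, whence continua.  Away from c, z is fixed   *)
(* by the fifth iterate iff an affine function of its level vanishes: this     *)
(* settles period 10 and, together with compactness, the case sigma = 2/5.     *)
(* As no point has period 2 or 3, the rotation numbers lie in ]1/3, 1/2[,      *)
(* which excludes the other exceptional periods; an interval of explicit       *)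
(* length contains reduced fractions of every large denominator, which gives   *)
(* a computable p0.                                                            *)

Require Import Defs.
From HB Require Import structures.
From mathcomp Require Import all_boot all_order all_algebra.
From mathcomp Require Import all_classical all_reals all_analysis.
From mathcomp Require Import ring lra zify.

Set Implicit Arguments.
Unset Strict Implicit.
Unset Printing Implicit Defensive.

Import Order.TTheory GRing.Theory Num.Theory.
Import numFieldNormedType.Exports.

Local Open Scope classical_set_scope.
Local Open Scope ring_scope.

(** * The map, its invariant and its periodic points of low period *)

(** Taken two terms at a time, the recurrence iterates [F := lyness_map a b] on the positive
    quadrant, and period [2 * p] means [iter p F z = z] ([is_period_orbit]); an odd period forces
    [a = b] ([odd_period_eq]). [F] preserves [lyness_inv], which in logarithmic coordinates about
    the critical point [c] increases strictly along every ray ([lyness_inv_ray]). A point is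
    therefore determined by its level and its direction, and it is fixed by [iter n F] exactly when
    [rotation n z], the angle swept in [n] steps, is a multiple of [2 * pi] ([rotation_closed],
    [rotation_multiple]). If it is [q] turns with [n] and [q] coprime, then [n] is the minimal
    period under [F] ([prime_rotation]).

    Existence rests on two limits: at [c] the rotation per step is [2 * pi * sigma]
    ([rotation_near_critical]), and far away its mean over five consecutive points is
    [2 * pi * 2 / 5] ([infinity_rotation]). The intermediate value theorem on a segment ending at
    [c] realizes every [q / n] strictly between [sigma] and [2 / 5] ([exists_rotation]). [F] also
    preserves the Hamiltonian field of [lyness_inv], so a whole arc through such a point is periodic
    ([porism_arc], [periodic_continuum]). A sieve with explicit error yields an admissible [q] for
    each [n] beyond a bound that depends only on the length of the interval ([coprime_in_interval]),
    and a loop computes that bound ([threshold_programP]). If [sigma] is [2 / 5] the interval is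
    empty, but on a level where the fifth iterate is not the identity the rotation stays a fixed
    distance from [2 / 5] ([level_gap]), which opens another interval ([resonant_rotation]).

    For the set of periods, [fixed2] and [fixed3] confine rotation numbers of periodic points to
    []1/3, 1/2[] ([periodic_rotation_range]), which rules out [p = 2, 3, 4, 6]; [p = 10] would
    require [4 / 10] and reduces to the fifth iterate ([periodic10]). Conversely [sigma] takes every
    value of []1/3, 1/2[] ([rotation_realization]), and a suitable [q] exists for the other [p]
    ([periodic_rotation_choice]), except [p = 1], given by a critical point, and [p = 5], given by
    an explicit cycle. *)

Lemma ivt_sign (R : realType) (f : R -> R) (u v l : R) : u <= v ->
  (forall x, u <= x <= v -> {for x, continuous f}) ->
  (f u - l) * (f v - l) <= 0 -> exists2 c, u <= c <= v & f c = l.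
Proof.
move=> uv fc fuv; have [||c] := @IVT R f u v l uv.
- by apply: continuous_in_subspaceT => x; rewrite inE /= in_itv /=; exact: fc.
- apply/andP; split; rewrite ?ge_min ?le_max; apply: contraTT fuv;
    rewrite negb_or -!ltNge => /andP[h1 h2].
    by rewrite mulr_gt0 ?subr_gt0.
  by rewrite nmulr_rgt0 subr_lt0.
- by rewrite in_itv /=; exists c.
Qed.

Section Algebra.
Context {R : realType}.
Implicit Types (a b x y s t : R) (z : R * R).

Definition lyness_step a z : R * R := (z.2, (a + z.2) / z.1).
Definition lyness_map a b z : R * R := lyness_step b (lyness_step a z).
Definition quadrant z : bool := (0 < z.1) && (0 < z.2).

Definition lyness_inv a b z : R :=
  a * z.1 + b * z.2 + b * (z.1 / z.2) + a * (z.2 / z.1)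
  + (a + b ^+ 2) / z.2 + (b + a ^+ 2) / z.1 + a * b / (z.1 * z.2).

Definition critical a b z : bool :=
  [&& quadrant z, z.1 ^+ 2 == a + z.2 & z.2 ^+ 2 == b + z.1].

(** Away from the critical point, a point of level [h] is fixed by the fifth iterate exactly when
    this affine function of [h] vanishes ([torsion5_periodic], [periodic5_torsion]). *)
Definition torsion5 a b (h : R) : R :=
  (a * b - 1) * h + (a ^+ 3 + b ^+ 3 + a ^+ 2 * b ^+ 2 - 2 * a * b - 1).

Lemma quadrant_step a z : 0 < a -> quadrant z -> quadrant (lyness_step a z).
Proof. by case: z => x y a0 /andP[/= x0 y0]; rewrite /quadrant /= y0 divr_gt0 ?addr_gt0. Qed.

Lemma quadrant_map a b z :
  0 < a -> 0 < b -> quadrant z -> quadrant (lyness_map a b z).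
Proof. by move=> a0 b0 z0; rewrite /lyness_map !quadrant_step. Qed.

Lemma quadrant_iter a b i z :
  0 < a -> 0 < b -> quadrant z -> quadrant (iter i (lyness_map a b) z).
Proof. by move=> a0 b0 z0; elim: i => //= i; exact: quadrant_map. Qed.

Lemma lyness_inv_step a b z : 0 < a -> quadrant z ->
  lyness_inv b a (lyness_step a z) = lyness_inv a b z.
Proof.
case: z => x y a0 /andP[/= x0 y0]; rewrite /lyness_inv /lyness_step /=.
have ay : 0 < a + y by rewrite addr_gt0.
by field; rewrite !gt_eqF.
Qed.

Lemma lyness_inv_iter a b i z : 0 < a -> 0 < b -> quadrant z ->
  lyness_inv a b (iter i (lyness_map a b) z) = lyness_inv a b z.
Proof.
move=> a0 b0 z0; elim: i => //= i <-; set w := iter _ _ _.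
have w0 : quadrant w by exact: quadrant_iter.
by rewrite /lyness_map !lyness_inv_step ?quadrant_step.
Qed.

Lemma critical_fixed a b z : quadrant z ->
  (lyness_map a b z == z) = critical a b z.
Proof.
case: z => x y z0; rewrite /critical z0 /=; have /andP[/= x0 y0] := z0.
apply/eqP/andP => [[]|[/eqP xE /eqP yE]].
  move=> e1 e2; rewrite e1 in e2; split; apply/eqP.
    by rewrite expr2 -{1}e1 divfK ?gt_eqF.
  by rewrite expr2 -{1}e2 divfK ?gt_eqF.
rewrite /lyness_map /lyness_step /= -xE expr2 mulfK ?gt_eqF //.
by rewrite -yE expr2 mulfK ?gt_eqF.
Qed.

(** The square of [x * y] is [(a + y) * (b + x)], which exceeds [x * y]. The bound makes the
    critical point unique and its differential elliptic. *)
Lemma critical_prod_gt1 a b z : 0 < a -> 0 < b -> critical a b z -> 1 < z.1 * z.2.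
Proof.
case: z => x y a0 b0 /and3P[/andP[/= x0 y0] /eqP xE /eqP yE].
have xy0 : 0 < x * y by rewrite mulr_gt0.
have : (x * y) * 1 < (x * y) * (x * y).
  rewrite mulr1 -expr2 exprMn xE yE mulrDl mulrDr.
  by have := mulr_gt0 a0 b0; have := mulr_gt0 a0 x0; have := mulr_gt0 y0 b0; nra.
by rewrite ltr_pM2l.
Qed.

Lemma critical_uniq a b z w : 0 < a -> 0 < b ->
  critical a b z -> critical a b w -> z = w.
Proof.
move=> a0 b0 cz cw.
have := critical_prod_gt1 a0 b0 cz.
case: z w cz cw => [x y] [x' y'] /and3P[/andP[/= x0 y0] /eqP xE /eqP yE].
move=> /and3P[/andP[/= x0' y0'] /eqP xE' /eqP yE'] xy1.
have e1 : (x + x') * (x - x') = y - y' by rewrite mulrC -subr_sqr xE xE'; ring.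
have e2 : (y + y') * (y - y') = x - x' by rewrite mulrC -subr_sqr yE yE'; ring.
have : ((x + x') * (y + y') - 1) * (x - x') = 0.
  rewrite mulrBl mul1r -[X in _ - X]e2 -e1; ring.
move/eqP; rewrite mulf_eq0 => /orP[/eqP|].
  move=> h; exfalso; move: h xy1 => /= h xy1.
  have := mulr_gt0 x0 y0'; have := mulr_gt0 x0' y0; have := mulr_gt0 x0' y0'; nra.
rewrite subr_eq0 => /eqP xx; congr pair => //.
by apply/eqP; rewrite -subr_eq0 -e1 xx subrr mulr0.
Qed.

(** Eliminating [x = y ^+ 2 - b] leaves a quartic in [y]; a root beyond the square root of [b] keeps
    [x] positive. *)
Lemma critical_exists a b : 0 < a -> 0 < b -> exists z : R * R, critical a b z.
Proof.
move=> a0 b0; pose f (y : R) := (y ^+ 2 - b) ^+ 2 - a - y.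
pose m := Num.sqrt b; pose M := 1 + a + b.
have m0 : 0 < m by rewrite sqrtr_gt0.
have mE : m ^+ 2 = b by rewrite sqr_sqrtr // ltW.
have mM : m <= M by rewrite /M; nra.
have fm : f m < 0 by rewrite /f mE; lra.
have fM : 0 < f M.
  rewrite /f /M; set t := _ ^+ 2 - b.
  have : 1 + a + b <= t by rewrite /t; nra.
  nra.
have [||y /andP[my yM] fy] := @ivt_sign R f m M 0 mM.
- move=> y _; rewrite /f.
  apply: cvgB; last exact: cvg_id.
  apply: cvgB; last exact: cvg_cst.
  apply: (@continuous_comp _ _ _ (fun y => y ^+ 2 - b) (fun t => t ^+ 2)); last exact: exprn_continuous.
  by apply: cvgB; [exact: exprn_continuous | exact: cvg_cst].
- by rewrite !subr0 mulr_le0_ge0 ?ltW.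
- have y0 : 0 < y by exact: lt_le_trans my.
  have ym : y != m by apply/eqP => ym; move: fy; rewrite /f ym mE; lra.
  exists (y ^+ 2 - b, y); apply/and3P; split; last first.
  + by apply/eqP => /=; ring.
  + by apply/eqP => /=; move: fy; rewrite /f; lra.
  rewrite /quadrant /= y0 andbT subr_gt0 -mE ltrXn2r ?nnegrE ?ltW //.
  by rewrite lt_neqAle eq_sym ym.
Qed.

(** On a 2-cycle [a + y] and [a + y'] both equal [x * x'], while [b + x] and [b + x'] both equal
    [y * y']. *)
Lemma fixed2 a b z : 0 < a -> 0 < b -> quadrant z ->
  iter 2 (lyness_map a b) z = z -> critical a b z.
Proof.
move=> a0 b0 z0 zE; rewrite -critical_fixed //; apply/eqP.
move: (quadrant_map a0 b0 z0) zE => /=.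
case zw: (lyness_map a b z) => [x' y'] /andP[/= x'0 y'0].
case: z z0 zw => x y /andP[/= x0 y0].
rewrite /lyness_map /lyness_step /= => -[e1 e2] [e3 e4].
have r1 : a + y = x' * x by rewrite -e1 divfK ?gt_eqF.
have r2 : b + x' = y' * y by rewrite -e2 e1 divfK ?gt_eqF.
have r3 : a + y' = x * x' by rewrite -e3 divfK ?gt_eqF.
have r4 : b + x = y * y' by rewrite -e4 e3 divfK ?gt_eqF.
by congr pair; nra.
Qed.

(** The six relations of a 3-cycle combine into [(a * y + b) * (x1 - x) = 0] and
    [(b * x1 + a) * (y1 - y) = 0], whose first factors are positive. *)
Lemma fixed3 a b z : 0 < a -> 0 < b -> quadrant z ->
  iter 3 (lyness_map a b) z = z -> critical a b z.
Proof.
move=> a0 b0 z0 zE; rewrite -critical_fixed //; apply/eqP.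
move: (quadrant_map a0 b0 z0) (quadrant_map a0 b0 (quadrant_map a0 b0 z0)) zE => /=.
case wv: (lyness_map a b (lyness_map a b z)) => [x2 y2].
move: wv; case zw: (lyness_map a b z) => [x1 y1].
case: z z0 zw => x y /andP[/= x_gt0 y_gt0].
rewrite /lyness_map /lyness_step /= => -[e1 e2] [e3 e4] /andP[/= x1_gt0 y1_gt0].
move=> /andP[/= x2_gt0 y2_gt0] [e5 e6].
have r1 : a + y = x1 * x by rewrite -e1 divfK ?gt_eqF.
have r2 : b + x1 = y1 * y by rewrite -e2 e1 divfK ?gt_eqF.
have r3 : a + y1 = x2 * x1 by rewrite -e3 divfK ?gt_eqF.
have r4 : b + x2 = y2 * y1 by rewrite -e4 e3 divfK ?gt_eqF.
have r5 : a + y2 = x * x2 by rewrite -e5 divfK ?gt_eqF.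
have r6 : b + x = y * y2 by rewrite -e6 e5 divfK ?gt_eqF.
have hx : (a * y + b) * (x1 - x) = 0.
  have -> : (a * y + b) * (x1 - x) = x1 * (y * (a + y2)) - x * (y * (a + y1))
    + x1 * ((b + x) - y * y2) - x * ((b + x1) - y1 * y) by ring.
  by rewrite r5 r3 r2 r6; ring.
have hy : (b * x1 + a) * (y1 - y) = 0.
  have -> : (b * x1 + a) * (y1 - y) = y1 * (x1 * (b + x)) - y * (x1 * (b + x2))
    + y1 * ((a + y) - x1 * x) - y * ((a + y1) - x2 * x1) by ring.
  by rewrite r6 r4 r1 r3; ring.
congr pair.
  apply/eqP; move/eqP: hx; rewrite mulf_eq0 gt_eqF ?addr_gt0 ?mulr_gt0 //=.
  by rewrite subr_eq0.
apply/eqP; move/eqP: hy; rewrite mulf_eq0 gt_eqF ?addr_gt0 ?mulr_gt0 //=.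
by rewrite subr_eq0.
Qed.

End Algebra.

(** * Points fixed by the fifth iterate *)

Section Torsion.
Context {R : realType}.
Implicit Types (a b x y s t : R) (z : R * R).

Lemma lyness_map_swap a b n z :
  iter n (lyness_map b a) (lyness_step a z) = lyness_step a (iter n (lyness_map a b) z).
Proof. by elim: n => //= n ->. Qed.

(** The recurrence is reversible. Counting terms from 0, so that [z] is [(u0, u1)], running it from
    [(u5, u6)] gives [u10], and running the same formula from [(u5, u4)] goes back to [u0]. *)
Definition four_terms a b s t : R :=
  let u7 := (b + t) / s in let u8 := (a + u7) / t in
  let u9 := (b + u8) / u7 in (a + u9) / u8.

(** The forward and backward values agree at [t = p]; once [t * p = a + s] is used, the cofactor of
    [t - p] depends on the level alone up to a positive factor. *)
Lemma four_termsB a b p s t : 0 < a -> 0 < b -> 0 < s -> 0 < t -> p = (a + s) / t ->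
  four_terms a b s t - four_terms a b s p =
  s ^+ 2 / ((b + t) * (a * s + b + t) * (b + p) * (a * s + b + p)) * (t - p)
  * torsion5 a b (lyness_inv a b (p, s)).
Proof.
move=> a0 b0 s0 t0 pE.
have p0 : 0 < p by rewrite pE divr_gt0 ?addr_gt0.
have D u : 0 < u -> four_terms a b s u =
  s * (a * u ^+ 2 + a * b * u + b * s * u + a * s + b + u)
    / ((b + u) * (a * s + b + u)).
  move=> u0; rewrite /four_terms.
  by field; rewrite !(gt_eqF, addr_gt0, mulr_gt0).
rewrite !D // /torsion5 /lyness_inv /= pE.
field; rewrite !(gt_eqF, addr_gt0, mulr_gt0) //.
Qed.

Lemma map5_sub1 a b z : 0 < a -> 0 < b -> quadrant z -> exists2 K, 0 < K &
  (iter 5 (lyness_map a b) z).1 - z.1 =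
  K * ((iter 3 (lyness_map a b) z).1 - (iter 2 (lyness_map a b) z).1)
  * torsion5 a b (lyness_inv a b z).
Proof.
move=> a0 b0 z0; rewrite -(lyness_inv_iter 2 a0 b0 z0).
have w0 := quadrant_iter 2 a0 b0 z0.
have : z.1 = four_terms a b (iter 2 (lyness_map a b) z).2 (iter 2 (lyness_map a b) z).1.
  case: z z0 w0 => x y /andP[/= x0 y0] /andP[/=].
  rewrite /lyness_map /lyness_step /four_terms /= => h1 h2.
  by field; rewrite !(gt_eqF, addr_gt0, mulr_gt0).
have -> : (iter 5 (lyness_map a b) z).1 = four_terms a b (iter 2 (lyness_map a b) z).2 (iter 3 (lyness_map a b) z).1.
  by [].
rewrite [iter 3 _ z]/=.
rewrite -/(iter 2 (lyness_map a b) z).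
case: (iter 2 (lyness_map a b) z) w0 => p s /andP[/= p0 s0] ->.
set t := (lyness_map a b (p, s)).1.
have t0 : 0 < t by rewrite /t /= divr_gt0 ?addr_gt0.
rewrite (@four_termsB a b p s t) //; last first.
  by rewrite /t /=; field; rewrite !(gt_eqF, addr_gt0, mulr_gt0).
eexists; last reflexivity.
by rewrite !(divr_gt0, exprn_gt0, mulr_gt0, addr_gt0).
Qed.

(** After one step the second coordinate becomes the first and [a], [b] are exchanged, so
    [map5_sub1] applies. *)
Lemma map5_sub2 a b z : 0 < a -> 0 < b -> quadrant z -> exists2 K, 0 < K &
  (iter 5 (lyness_map a b) z).2 - z.2 =
  K * ((iter 3 (lyness_map a b) z).2 - (iter 2 (lyness_map a b) z).2)
  * torsion5 a b (lyness_inv a b z).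
Proof.
move=> a0 b0 z0.
have [K K0] := map5_sub1 b0 a0 (quadrant_step a0 z0).
rewrite lyness_inv_step // !lyness_map_swap => e; exists K => //.
by rewrite [LHS]e /torsion5; congr (_ * _); ring.
Qed.

Lemma torsion5_periodic a b z : 0 < a -> 0 < b -> quadrant z ->
  torsion5 a b (lyness_inv a b z) = 0 -> iter 5 (lyness_map a b) z = z.
Proof.
move=> a0 b0 z0 T; have [K1 _ e1] := map5_sub1 a0 b0 z0.
have [K2 _ e2] := map5_sub2 a0 b0 z0.
rewrite [LHS]surjective_pairing [RHS]surjective_pairing.
by congr pair; apply/eqP; rewrite -subr_eq0 (e1, e2) T mulr0.
Qed.

Lemma periodic5_torsion a b z : 0 < a -> 0 < b -> quadrant z ->
  iter 5 (lyness_map a b) z = z ->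
  critical a b z \/ torsion5 a b (lyness_inv a b z) = 0.
Proof.
move=> a0 b0 z0 zE; have [K1 K10] := map5_sub1 a0 b0 z0.
have [K2 K20] := map5_sub2 a0 b0 z0; rewrite zE !subrr.
have [->|T0] := eqVneq (torsion5 a b (lyness_inv a b z)) 0; first by right.
move=> /esym/eqP; rewrite !mulf_eq0 (negPf T0) orbF (gt_eqF K20) /= subr_eq0 => /eqP e2.
move=> /esym/eqP; rewrite !mulf_eq0 (negPf T0) orbF (gt_eqF K10) /= subr_eq0 => /eqP e1.
left.
have w0 := quadrant_iter 2 a0 b0 z0.
have fw : lyness_map a b (iter 2 (lyness_map a b) z) = iter 2 (lyness_map a b) z.
  by rewrite [LHS]surjective_pairing [RHS]surjective_pairing; congr pair.
(* The second iterate of [z] is a fixed point, and [z], being the third iterate of it, coincides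
   with it. *)
suff -> : z = iter 2 (lyness_map a b) z by rewrite -critical_fixed //; apply/eqP.
by rewrite -[LHS]zE [LHS](iterD 3 2) 2!iterSr fw /= !fw.
Qed.

(** The slope is [a * b - 1]. When it is 0, the constant term times [a ^+ 3] equals
    [(a ^+ 3 - 1) ^+ 2], which vanishes only at [a = b = 1]. *)
Lemma torsion5_inj a b h h' : 0 < a -> 0 < b -> (a, b) <> (1, 1) ->
  torsion5 a b h = 0 -> torsion5 a b h' = 0 -> h = h'.
Proof.
move=> a0 b0 ab; rewrite /torsion5 => e e'; apply/eqP; apply: contra_notT ab => hh.
have : (a * b - 1) * (h - h') = 0.
  by transitivity ((0 : R) - 0); [rewrite -{1}e -{1}e'; ring | ring].
move/eqP; rewrite mulf_eq0 subr_eq0 [h - h' == _]subr_eq0 (negPf hh) orbF => /eqP ab1.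
have : (a ^+ 3 - 1) ^+ 2 = 0.
  have -> : (a ^+ 3 - 1) ^+ 2 = a ^+ 3 * ((a * b - 1) * h +
     (a ^+ 3 + b ^+ 3 + a ^+ 2 * b ^+ 2 - 2 * a * b - 1))
     + (1 - a * b) * (a ^+ 3 * h + (1 + a * b + a ^+ 2 * b ^+ 2) - a ^+ 3 * (1 - a * b)).
    ring.
  by rewrite e ab1; ring.
move/eqP; rewrite expf_eq0 /= subr_eq0 => /eqP a3.
have a1 : a = 1.
  apply/eqP; move/eqP: a3; rewrite -subr_eq0.
  have -> : a ^+ 3 - 1 = (a - 1) * (a ^+ 2 + a + 1) by ring.
  by rewrite mulf_eq0 [X in _ || X]gt_eqF ?orbF ?subr_eq0 // ?addr_gt0 ?exprn_gt0.
by move: ab1; rewrite a1 mul1r => ->.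
Qed.

End Torsion.

(** * Angles and winding of plane sequences *)

Section Angle.
Context {R : realType}.
Implicit Types (v w : R * R) (x : R).

Definition dot v w : R := v.1 * w.1 + v.2 * w.2.
Definition cross v w : R := v.1 * w.2 - v.2 * w.1.
Definition nrm v : R := Num.sqrt (dot v v).
(** Strict Cauchy-Schwarz without absolute value: the vectors are nonzero and not positively
    parallel, so the denominator in [angle] is positive. *)
Definition apart v w : bool := dot v w < nrm v * nrm w.

(* The counterclockwise angle in ]0, 2 pi[ from v to w: atan of its half's    *)
(* cotangent, which is continuous also when the angle crosses pi.             *)
Definition angle v w : R :=
  pi - 2 * atan (cross v w / (nrm v * nrm w - dot v w)).

Lemma dot_ge0 v : 0 <= dot v v.
Proof. by rewrite addr_ge0 // -expr2 sqr_ge0. Qed.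

Lemma nrm_ge0 v : 0 <= nrm v. Proof. exact: sqrtr_ge0. Qed.

Lemma sqr_nrm v : nrm v ^+ 2 = dot v v.
Proof. by rewrite sqr_sqrtr ?dot_ge0. Qed.

Lemma nrm_gt0 v : (0 < nrm v) = (v != 0).
Proof.
rewrite sqrtr_gt0 lt0r dot_ge0 andbT; case: v => x y; rewrite /dot /= -!expr2.
by rewrite paddr_eq0 ?sqr_ge0 // !sqrf_eq0.
Qed.

Lemma lagrange v w : (nrm v * nrm w) ^+ 2 = dot v w ^+ 2 + cross v w ^+ 2.
Proof. by rewrite exprMn !sqr_nrm /dot /cross; ring. Qed.

Lemma apart_neq0 v w : apart v w -> v != 0 /\ w != 0.
Proof.
rewrite /apart => vw; split; apply: contraTneq vw => ->;
  by rewrite /dot /nrm /= /dot /= !(mulr0, mul0r, addr0, sqrtr0) ltxx.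
Qed.

Lemma apart_intro v w : v != 0 -> w != 0 ->
  (forall l, 0 < l -> w.1 = l * v.1 -> w.2 = l * v.2 -> False) -> apart v w.
Proof.
move=> v0 w0 vw; rewrite /apart ltNge; apply/negP => h.
have nv : 0 < nrm v by rewrite nrm_gt0.
have nw : 0 < nrm w by rewrite nrm_gt0.
have d0 : 0 < dot v w by apply: lt_le_trans h; rewrite mulr_gt0.
have c0 : cross v w = 0.
  apply/eqP; rewrite -sqrf_eq0 eq_le sqr_ge0 andbT.
  have := lagrange v w; have : (nrm v * nrm w) ^+ 2 <= dot v w ^+ 2.
    by rewrite ler_sqr ?nnegrE ?mulr_ge0 ?nrm_ge0 // ltW.
  lra.
have vv : 0 < dot v v by rewrite -sqr_nrm exprn_gt0.
have vvE t : dot v v * (dot v w / dot v v * t) = dot v w * t.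
  by field; rewrite gt_eqF.
apply: (vw (dot v w / dot v v)); first by rewrite divr_gt0.
- apply: (mulfI (lt0r_neq0 vv)); rewrite vvE.
  apply/eqP; rewrite -subr_eq0; apply/eqP.
  by transitivity (- v.2 * cross v w); [rewrite /dot /cross; ring | rewrite c0 mulr0].
- apply: (mulfI (lt0r_neq0 vv)); rewrite vvE.
  apply/eqP; rewrite -subr_eq0; apply/eqP.
  by transitivity (v.1 * cross v w); [rewrite /dot /cross; ring | rewrite c0 mulr0].
Qed.

Lemma angle_gt0 v w : 0 < angle v w.
Proof. by have := atan_ltpi2 (cross v w / (nrm v * nrm w - dot v w)); rewrite /angle; lra. Qed.

Lemma angle_lt2pi v w : angle v w < 2 * pi.
Proof. by have := atan_gtNpi2 (cross v w / (nrm v * nrm w - dot v w)); rewrite /angle; lra. Qed.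

(** Half-angle formulas: with [T] the cotangent of the half angle, [lagrange] gives
    [1 + T ^+ 2 = 2 * N / (N - dot v w)]. *)
Lemma cos_sin_angle v w : apart v w ->
  nrm v * nrm w * cos (angle v w) = dot v w /\
  nrm v * nrm w * sin (angle v w) = cross v w.
Proof.
move=> vw; have [v0 w0] := apart_neq0 vw.
rewrite /angle; set N := nrm v * nrm w; set T := cross v w / _; have N0 : 0 < N by rewrite mulr_gt0 ?nrm_gt0.
have D0 : 0 < N - dot v w by rewrite subr_gt0.
have cT : cos (atan T) ^+ 2 = (1 + T ^+ 2)^-1.
  by rewrite cos_atan exprVn sqr_sqrtr // addr_ge0 ?sqr_ge0.
have c0 : cos (atan T) != 0.
  by rewrite gt_eqF // cos_gt0_pihalf // atan_gtNpi2 atan_ltpi2.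
have sT : sin (atan T) = T * cos (atan T) by rewrite -{2}(atanK T) /tan divfK.
have T1 : 1 + T ^+ 2 = 2 * N / (N - dot v w).
  have L := lagrange v w; rewrite -/N in L.
  have cE : cross v w ^+ 2 = (N - dot v w) * (N + dot v w) by rewrite -subr_sqr L; ring.
  rewrite /T expr_div_n cE; field; exact: lt0r_neq0.
have cc : cos (atan T) ^+ 2 = (N - dot v w) / (2 * N).
  by rewrite cT T1; field; rewrite !gt_eqF.
have -> : 2 * atan T = atan T *+ 2 by rewrite mulr2n; ring.
rewrite cosB sinB cospi sinpi !mul0r addr0 sub0r mulN1r mulN1r opprK.
rewrite cos_mulr2n sin_mulr2n sT; split.
  by rewrite -mulr_natl cc; field; rewrite !gt_eqF.
have -> : cos (atan T) * (T * cos (atan T)) = T * cos (atan T) ^+ 2 by ring.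
by rewrite -mulr_natl cc /T; field; rewrite !gt_eqF.
Qed.

Lemma cos_eq1 x : 0 <= x -> cos x = 1 -> exists n : nat, x = n%:R * (2 * pi).
Proof.
move=> x0 cx; have p0 : 0 < 2 * pi :> R by rewrite mulr_gt0 ?pi_gt0.
pose n := Num.truncn (x / (2 * pi)); exists n.
have /andP[n1 n2] : n%:R <= x / (2 * pi) < n.+1%:R.
  by rewrite truncn_itv // divr_ge0 // ltW.
move: n1 n2; rewrite ler_pdivlMr // ltr_pdivrMr // -natr1 mulrDl mul1r => n1 n2.
set y := x - n%:R * (2 * pi).
have y2 : y / 2 + y / 2 = y by field.
have xE : x = y + (pi *+ 2) *+ n by rewrite /y -mulr_natl -[pi *+ 2]mulr_natl; ring.
have cy : cos y = 1 by rewrite -cx xE periodicn //; exact: cosD2pi.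
have [y_eq0|y_neq0] := eqVneq y 0; first by rewrite -[LHS]subr0 -y_eq0 /y; ring.
have y0 : 0 < y by rewrite lt0r y_neq0 /y; lra.
have s0 : 0 < sin (y / 2) by apply: sin_gt0_pi; rewrite /y in y0 *; lra.
move: cy; rewrite -y2 cosD -!expr2 cos2sin2.
by have := exprn_gt0 2 s0; lra.
Qed.

Lemma angle_unique v w x : apart v w -> 0 < x < 2 * pi ->
  nrm v * nrm w * cos x = dot v w -> nrm v * nrm w * sin x = cross v w ->
  angle v w = x.
Proof.
move=> vw /andP[x0 x1] cx sx; have [v0 w0] := apart_neq0 vw.
have [ca sa] := cos_sin_angle vw.
have N0 : nrm v * nrm w != 0 by rewrite mulf_neq0 // gt_eqF // nrm_gt0.
have ce : cos (angle v w) = cos x by apply: (mulfI N0); rewrite ca cx.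
have se : sin (angle v w) = sin x by apply: (mulfI N0); rewrite sa sx.
have := angle_gt0 v w; have := angle_lt2pi v w => a1 a0.
have [|n nE] := @cos_eq1 `|angle v w - x| (normr_ge0 _).
  by rewrite cos_norm cosB ce se -!expr2 cos2Dsin2.
have : `|angle v w - x| < 2 * pi by rewrite ltr_norml; apply/andP; split; lra.
rewrite nE; case: n nE => [|n] nE.
  by move: nE => /eqP; rewrite mul0r normr_eq0 subr_eq0 => /eqP.
have p0 : 0 < 2 * pi :> R by rewrite mulr_gt0 ?pi_gt0.
by rewrite ltNge ler_peMl ?(ltW p0) // ?ler1n.
Qed.

Lemma angle_antipodal v w : cross v w = 0 -> angle v w = pi.
Proof. by rewrite /angle => ->; rewrite mul0r atan0 mulr0 subr0. Qed.

Lemma angle_ltpi v w : apart v w -> 0 < cross v w -> angle v w < pi.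
Proof.
move=> vw c0; have : atan 0 < atan (cross v w / (nrm v * nrm w - dot v w)).
  by apply: lt_atan; apply: divr_gt0 => //; rewrite subr_gt0.
by rewrite atan0 /angle; lra.
Qed.

Lemma nrm_scale l v : 0 < l -> nrm (l * v.1, l * v.2) = l * nrm v.
Proof.
move=> l0; rewrite /nrm /dot /=.
have -> : l * v.1 * (l * v.1) + l * v.2 * (l * v.2) = l ^+ 2 * (v.1 * v.1 + v.2 * v.2) by ring.
by rewrite sqrtrM ?sqr_ge0 // sqrtr_sqr gtr0_norm.
Qed.

Lemma angle_scale l v w : 0 < l ->
  angle (l * v.1, l * v.2) (l * w.1, l * w.2) = angle v w.
Proof.
move=> l0; rewrite /angle !nrm_scale //; congr (_ - _ * atan _).
have -> : cross (l * v.1, l * v.2) (l * w.1, l * w.2) = l ^+ 2 * cross v w.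
  by rewrite /cross /=; ring.
have -> : l * nrm v * (l * nrm w) - dot (l * v.1, l * v.2) (l * w.1, l * w.2)
  = l ^+ 2 * (nrm v * nrm w - dot v w) by rewrite /dot /=; ring.
by rewrite -mulf_div divff ?mul1r // gt_eqF // exprn_gt0.
Qed.

Lemma cvg_angle (T : Type) (F : set_system T) (FF : Filter F) (f g : T -> R * R) v w :
  apart v w ->
  (fun t => (f t).1) @ F --> v.1 -> (fun t => (f t).2) @ F --> v.2 ->
  (fun t => (g t).1) @ F --> w.1 -> (fun t => (g t).2) @ F --> w.2 ->
  (fun t => angle (f t) (g t)) @ F --> angle v w.
Proof.
move=> vw f1 f2 g1 g2; rewrite /angle.
have cdot (f' g' : T -> R * R) v' w' : (fun t => (f' t).1) @ F --> v'.1 ->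
    (fun t => (f' t).2) @ F --> v'.2 -> (fun t => (g' t).1) @ F --> w'.1 ->
    (fun t => (g' t).2) @ F --> w'.2 -> (fun t => dot (f' t) (g' t)) @ F --> dot v' w'.
  by move=> *; apply: cvgD; apply: cvgM.
have cnrm (f' : T -> R * R) v' : (fun t => (f' t).1) @ F --> v'.1 ->
    (fun t => (f' t).2) @ F --> v'.2 -> (fun t => nrm (f' t)) @ F --> nrm v'.
  move=> h1 h2; rewrite /nrm.
  by apply: (@continuous_cvg _ R R F _ _ (@Num.sqrt R)); [exact: sqrt_continuous | exact: cdot].
apply: cvgB; first exact: cvg_cst.
apply: cvgM; first exact: cvg_cst.
apply: (@continuous_cvg _ R R F _ _ (@atan R)); first exact: continuous_atan.
apply: cvgM.
  by apply: cvgB; apply: cvgM.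
apply: cvgV; first by rewrite subr_eq0 gt_eqF.
by apply: cvgB; [apply: cvgM; exact: cnrm | exact: cdot].
Qed.

Definition winding (v : nat -> R * R) n : R := \sum_(i < n) angle (v i) (v i.+1).

Lemma winding_ge0 (v : nat -> R * R) n : 0 <= winding v n.
Proof. by apply: sumr_ge0 => i _; rewrite ltW ?angle_gt0. Qed.

(** By the addition formulas, the sum of the increments is a real-valued lift of the angle from the
    first vector to the last. *)
Lemma cos_sin_winding (v : nat -> R * R) n :
  (forall i, apart (v i) (v i.+1)) ->
  nrm (v 0%N) * nrm (v n) * cos (winding v n) = dot (v 0%N) (v n) /\
  nrm (v 0%N) * nrm (v n) * sin (winding v n) = cross (v 0%N) (v n).
Proof.
move=> vv; elim: n => [|n [ihc ihs]].
  rewrite /winding big_ord0 cos0 sin0 mulr1 mulr0 -expr2 sqr_nrm; split => //.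
  by rewrite /cross; ring.
have [ca sa] := cos_sin_angle (vv n).
rewrite /winding big_ord_recr /= -/(winding v n).
have n0 : nrm (v n) ^+ 2 != 0.
  by have [h _] := apart_neq0 (vv n); rewrite gt_eqF // exprn_gt0 // nrm_gt0.
set A := winding v n in ihc ihs *; set B := angle _ _ in ca sa *.
have cosAB := cosD A B; have sinAB := sinD A B.
have E1 : nrm (v n) ^+ 2 * dot (v 0%N) (v n.+1)
   = dot (v 0%N) (v n) * dot (v n) (v n.+1) - cross (v 0%N) (v n) * cross (v n) (v n.+1).
  by rewrite sqr_nrm /dot /cross; ring.
have E2 : nrm (v n) ^+ 2 * cross (v 0%N) (v n.+1)
   = cross (v 0%N) (v n) * dot (v n) (v n.+1) + dot (v 0%N) (v n) * cross (v n) (v n.+1).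
  by rewrite sqr_nrm /dot /cross; ring.
split; apply: (mulfI n0); rewrite (E1, E2) -ihc -ihs -ca -sa ?cosAB ?sinAB; ring.
Qed.

Lemma winding_closed (v : nat -> R * R) n : (forall i, apart (v i) (v i.+1)) ->
  v n = v 0%N -> exists m : nat, winding v n = m%:R * (2 * pi).
Proof.
move=> vv vn; apply: cos_eq1; first exact: winding_ge0.
have [c _] := cos_sin_winding n vv; have [h _] := apart_neq0 (vv 0%N).
rewrite vn -expr2 sqr_nrm in c.
have d0 : dot (v 0%N) (v 0%N) != 0 by rewrite -sqr_nrm expf_neq0 // gt_eqF // nrm_gt0.
by apply: (mulfI d0); rewrite c mulr1.
Qed.

(** A converse of [winding_closed] up to length: only the direction is recovered, and the level will
    supply the length. *)
Lemma winding_multiple (v : nat -> R * R) n (m : nat) :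
  (forall i, apart (v i) (v i.+1)) -> winding v n = m%:R * (2 * pi) ->
  exists2 l, 0 < l & v n = (l * (v 0%N).1, l * (v 0%N).2).
Proof.
move=> vv wn; have [c s] := cos_sin_winding n vv.
have [h _] := apart_neq0 (vv 0%N); have [h' _] := apart_neq0 (vv n).
have e : m%:R * (2 * pi) = 0 + (pi *+ 2) *+ m :> R.
  by rewrite -mulr_natl -[pi *+ 2]mulr_natl; ring.
move: c s; rewrite wn e periodicn; last exact: cosD2pi.
rewrite periodicn; last exact: sinD2pi.
rewrite cos0 sin0 mulr1 mulr0 => c s.
have [//|na] := boolP (apart (v 0%N) (v n)); first by rewrite /apart c ltxx.
apply: contrapT => nl; move/negP: na; apply; apply: apart_intro => // l l0 e1 e2.
by apply: nl; exists l => //; rewrite [LHS]surjective_pairing e1 e2.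
Qed.

End Angle.

(** * Logarithmic coordinates *)

Section LogCoordinates.
Context {R : realType}.
Implicit Types (a b l M : R) (c z p q : R * R).

Definition log_coord c z : R * R := (ln z.1 - ln c.1, ln z.2 - ln c.2).
Definition exp_coord c p : R * R := (c.1 * expR p.1, c.2 * expR p.2).

Lemma log_coordK c z : quadrant c -> quadrant z -> exp_coord c (log_coord c z) = z.
Proof.
case: z c => x y [xc yc] /andP[/= c1 c2] /andP[/= z1 z2].
rewrite /exp_coord /log_coord /= !expRB !lnK ?posrE //.
by congr pair; field; rewrite !gt_eqF.
Qed.

Lemma exp_coordK c p : quadrant c -> log_coord c (exp_coord c p) = p.
Proof.
case: p c => x y [xc yc] /andP[/= c1 c2].
rewrite /exp_coord /log_coord /= !lnM ?posrE ?expR_gt0 // !expRK.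
by congr pair; ring.
Qed.

Lemma quadrant_exp c p : quadrant c -> quadrant (exp_coord c p).
Proof. by case/andP => c1 c2; rewrite /quadrant /= !mulr_gt0 ?expR_gt0. Qed.

Lemma log_coord_eq0 c z : quadrant c -> quadrant z -> (log_coord c z == (0, 0)) = (z == c).
Proof.
move=> c0 z0; apply/eqP/eqP => [h|->]; last by rewrite /log_coord !subrr.
rewrite -(log_coordK c0 z0) h /exp_coord /= expR0 !mulr1.
by rewrite -surjective_pairing.
Qed.

(** A combination of exponentials of linear forms with positive coefficients: this is where
    convexity comes from. *)
Lemma lyness_inv_exp a b c p : quadrant c ->
  lyness_inv a b (exp_coord c p) =
    a * c.1 * expR p.1 + b * c.2 * expR p.2
  + b * (c.1 / c.2) * expR (p.1 - p.2) + a * (c.2 / c.1) * expR (p.2 - p.1)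
  + (a + b ^+ 2) / c.2 * expR (- p.2) + (b + a ^+ 2) / c.1 * expR (- p.1)
  + a * b / (c.1 * c.2) * expR (- p.1 - p.2).
Proof.
case: c p => xc yc [x y] /andP[/= c1 c2]; rewrite /lyness_inv /=.
rewrite !(expRD, expRN); have := expR_gt0 x; have := expR_gt0 y.
by move=> ey ex; field; rewrite !gt_eqF.
Qed.

(* The critical point is where the logarithmic gradient of the invariant      *)
(* vanishes; each equation below is one of its components.                    *)
Lemma critical_gradient a b c : critical a b c ->
  a * c.1 + b * (c.1 / c.2) - a * (c.2 / c.1) - (b + a ^+ 2) / c.1
    - a * b / (c.1 * c.2) = 0 /\
  b * c.2 - b * (c.1 / c.2) + a * (c.2 / c.1) - (a + b ^+ 2) / c.2
    - a * b / (c.1 * c.2) = 0.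
Proof.
case: c => x y /and3P[/andP[/= x0 y0] /eqP xE /eqP yE]; split.
  transitivity ((a * y + b) * (x ^+ 2 - (a + y)) / (x * y)).
    by field; rewrite !gt_eqF.
  by rewrite xE subrr mulr0 mul0r.
transitivity ((b * x + a) * (y ^+ 2 - (b + x)) / (x * y)).
  by field; rewrite !gt_eqF.
by rewrite yE subrr mulr0 mul0r.
Qed.

(** Combine [expR (l * m) >= expR m * (1 + (l - 1) * m)] with [(expR m - 1) * m >= 0]. *)
Lemma expR_ray l m : 1 < l -> (l - 1) * m <= expR (l * m) - expR m ?= iff (m == 0).
Proof.
move=> l1; apply/leifP; case: eqVneq => [->|m0]; first by rewrite !mulr0 subrr.
have -> : l * m = m + (l - 1) * m by ring.
rewrite expRD.
have h : 1 + (l - 1) * m < expR ((l - 1) * m).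
  by apply: expR_gt1Dx; rewrite mulf_neq0 // subr_eq0 gt_eqF.
have e0 := expR_gt0 m.
have h2 : 0 < (expR m - 1) * m.
  have [mn|mp|/eqP] := ltrgtP m 0; last by rewrite (negPf m0).
    by rewrite nmulr_rgt0 // subr_lt0 expR_lt1.
  by rewrite pmulr_lgt0 // subr_gt0 expR_gt1.
have h3 : 0 < expR m * (expR ((l - 1) * m) - (1 + (l - 1) * m)).
  by rewrite mulr_gt0 // subr_gt0.
nra.
Qed.

(** Add up [expR_ray] over the seven exponentials; the linear terms cancel by
    [critical_gradient]. *)
Lemma lyness_inv_ray a b c p l : 0 < a -> 0 < b -> critical a b c -> p != (0, 0) ->
  1 < l -> lyness_inv a b (exp_coord c p) < lyness_inv a b (exp_coord c (l * p.1, l * p.2)).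
Proof.
move=> a0 b0 cc p0 l1; have [g1 g2] := critical_gradient cc.
have /and3P[cq _ _] := cc; have /andP[c1 c2] := cq.
rewrite !lyness_inv_exp //= -!mulrBr -[- (l * p.1) - _]opprD -mulrDr -!mulrN.
rewrite [- (p.1 + p.2)]opprD.
have k1 : 0 < a * c.1 by rewrite mulr_gt0.
have k2 : 0 < b * c.2 by rewrite mulr_gt0.
have k3 : 0 < b * (c.1 / c.2) by rewrite mulr_gt0 ?divr_gt0.
have k4 : 0 < a * (c.2 / c.1) by rewrite mulr_gt0 ?divr_gt0.
have k5 : 0 < (a + b ^+ 2) / c.2 by rewrite divr_gt0 ?addr_gt0 ?exprn_gt0.
have k6 : 0 < (b + a ^+ 2) / c.1 by rewrite divr_gt0 ?addr_gt0 ?exprn_gt0.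
have k7 : 0 < a * b / (c.1 * c.2) by rewrite divr_gt0 ?mulr_gt0.
set K1 := a * c.1 in g1 k1 *; set K2 := b * c.2 in g2 k2 *.
set K3 := b * _ in g1 g2 k3 *; set K4 := a * (_ / _) in g1 g2 k4 *.
set K5 := (a + _) / _ in g2 k5 *; set K6 := (b + _) / _ in g1 k6 *.
set K7 := a * b / _ in g1 g2 k7 *.
have e (m : R) := expR_ray m l1.
have ge (K m : R) : 0 < K -> 0 <= K * (expR (l * m) - expR m - (l - 1) * m).
  by move=> K0; rewrite mulr_ge0 ?(ltW K0) // subr_ge0; exact: (e m).
have gt (K m : R) : 0 < K -> m != 0 -> 0 < K * (expR (l * m) - expR m - (l - 1) * m).
  by move=> K0 m0; rewrite mulr_gt0 // subr_gt0 (lt_leif (e m)).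
have S : (l - 1) * (K1 * p.1 + K2 * p.2 + K3 * (p.1 - p.2) + K4 * (p.2 - p.1)
   + K5 * (- p.2) + K6 * (- p.1) + K7 * (- p.1 - p.2)) = 0.
  transitivity ((l - 1) * (p.1 * (K1 + K3 - K4 - K6 - K7) + p.2 * (K2 - K3 + K4 - K5 - K7))).
    by ring.
  by rewrite g1 g2; ring.
have h3 := ge _ (p.1 - p.2) k3; have h4 := ge _ (p.2 - p.1) k4.
have h5 := ge _ (- p.2) k5; have h6 := ge _ (- p.1) k6.
have h7 := ge _ (- p.1 - p.2) k7.
(* Strictness comes from the first two exponentials, since [p.1] or [p.2] is nonzero. *)
have : 0 < K1 * (expR (l * p.1) - expR p.1 - (l - 1) * p.1)
         + K2 * (expR (l * p.2) - expR p.2 - (l - 1) * p.2).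
  have [p1|p1] := eqVneq p.1 0; last by rewrite ltr_pwDl ?gt ?ge.
  by rewrite ltr_wpDl ?gt ?ge //; apply: contraNneq p0 => p2; rewrite [p]surjective_pairing p1 p2.
clearbody K1 K2 K3 K4 K5 K6 K7; clear -S h3 h4 h5 h6 h7; lra.
Qed.

Lemma lyness_inv_min a b c p : 0 < a -> 0 < b -> critical a b c -> p != (0, 0) ->
  lyness_inv a b c < lyness_inv a b (exp_coord c p).
Proof.
move=> a0 b0 cc p0; have [g1 g2] := critical_gradient cc.
have /and3P[cq _ _] := cc; have /andP[c1 c2] := cq.
have -> : lyness_inv a b c = lyness_inv a b (exp_coord c (0, 0)).
  by rewrite /exp_coord /= expR0 !mulr1 -surjective_pairing.
rewrite !lyness_inv_exp //= !(subrr, oppr0, addr0) expR0 !mulr1.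
have k1 : 0 < a * c.1 by rewrite mulr_gt0.
have k2 : 0 < b * c.2 by rewrite mulr_gt0.
have k3 : 0 < b * (c.1 / c.2) by rewrite mulr_gt0 ?divr_gt0.
have k4 : 0 < a * (c.2 / c.1) by rewrite mulr_gt0 ?divr_gt0.
have k5 : 0 < (a + b ^+ 2) / c.2 by rewrite divr_gt0 ?addr_gt0 ?exprn_gt0.
have k6 : 0 < (b + a ^+ 2) / c.1 by rewrite divr_gt0 ?addr_gt0 ?exprn_gt0.
have k7 : 0 < a * b / (c.1 * c.2) by rewrite divr_gt0 ?mulr_gt0.
set K1 := a * c.1 in g1 k1 *; set K2 := b * c.2 in g2 k2 *.
set K3 := b * _ in g1 g2 k3 *; set K4 := a * (_ / _) in g1 g2 k4 *.
set K5 := (a + _) / _ in g2 k5 *; set K6 := (b + _) / _ in g1 k6 *.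
set K7 := a * b / _ in g1 g2 k7 *.
have ge (K m : R) : 0 < K -> 0 <= K * (expR m - 1 - m).
  by move=> K0; rewrite mulr_ge0 ?(ltW K0) //; have := expR_ge1Dx m; lra.
have gt (K m : R) : 0 < K -> m != 0 -> 0 < K * (expR m - 1 - m).
  by move=> K0 m0; rewrite mulr_gt0 //; have := expR_gt1Dx m0; lra.
have S : K1 * p.1 + K2 * p.2 + K3 * (p.1 - p.2) + K4 * (p.2 - p.1)
   + K5 * (- p.2) + K6 * (- p.1) + K7 * (- p.1 - p.2) = 0.
  transitivity (p.1 * (K1 + K3 - K4 - K6 - K7) + p.2 * (K2 - K3 + K4 - K5 - K7)).
    by ring.
  by rewrite g1 g2; ring.
have h3 := ge _ (p.1 - p.2) k3; have h4 := ge _ (p.2 - p.1) k4.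
have h5 := ge _ (- p.2) k5; have h6 := ge _ (- p.1) k6.
have h7 := ge _ (- p.1 - p.2) k7.
have : 0 < K1 * (expR p.1 - 1 - p.1) + K2 * (expR p.2 - 1 - p.2).
  have [p1|p1] := eqVneq p.1 0; last by rewrite ltr_pwDl ?gt ?ge.
  by rewrite ltr_wpDl ?gt ?ge //; apply: contraNneq p0 => p2; rewrite [p]surjective_pairing p1 p2.
clearbody K1 K2 K3 K4 K5 K6 K7; clear -S h3 h4 h5 h6 h7; lra.
Qed.

(** All seven exponents are at most [2 * M]. Hence small circles about [c] lie on levels close to
    the minimum. *)
Lemma lyness_inv_upper a b c p M : 0 < a -> 0 < b -> critical a b c ->
  `|p.1| <= M -> `|p.2| <= M ->
  lyness_inv a b (exp_coord c p) <= lyness_inv a b c * expR (2 * M).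
Proof.
move=> a0 b0 cc; rewrite !ler_norml => /andP[p1 p1'] /andP[p2 p2'].
have /and3P[cq _ _] := cc; have /andP[c1 c2] := cq.
set E := expR (2 * M).
have aux (K t : R) : 0 < K -> t <= 2 * M -> K * expR t <= K * E.
  by move=> K0 tM; rewrite ler_wpM2l ?ler_expR // ltW.
rewrite lyness_inv_exp // {1}/lyness_inv !mulrDl.
by rewrite !lerD // aux // ?(divr_gt0, mulr_gt0, addr_gt0, exprn_gt0) //; lra.
Qed.

(** Four of the exponentials suffice, through [|t| <= expR t + expR (- t)]. Hence large circles
    about [c] lie on high levels. *)
Lemma lyness_inv_lower a b c : 0 < a -> 0 < b -> critical a b c ->
  exists2 m, 0 < m & forall p, m * (`|p.1| + `|p.2|) <= lyness_inv a b (exp_coord c p).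
Proof.
move=> a0 b0 cc; have /and3P[cq _ _] := cc; have /andP[c1 c2] := cq.
have k1 : 0 < a * c.1 by rewrite mulr_gt0.
have k2 : 0 < b * c.2 by rewrite mulr_gt0.
have k5 : 0 < (a + b ^+ 2) / c.2 by rewrite divr_gt0 ?addr_gt0 ?exprn_gt0.
have k6 : 0 < (b + a ^+ 2) / c.1 by rewrite divr_gt0 ?addr_gt0 ?exprn_gt0.
pose m := Num.min (Num.min (a * c.1) (b * c.2)) (Num.min ((a + b ^+ 2) / c.2) ((b + a ^+ 2) / c.1)).
exists m => [|p]; first by rewrite !lt_min k1 k2 k5 k6.
have m0 : 0 < m by rewrite !lt_min k1 k2 k5 k6.
have m1 : m <= a * c.1 by rewrite /m !ge_min lexx.
have m2 : m <= b * c.2 by rewrite /m !ge_min lexx !orbT.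
have m5 : m <= (a + b ^+ 2) / c.2 by rewrite /m !ge_min lexx !orbT.
have m6 : m <= (b + a ^+ 2) / c.1 by rewrite /m !ge_min lexx !orbT.
have aux K K' t : m <= K -> m <= K' -> m * `|t| <= K * expR t + K' * expR (- t).
  move=> mK mK'; have e0 := expR_gt0 t; have e0' := expR_gt0 (- t).
  have h : `|t| <= expR t + expR (- t).
    have := expR_ge1Dx t; have := expR_ge1Dx (- t).
    by case: (ler0P t) => _; lra.
  apply: le_trans (_ : m * (expR t + expR (- t)) <= _); first by rewrite ler_wpM2l // ltW.
  by rewrite mulrDr lerD // ler_wpM2r // ltW.
rewrite lyness_inv_exp // mulrDr.
have h1 := aux _ _ p.1 m1 m6; have h2 := aux _ _ p.2 m2 m5.
have g (K t : R) : 0 < K -> 0 <= K * expR t by move=> K0; rewrite mulr_ge0 ?expR_ge0 ?ltW.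
have h3 : 0 <= b * (c.1 / c.2) * expR (p.1 - p.2) by rewrite g // !(divr_gt0, mulr_gt0).
have h4 : 0 <= a * (c.2 / c.1) * expR (p.2 - p.1) by rewrite g // !(divr_gt0, mulr_gt0).
have h7 : 0 <= a * b / (c.1 * c.2) * expR (- p.1 - p.2) by rewrite g // !(divr_gt0, mulr_gt0).
lra.
Qed.

(** Strict growth along rays: a level meets each ray from [c] at most once. *)
Lemma log_ray_uniq a b c z z' l : 0 < a -> 0 < b -> critical a b c ->
  quadrant z -> quadrant z' -> lyness_inv a b z' = lyness_inv a b z -> 0 < l ->
  log_coord c z' = (l * (log_coord c z).1, l * (log_coord c z).2) -> z' = z.
Proof.
move=> a0 b0 cc z0 z0' VE l0 e; have /and3P[cq _ _] := cc.
have [zc|zc] := eqVneq z c.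
  move: e; rewrite zc {2 3}/log_coord !subrr /= !mulr0 => /eqP.
  by rewrite log_coord_eq0 // => /eqP.
have p0 : log_coord c z != (0, 0) by rewrite log_coord_eq0.
rewrite -(log_coordK cq z0) -(log_coordK cq z0') e.
have [l1|l1|->] := ltrgtP l 1; last by rewrite !mul1r -surjective_pairing.
- suff : lyness_inv a b z' < lyness_inv a b z by rewrite VE ltxx.
  rewrite -(log_coordK cq z0) -(log_coordK cq z0').
  have -> : log_coord c z = (l^-1 * (log_coord c z').1, l^-1 * (log_coord c z').2).
    by rewrite e /= !mulKf ?gt_eqF // -surjective_pairing.
  apply: lyness_inv_ray => //; last by rewrite invf_gt1.
  by rewrite e; apply: contraNneq p0 => -[/eqP + /eqP];
    rewrite !mulf_eq0 gt_eqF //= => /eqP h1 /eqP h2; rewrite /log_coord h1 h2.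
- suff : lyness_inv a b z < lyness_inv a b z' by rewrite VE ltxx.
  rewrite -{1}(log_coordK cq z0) -(log_coordK cq z0') e.
  exact: lyness_inv_ray.
Qed.

Lemma iter_neq_critical a b c z i : 0 < a -> 0 < b -> critical a b c ->
  quadrant z -> z != c -> iter i (lyness_map a b) z != c.
Proof.
move=> a0 b0 cc z0 zc; have /and3P[cq _ _] := cc.
have : lyness_inv a b c < lyness_inv a b (iter i (lyness_map a b) z).
  rewrite lyness_inv_iter // -(log_coordK cq z0) lyness_inv_min //.
  by rewrite log_coord_eq0.
by apply: contraTneq => ->; rewrite ltxx.
Qed.

End LogCoordinates.

(** * The differential at the critical point *)

Section LinearPart.
Context {R : realType}.
Implicit Types (c p q : R * R).

(** The logarithmic derivative of [a + y] with respect to [y] is [y / (a + y)], and [a + y] is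
    [x ^+ 2] at the critical point; [slope2] is its analogue for the second step. *)
Definition slope1 c : R := c.2 / c.1 ^+ 2.
Definition slope2 c : R := c.1 / c.2 ^+ 2.

(* Coordinates in which the differential of the map at c, written in          *)
(* logarithmic coordinates, is a rotation.                                    *)
Definition ortho_coord c p : R * R :=
  (Num.sqrt (slope2 c) * (p.1 - slope1 c / 2 * p.2),
   - Num.sqrt (slope1 c - slope1 c ^+ 2 * slope2 c / 4) * p.2).

Definition diff_step (m : R) p : R * R := (p.2, m * p.2 - p.1).
Definition diff_map c p : R * R := diff_step (slope2 c) (diff_step (slope1 c) p).

Definition critical_angle c : R := acos (2^-1 * (- 2 + (c.1 * c.2)^-1)).

Context (c : R * R) (cq : quadrant c) (c_gt1 : 1 < c.1 * c.2).

Lemma slope1_gt0 : 0 < slope1 c.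
Proof using cq. by case/andP: cq => c1 c2; rewrite divr_gt0 ?exprn_gt0. Qed.

Lemma slope2_gt0 : 0 < slope2 c.
Proof using cq. by case/andP: cq => c1 c2; rewrite divr_gt0 ?exprn_gt0. Qed.

Lemma slope_prodE : slope1 c * slope2 c = (c.1 * c.2)^-1.
Proof using cq.
by case/andP: cq => c1 c2; rewrite /slope1 /slope2; field; rewrite !gt_eqF.
Qed.

Lemma slope_prod_lt1 : slope1 c * slope2 c < 1.
Proof using cq c_gt1. by rewrite slope_prodE invf_lt1 // (lt_trans _ c_gt1). Qed.

Lemma ortho_disc_gt0 : 0 < slope1 c - slope1 c ^+ 2 * slope2 c / 4.
Proof using cq c_gt1.
have := slope_prod_lt1; have := slope1_gt0.
set m1 := slope1 c; set m2 := slope2 c => m10 m12.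
have -> : m1 - m1 ^+ 2 * m2 / 4 = m1 * (1 - m1 * m2 / 4) by field.
by rewrite mulr_gt0 //; lra.
Qed.

(** The right-hand side is the bilinear form of the quadratic form preserved by [diff_map c];
    [ortho_coord] completes its square. *)
Lemma dot_ortho p q : dot (ortho_coord c p) (ortho_coord c q) =
  slope2 c * (p.1 * q.1) - slope1 c * slope2 c / 2 * (p.1 * q.2 + p.2 * q.1)
  + slope1 c * (p.2 * q.2).
Proof using cq c_gt1.
rewrite /dot /= [X in X + _]mulrACA [X in _ + X]mulrACA mulrNN -!expr2.
rewrite !sqr_sqrtr ?(ltW slope2_gt0) ?(ltW ortho_disc_gt0) //.
by field.
Qed.

(** The minus sign in [ortho_coord] reverses orientation, so that the differential turns
    counterclockwise by less than [pi]. *)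
Lemma cross_ortho p q : cross (ortho_coord c p) (ortho_coord c q) =
  - (Num.sqrt (slope2 c) * Num.sqrt (slope1 c - slope1 c ^+ 2 * slope2 c / 4))
  * (p.1 * q.2 - p.2 * q.1).
Proof using Type. by rewrite /cross /=; ring. Qed.

Lemma ortho_scale (l : R) p : ortho_coord c (l * p.1, l * p.2) =
  (l * (ortho_coord c p).1, l * (ortho_coord c p).2).
Proof using Type. by rewrite /ortho_coord /=; congr pair; ring. Qed.

Lemma ortho_inj (l : R) p q : (ortho_coord c q).1 = l * (ortho_coord c p).1 ->
  (ortho_coord c q).2 = l * (ortho_coord c p).2 -> q = (l * p.1, l * p.2).
Proof using cq c_gt1.
move=> /= e1 e2.
have d0 : Num.sqrt (slope1 c - slope1 c ^+ 2 * slope2 c / 4) != 0.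
  by rewrite gt_eqF // sqrtr_gt0 ortho_disc_gt0.
have s0 : Num.sqrt (slope2 c) != 0 by rewrite gt_eqF // sqrtr_gt0 slope2_gt0.
have h2 : q.2 = l * p.2.
  by apply: (mulfI d0); apply: oppr_inj; rewrite -mulNr e2; ring.
have h1 : q.1 - slope1 c / 2 * q.2 = l * (p.1 - slope1 c / 2 * p.2).
  by apply: (mulfI s0); rewrite e1; ring.
rewrite [LHS]surjective_pairing h2; congr pair.
by rewrite h2 in h1; rewrite -[LHS](subrK (slope1 c / 2 * (l * p.2))) h1; ring.
Qed.

Lemma ortho_neq0 p : p != (0, 0) -> ortho_coord c p != 0.
Proof using cq c_gt1.
apply: contraNneq => e; apply/eqP; have := @ortho_inj 0 (0, 0) p.
by rewrite e /= !mul0r; apply.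
Qed.

Lemma diff_map_neq0 p : p != (0, 0) -> diff_map c p != (0, 0).
Proof using Type.
case: p => x y; apply: contraNneq; rewrite /diff_map /diff_step /= => -[e1 e2].
have y0 : y = 0 by move: e2; rewrite e1 mulr0 sub0r => /eqP; rewrite oppr_eq0 => /eqP.
by move: e1; rewrite y0 mulr0 sub0r => /eqP; rewrite oppr_eq0 => /eqP ->.
Qed.

Lemma critical_angle_itv : 0 < critical_angle c < pi.
Proof using cq c_gt1.
have h1 := slope_prod_lt1; have h0 := mulr_gt0 slope1_gt0 slope2_gt0.
rewrite slope_prodE in h0 h1; rewrite /critical_angle.
by rewrite acos_gt0 ?acos_ltpi //; apply/andP; split; lra.
Qed.

Lemma cos_critical_angle : cos (critical_angle c) = -1 + slope1 c * slope2 c / 2.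
Proof using cq c_gt1.
have h1 := slope_prod_lt1; have h0 := mulr_gt0 slope1_gt0 slope2_gt0.
rewrite slope_prodE in h0 h1 *; rewrite /critical_angle acosK; first by field; case/andP: cq => ? ?; rewrite !gt_eqF.
by rewrite in_itv /=; apply/andP; split; lra.
Qed.

Lemma sin_critical_angle : sin (critical_angle c) =
  Num.sqrt (slope2 c) * Num.sqrt (slope1 c - slope1 c ^+ 2 * slope2 c / 4).
Proof using cq c_gt1.
have /andP[a0 a1] := critical_angle_itv.
have s0 : 0 < sin (critical_angle c) by apply: sin_gt0_pi; rewrite a0 a1.
rewrite -sqrtrM ?(ltW slope2_gt0) // -[LHS]ger0_norm ?(ltW s0) // -sqrtr_sqr.
by congr Num.sqrt; rewrite sin2cos2 cos_critical_angle; field.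
Qed.

(** [diff_map c] has determinant 1 and trace [slope1 c * slope2 c - 2], hence is a rotation for the
    preserved form, with half the trace as cosine. *)
Lemma angle_diff_map p : p != (0, 0) ->
  apart (ortho_coord c p) (ortho_coord c (diff_map c p)) /\
  angle (ortho_coord c p) (ortho_coord c (diff_map c p)) = critical_angle c.
Proof using cq c_gt1.
move=> p0; set v := ortho_coord c p; set w := ortho_coord c _.
have v0 : v != 0 by exact: ortho_neq0.
have w0 : w != 0 by apply: ortho_neq0; exact: diff_map_neq0.
have nvw : nrm v = nrm w.
  by rewrite /nrm; congr Num.sqrt; rewrite !dot_ortho /diff_map /diff_step /=; field.
have /andP[a0 a1] := critical_angle_itv.
have ec : nrm v * nrm w * cos (critical_angle c) = dot v w.
  rewrite -nvw -expr2 sqr_nrm cos_critical_angle !dot_ortho /diff_map /diff_step /=.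
  by field.
have es : nrm v * nrm w * sin (critical_angle c) = cross v w.
  rewrite -nvw -expr2 sqr_nrm sin_critical_angle cross_ortho dot_ortho /diff_map /diff_step /=.
  by field.
have n0 : 0 < nrm v by rewrite nrm_gt0.
have vw : apart v w.
  rewrite /apart -ec -nvw -[ltRHS]mulr1 ltr_pM2l ?mulr_gt0 // cos_critical_angle.
  by have := slope_prod_lt1; lra.
by split => //; apply: angle_unique => //; rewrite a0 /=; have := @pi_gt0 R; lra.
Qed.

End LinearPart.

(** * Approaching the critical point along a segment *)

Section SegmentToCritical.
Context {R : realType}.
Implicit Types (c z : R * R) (s k d : R).

Definition toward c z s : R * R := (c.1 + s * (z.1 - c.1), c.2 + s * (z.2 - c.2)).

Lemma toward1 c z : toward c z 1 = z.
Proof. by rewrite /toward !mul1r ![_ + (_ - _)]addrC !subrK -surjective_pairing. Qed.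

Lemma quadrant_toward c z s : quadrant c -> quadrant z -> 0 <= s <= 1 ->
  quadrant (toward c z s).
Proof.
move=> /andP[c1 c2] /andP[z1 z2] /andP[s0 s1].
by rewrite /quadrant /=; apply/andP; split; nra.
Qed.

Lemma toward_neq c z s : 0 < s -> z != c -> toward c z s != c.
Proof.
move=> s0; apply: contraNneq => e.
have /= e1 := congr1 fst e; have /= e2 := congr1 snd e.
have {}e1 : s * (z.1 - c.1) = 0 by lra.
have {}e2 : s * (z.2 - c.2) = 0 by lra.
move/eqP: e1; rewrite mulf_eq0 gt_eqF //= subr_eq0 => /eqP e1.
move/eqP: e2; rewrite mulf_eq0 gt_eqF //= subr_eq0 => /eqP e2.
by rewrite [z]surjective_pairing e1 e2 -surjective_pairing.
Qed.

Lemma continuous_affine k d s : (fun s => k + s * d) @ s --> k + s * d.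
Proof.
by apply: cvgD; [exact: cvg_cst | apply: cvgM; [exact: cvg_id | exact: cvg_cst]].
Qed.

Lemma cvg_affine0 k d : (fun s => k + s * d) @ 0^'+ --> k.
Proof.
apply: cvg_at_right_filter; rewrite -[X in _ --> X]addr0 -[X in _ --> _ + X](mul0r d).
exact: continuous_affine.
Qed.

Lemma near_inv_gt0 : \forall s \near (0 : R)^'+, 0 < s^-1.
Proof.
by near=> s; rewrite invr_gt0; near: s; exact: nbhs_right_gt.
Unshelve. all: by end_near. Qed.

Lemma cvg_affine_quotient k d : 0 < k ->
  (fun s => s^-1 * (k + s * d - k)) @ 0^'+ --> k * (d / k).
Proof.
move=> k0; apply: cvg_near_cst; near=> s.
have s0 : 0 < s by near: s; exact: nbhs_right_gt.
by field; rewrite !gt_eqF.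
Unshelve. all: by end_near. Qed.

Lemma relative_displacement_neq0 c z : quadrant c -> z != c ->
  ((z.1 - c.1) / c.1, (z.2 - c.2) / c.2) != (0, 0).
Proof.
move=> /andP[c1 c2]; apply: contraNneq => -[/eqP + /eqP].
rewrite !mulf_eq0 !invr_eq0 (gt_eqF c1) (gt_eqF c2) !orbF !subr_eq0.
by move=> /eqP e1 /eqP e2; rewrite [z]surjective_pairing e1 e2 -surjective_pairing.
Qed.

End SegmentToCritical.

(** * The rotation of an orbit *)

Section Rotation.
Context {R : realType} (a b : R) (c : R * R).
Hypotheses (a0 : 0 < a) (b0 : 0 < b) (cc : critical a b c).
Implicit Types (z p q : R * R) (n i : nat).

Let cq : quadrant c. Proof. by case/and3P: cc. Qed.
Let c_gt1 : 1 < c.1 * c.2. Proof. exact: critical_prod_gt1 cc. Qed.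
Let F := lyness_map a b.

Definition ortho_log z : R * R := ortho_coord c (log_coord c z).
Definition rotation n z : R := winding (fun i => ortho_log (iter i F z)) n.

Lemma ortho_log_neq0 z : quadrant z -> z != c -> ortho_log z != 0.
Proof using cc a0 b0.
move=> z0 zc; apply: ortho_neq0 => //; by rewrite log_coord_eq0.
Qed.

(** Positively parallel coordinates on one level would force equality by [log_ray_uniq]. *)
Lemma apart_level z z' : quadrant z -> quadrant z' -> z != c -> z' != z ->
  lyness_inv a b z' = lyness_inv a b z -> apart (ortho_log z) (ortho_log z').
Proof using cc a0 b0.
move=> z0 z0' zc zz V; apply: apart_intro.
- exact: ortho_log_neq0.
- apply: ortho_log_neq0 => //; apply/eqP => z'c.
  move: V; rewrite z'c -(log_coordK cq z0) => V.
  by have := lyness_inv_min a0 b0 cc; move/(_ (log_coord c z)); rewrite log_coord_eq0 // V ltxx => /(_ zc).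
- move=> l l0 e1 e2; move/eqP: zz; apply.
  apply: (log_ray_uniq a0 b0 cc z0 z0' V l0).
  exact: (ortho_inj cq c_gt1 e1 e2).
Qed.

Lemma critical_map_neq z : quadrant z -> z != c -> F z != z.
Proof using cc a0 b0.
move=> z0; apply: contraNneq => zE; apply/eqP.
by apply: (critical_uniq a0 b0) cc; rewrite -critical_fixed //; apply/eqP.
Qed.

Lemma apart_iter z i : quadrant z -> z != c ->
  apart (ortho_log (iter i F z)) (ortho_log (iter i.+1 F z)).
Proof using cc a0 b0.
move=> z0 zc; have w0 := quadrant_iter i a0 b0 z0.
have wc := iter_neq_critical i a0 b0 cc z0 zc.
apply: apart_level => //=; first exact: quadrant_map.
  exact: critical_map_neq.
exact: (lyness_inv_iter 1).
Qed.

Lemma rotation_ge0 n z : 0 <= rotation n z.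
Proof using Type. exact: winding_ge0. Qed.

Lemma rotationD n m z : rotation (n + m) z = rotation n z + rotation m (iter n F z).
Proof using Type.
rewrite /rotation /winding big_split_ord /=; congr (_ + _).
by apply: eq_bigr => i _ /=; rewrite -!iterD addnC.
Qed.

Lemma rotation_mul n m z : rotation (n * m) z = \sum_(j < m) rotation n (iter (n * j) F z).
Proof using Type.
elim: m => [|m IH]; first by rewrite muln0 big_ord0 /rotation /winding big_ord0.
by rewrite mulnS addnC rotationD IH big_ord_recr.
Qed.

(* Both sides sum the angle increments over the pairs i < n, j < m.           *)
Lemma rotation_exchange n m z :
  \sum_(i < n) rotation m (iter i F z) = \sum_(j < m) rotation n (iter j F z).
Proof using Type.
rewrite /rotation /winding exchange_big /=; apply: eq_bigr => i _.
by apply: eq_bigr => j _ /=; rewrite -!iterD addnC.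
Qed.

Lemma rotation_periodic n m z : iter n F z = z -> rotation (n * m) z = m%:R * rotation n z.
Proof using Type.
move=> zE; rewrite rotation_mul.
under eq_bigr => j _.
  rewrite (_ : iter (n * j) F z = z); last by elim: (nat_of_ord j) => [|k]; rewrite ?muln0 // mulnS iterD => ->.
  over.
by rewrite sumr_const card_ord mulr_natl.
Qed.

Lemma rotation_closed n z : quadrant z -> z != c -> iter n F z = z ->
  exists m : nat, rotation n z = m%:R * (2 * pi).
Proof using cc a0 b0.
move=> z0 zc zE; apply: winding_closed => [i|]; first exact: apart_iter.
by rewrite zE.
Qed.

(** After a whole number of turns the orbit is back on its initial ray, and it has kept its
    level. *)
Lemma rotation_multiple n (m : nat) z : quadrant z -> z != c ->
  rotation n z = m%:R * (2 * pi) -> iter n F z = z.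
Proof using cc a0 b0.
move=> z0 zc e; have [i|l l0 e'] := winding_multiple _ e; first exact: apart_iter.
apply: (log_ray_uniq a0 b0 cc z0 _ _ l0); rewrite ?quadrant_iter ?lyness_inv_iter //.
by apply: (ortho_inj cq c_gt1); rewrite -/(ortho_log _) e'.
Qed.

Lemma rotation_lt n z : (0 < n)%N -> rotation n z < n%:R * (2 * pi).
Proof using Type.
case: n => // n _; elim: n => [|n IH].
  by rewrite /rotation /winding big_ord1 mul1r angle_lt2pi.
rewrite -addn1 rotationD natrD mulrDl mul1r ltrD //.
by rewrite /rotation /winding big_ord1 angle_lt2pi.
Qed.

Section Continuity.
Context {T : Type} (G : set_system T) {FG : Filter G}.

Lemma cvg_step (m : R) (f : T -> R * R) z : quadrant z ->
  (fun t => (f t).1) @ G --> z.1 -> (fun t => (f t).2) @ G --> z.2 ->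
  (fun t => (lyness_step m (f t)).1) @ G --> (lyness_step m z).1 /\
  (fun t => (lyness_step m (f t)).2) @ G --> (lyness_step m z).2.
Proof using FG.
move=> /andP[z1 _] f1 f2; split => //=; apply: cvgM.
  by apply: cvgD => //; exact: cvg_cst.
by apply: cvgV => //; rewrite gt_eqF.
Qed.

Lemma cvg_iter (f : T -> R * R) z i : quadrant z ->
  (fun t => (f t).1) @ G --> z.1 -> (fun t => (f t).2) @ G --> z.2 ->
  (fun t => (iter i F (f t)).1) @ G --> (iter i F z).1 /\
  (fun t => (iter i F (f t)).2) @ G --> (iter i F z).2.
Proof using FG a0 b0.
move=> z0 f1 f2; elim: i => //= i [h1 h2].
have w0 := quadrant_iter i a0 b0 z0.
have [k1 k2] := @cvg_step a _ _ w0 h1 h2.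
exact: (@cvg_step b _ _ (quadrant_step a0 w0) k1 k2).
Qed.

Lemma cvg_ortho (f : T -> R * R) p :
  (fun t => (f t).1) @ G --> p.1 -> (fun t => (f t).2) @ G --> p.2 ->
  (fun t => (ortho_coord c (f t)).1) @ G --> (ortho_coord c p).1 /\
  (fun t => (ortho_coord c (f t)).2) @ G --> (ortho_coord c p).2.
Proof using FG.
move=> f1 f2; split => /=; apply: cvgM => //; try exact: cvg_cst.
by apply: cvgB => //; apply: cvgM => //; exact: cvg_cst.
Qed.

Lemma cvg_ortho_log (f : T -> R * R) z : quadrant z ->
  (fun t => (f t).1) @ G --> z.1 -> (fun t => (f t).2) @ G --> z.2 ->
  (fun t => (ortho_log (f t)).1) @ G --> (ortho_log z).1 /\
  (fun t => (ortho_log (f t)).2) @ G --> (ortho_log z).2.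
Proof using FG.
move=> /andP[z1 z2] f1 f2; apply: cvg_ortho => /=;
  (apply: cvgB; last exact: cvg_cst);
  by apply: (@continuous_cvg _ R R G _ _ (@ln R)) => //; exact: continuous_ln.
Qed.

Lemma cvg_rotation (f : T -> R * R) z n : quadrant z -> z != c ->
  (fun t => (f t).1) @ G --> z.1 -> (fun t => (f t).2) @ G --> z.2 ->
  (fun t => rotation n (f t)) @ G --> rotation n z.
Proof using FG a0 b0 cc.
move=> z0 zc f1 f2.
have [g1 g2] : (forall i, (fun t => (ortho_log (iter i F (f t))).1) @ G --> (ortho_log (iter i F z)).1) /\
  (forall i, (fun t => (ortho_log (iter i F (f t))).2) @ G --> (ortho_log (iter i F z)).2).
  split => i; have [h1 h2] := cvg_iter i z0 f1 f2;
  by have [k1 k2] := cvg_ortho_log (quadrant_iter i a0 b0 z0) h1 h2.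
elim: n => [|n IH].
  by rewrite /rotation /winding big_ord0; under eq_fun do rewrite big_ord0; exact: cvg_cst.
rewrite /rotation /winding big_ord_recr /=; under eq_fun do rewrite big_ord_recr /=.
apply: cvgD; first exact: IH.
apply: (@cvg_angle R T G _ (fun t => ortho_log (iter n F (f t))) (fun t => ortho_log (iter n.+1 F (f t)))).
- exact: apart_iter.
- exact: g1.
- exact: g2.
- exact: (g1 n.+1).
- exact: (g2 n.+1).
Qed.

End Continuity.

End Rotation.

(** * Limits at the critical point and at infinity *)

Section Asymptotics.
Context {R : realType} (a b : R) (c : R * R).
Hypotheses (a0 : 0 < a) (b0 : 0 < b) (cc : critical a b c).

Let cq : quadrant c. Proof. by case/and3P: cc. Qed.
Let c_gt1 : 1 < c.1 * c.2. Proof. exact: critical_prod_gt1 cc. Qed.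
Let F := lyness_map a b.

(** Angles ignore positive scaling, so convergence of the rescaled orbits is enough. It serves at
    [c] with [l] the inverse of the segment parameter, and at infinity with [l] the inverse of the
    logarithmic distance. *)
Lemma cvg_rotation_asymptotic (T : Type) (G : set_system T) (FG : Filter G)
    (l : T -> R) (f : T -> R * R) (P : nat -> R * R) n :
  (\forall t \near G, 0 < l t) ->
  (forall i, (fun t => l t * (log_coord c (iter i F (f t))).1) @ G --> (P i).1) ->
  (forall i, (fun t => l t * (log_coord c (iter i F (f t))).2) @ G --> (P i).2) ->
  (forall i, apart (ortho_coord c (P i)) (ortho_coord c (P i.+1))) ->
  (fun t => rotation a b c n (f t)) @ G --> winding (fun i => ortho_coord c (P i)) n.
Proof.
move=> l0 P1 P2 Pa; elim: n => [|n IH].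
  by rewrite /rotation /winding big_ord0; under eq_fun do rewrite big_ord0; exact: cvg_cst.
rewrite /rotation /winding big_ord_recr /=; under eq_fun do rewrite big_ord_recr /=.
apply: cvgD; first exact: IH.
pose g i t := ortho_coord c (l t * (log_coord c (iter i F (f t))).1, l t * (log_coord c (iter i F (f t))).2).
have g12 i : (fun t => (g i t).1) @ G --> (ortho_coord c (P i)).1 /\
   (fun t => (g i t).2) @ G --> (ortho_coord c (P i)).2.
  by apply: cvg_ortho; [exact: P1|exact: P2].
have h : (fun t => angle (g n t) (g n.+1 t)) @ G --> angle (ortho_coord c (P n)) (ortho_coord c (P n.+1)).
  by apply: cvg_angle; rewrite ?Pa //; have [? ?] := g12 n; have [? ?] := g12 n.+1.
apply: cvg_trans h; apply: near_eq_cvg; near=> t.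
have lt0 : 0 < l t by near: t.
by rewrite /g !ortho_scale angle_scale.
Unshelve. all: by end_near. Qed.

Lemma critical_fixed_iter i : iter i F c = c.
Proof using cc. by elim: i => //= i ->; apply/eqP; rewrite critical_fixed. Qed.

Section NearCritical.
Context {T : Type} (G : set_system T) {FG : Filter G} (l : T -> R).
Hypothesis l_gt0 : \forall t \near G, 0 < l t.

(** The logarithmic difference is squeezed between [(f t - k) / f t] and [(f t - k) / k]. *)
Lemma cvg_log_quotient (f : T -> R) (k x : R) : 0 < k -> f @ G --> k ->
  (fun t => l t * (f t - k)) @ G --> k * x ->
  (fun t => l t * (ln (f t) - ln k)) @ G --> x.
Proof using FG l_gt0.
move=> k0 fk lf.
have k_neq0 : k != 0 by rewrite gt_eqF.
have lnB (u v : R) : 0 < u -> 0 < v -> ln u - ln v <= (u - v) / v.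
  move=> u0 v0; rewrite -ln_div ?posrE //.
  have -> : u / v = 1 + (u - v) / v by field; rewrite gt_eqF.
  apply: le_ln1Dx; rewrite ltr_pdivlMr //; lra.
apply: (@squeeze_cvgr _ _ _ _ (fun t => l t * (f t - k) / f t) (fun t => l t * (f t - k) / k)).
- near=> t.
  have lt0 : 0 < l t by near: t.
  have ft0 : 0 < f t by near: t; exact: (cvgr_gt k fk).
  rewrite -!mulrA; apply/andP; split; apply: (ler_wpM2l (ltW lt0)); last exact: lnB.
  by have := lnB _ _ k0 ft0; rewrite -(opprB (f t)) mulNr; lra.
- have -> : x = k * x / k by field.
  by apply: cvgM => //; apply: cvgV.
- have -> : x = k * x / k by field.
  by apply: cvgM => //; exact: cvg_cst.
Unshelve. all: by end_near. Qed.

(** The linearization of one step, obtained algebraically from difference quotients; the limit is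
    the new coordinate of [diff_step], scaled by [k1]. *)
Lemma cvg_quotient_step (f g : T -> R) (m k1 k2 x y : R) : 0 < k1 -> k1 ^+ 2 = m + k2 ->
  f @ G --> k1 ->
  (fun t => l t * (f t - k1)) @ G --> k1 * x ->
  (fun t => l t * (g t - k2)) @ G --> k2 * y ->
  (fun t => l t * ((m + g t) / f t - k1)) @ G --> k1 * (k2 / k1 ^+ 2 * y - x).
Proof using FG.
move=> k10 kE fk lf lg.
have k_neq0 : k1 != 0 by rewrite gt_eqF.
have h : (fun t => (l t * (g t - k2) - k1 * (l t * (f t - k1))) / f t) @ G -->
    (k2 * y - k1 * (k1 * x)) / k1.
  apply: cvgM; last exact: cvgV.
  by apply: cvgB => //; apply: cvgM => //; exact: cvg_cst.
have -> : k1 * (k2 / k1 ^+ 2 * y - x) = (k2 * y - k1 * (k1 * x)) / k1 by field.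
apply: cvg_trans h; apply: near_eq_cvg; near=> t.
have ft0 : f t != 0 by rewrite gt_eqF //; near: t; exact: (cvgr_gt k1 fk).
apply: (mulIf ft0); rewrite divfK // -mulrA mulrBl divfK //.
have -> : m = k1 ^+ 2 - k2 by rewrite kE addrK.
ring.
Unshelve. all: by end_near. Qed.

Lemma cvg_iter_quotient (f : T -> R * R) p i :
  (fun t => (f t).1) @ G --> c.1 -> (fun t => (f t).2) @ G --> c.2 ->
  (fun t => l t * ((f t).1 - c.1)) @ G --> c.1 * p.1 ->
  (fun t => l t * ((f t).2 - c.2)) @ G --> c.2 * p.2 ->
  (fun t => l t * ((iter i F (f t)).1 - c.1)) @ G --> c.1 * (iter i (diff_map c) p).1 /\
  (fun t => l t * ((iter i F (f t)).2 - c.2)) @ G --> c.2 * (iter i (diff_map c) p).2.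
Proof using FG a0 b0 cc.
move=> f1 f2 l1 l2.
have /and3P[/andP[c1 c2] /eqP cE1 /eqP cE2] := cc.
elim: i => //= i [h1 h2].
have [k1 k2] := cvg_iter a0 b0 i cq f1 f2.
rewrite critical_fixed_iter in k1 k2.
have e1 : (fun t => l t * ((F (iter i F (f t))).1 - c.1)) @ G --> c.1 * (diff_map c (iter i (diff_map c) p)).1.
  exact: (cvg_quotient_step c1 cE1 k1 h1 h2).
split => //.
exact: (cvg_quotient_step c2 cE2 k2 h2 e1).
Qed.

End NearCritical.

(** The rescaled orbit converges to an orbit of [diff_map c], each step of which turns by
    [critical_angle c]. *)
Lemma rotation_near_critical z n : quadrant z -> z != c ->
  (fun s => rotation a b c n (toward c z s)) @ 0^'+ --> n%:R * critical_angle c.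
Proof using a0 b0 cc.
move=> z0 zc; have /andP[c1 c2] := cq.
pose p := ((z.1 - c.1) / c.1, (z.2 - c.2) / c.2).
have p0 : p != (0, 0) by exact: relative_displacement_neq0.
pose P i := iter i (diff_map c) p.
have P0 i : P i != (0, 0) by elim: i => //= i; exact: diff_map_neq0.
have Pa i : apart (ortho_coord c (P i)) (ortho_coord c (P i.+1)).
  by have [] := angle_diff_map cq c_gt1 (P0 i).
have wE : winding (fun i => ortho_coord c (P i)) n = n%:R * critical_angle c.
  rewrite /winding; under eq_bigr => i _ do rewrite (angle_diff_map cq c_gt1 (P0 i)).2.
  by rewrite sumr_const card_ord mulr_natl.
have l0 := @near_inv_gt0 R.
have f1 : (fun s => (toward c z s).1) @ (0 : R)^'+ --> c.1 by exact: cvg_affine0.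
have f2 : (fun s => (toward c z s).2) @ (0 : R)^'+ --> c.2 by exact: cvg_affine0.
have q1 : (fun s => s^-1 * ((toward c z s).1 - c.1)) @ (0 : R)^'+ --> c.1 * p.1.
  exact: cvg_affine_quotient.
have q2 : (fun s => s^-1 * ((toward c z s).2 - c.2)) @ (0 : R)^'+ --> c.2 * p.2.
  exact: cvg_affine_quotient.
have iq i := cvg_iter_quotient i f1 f2 q1 q2.
have ic i := cvg_iter a0 b0 i cq f1 f2.
rewrite -wE; apply: (cvg_rotation_asymptotic _ l0) => // i.
- have [h1 h2] := iq _ i; have [k1 k2] := ic _ i; rewrite critical_fixed_iter in k1 k2.
  exact: (cvg_log_quotient l0 c1 k1 h1).
- have [h1 h2] := iq _ i; have [k1 k2] := ic _ i; rewrite critical_fixed_iter in k1 k2.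
  exact: (cvg_log_quotient l0 c2 k2 h2).
Qed.

End Asymptotics.

Section Infinity.
Context {R : realType} (a b : R) (c : R * R).
Hypotheses (a0 : 0 < a) (b0 : 0 < b) (cc : critical a b c).

Let cq : quadrant c. Proof. by case/and3P: cc. Qed.
Let c_gt1 : 1 < c.1 * c.2. Proof. exact: critical_prod_gt1 cc. Qed.
Let F := lyness_map a b.

(* In logarithmic coordinates the map is asymptotic at infinity to this       *)
(* piecewise linear one, which is globally 5-periodic.                        *)
Definition tropical_step (p : R * R) : R * R := (p.2, Num.max 0 p.2 - p.1).
Definition tropical_map (p : R * R) : R * R := tropical_step (tropical_step p).

Section Filter.
Context {T : Type} (G : set_system T) {FG : Filter G} (l : T -> R).
Hypotheses (l_gt0 : \forall t \near G, 0 < l t) (l_cvg0 : l @ G --> 0).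

(** [ln (m + g t)] exceeds the larger of [ln m] and [ln (g t)] by at most [ln 2], and the factor
    [l], tending to 0, removes both [ln 2] and [ln m]. *)
Lemma cvg_scaled_lnD (g : T -> R) (m y : R) : 0 < m -> (\forall t \near G, 0 < g t) ->
  (fun t => l t * ln (g t)) @ G --> y ->
  (fun t => l t * ln (m + g t)) @ G --> Num.max 0 y.
Proof using FG l_gt0 l_cvg0.
move=> m0 g0 lg.
have lk (k : R) : (fun t => l t * k) @ G --> 0.
  by rewrite -[X in _ --> X](mul0r k); apply: cvgM => //; exact: cvg_cst.
have lmax : (fun t => Num.max (l t * ln m) (l t * ln (g t))) @ G --> Num.max 0 y.
  rewrite maxr_absE; under eq_fun do rewrite maxr_absE.
  apply: cvgM; last exact: cvg_cst.
  apply: cvgD; first by apply: cvgD.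
  by apply: cvg_norm; apply: cvgB.
have lmax2 : (fun t => l t * ln 2 + Num.max (l t * ln m) (l t * ln (g t))) @ G --> Num.max 0 y.
  by rewrite -[X in _ --> X]add0r; apply: cvgD.
apply: (@squeeze_cvgr _ _ _ _ _ _ _ _ _ lmax lmax2); near=> t.
have lt0 : 0 < l t by near: t.
have gt0 : 0 < g t by near: t.
rewrite -maxr_pMr ?(ltW lt0) // -mulrDr !ler_pM2l //.
have s0 : 0 < m + g t by rewrite addr_gt0.
apply/andP; split.
  by rewrite ge_max !ler_ln ?posrE //; apply/andP; split; lra.
have [mg|mg] := leP (ln m) (ln (g t)).
  rewrite ler_ln ?posrE // in mg.
  by rewrite -lnM ?posrE // ler_ln ?posrE ?mulr_gt0 //; lra.
move/ltW: mg; rewrite ler_ln ?posrE // => mg.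
by rewrite -lnM ?posrE // ler_ln ?posrE ?mulr_gt0 //; lra.
Unshelve. all: by end_near. Qed.

Lemma cvg_tropical_step (f g : T -> R) (m x y : R) : 0 < m ->
  (\forall t \near G, 0 < f t) -> (\forall t \near G, 0 < g t) ->
  (fun t => l t * ln (f t)) @ G --> x -> (fun t => l t * ln (g t)) @ G --> y ->
  (fun t => l t * ln ((m + g t) / f t)) @ G --> Num.max 0 y - x.
Proof using FG l_gt0 l_cvg0.
move=> m0 f0 g0 lf lg.
have h : (fun t => l t * ln (m + g t) - l t * ln (f t)) @ G --> Num.max 0 y - x.
  by apply: cvgB => //; exact: cvg_scaled_lnD.
apply: cvg_trans h; apply: near_eq_cvg; near=> t.
have ft0 : 0 < f t by near: t.
have gt0 : 0 < g t by near: t.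
by rewrite ln_div ?posrE ?addr_gt0 // mulrBr.
Unshelve. all: by end_near. Qed.

Lemma cvg_iter_tropical (f : T -> R * R) p i : (forall t, quadrant (f t)) ->
  (fun t => l t * ln (f t).1) @ G --> p.1 -> (fun t => l t * ln (f t).2) @ G --> p.2 ->
  (fun t => l t * (log_coord c (iter i F (f t))).1) @ G --> (iter i tropical_map p).1 /\
  (fun t => l t * (log_coord c (iter i F (f t))).2) @ G --> (iter i tropical_map p).2.
Proof using FG l_gt0 l_cvg0 a0 b0.
move=> f0 l1 l2.
have q0 i t := quadrant_iter i a0 b0 (f0 t).
have [h1 h2] : (fun t => l t * ln (iter i F (f t)).1) @ G --> (iter i tropical_map p).1 /\
  (fun t => l t * ln (iter i F (f t)).2) @ G --> (iter i tropical_map p).2.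
  elim: i => //= i [h1 h2].
  have n1 : \forall t \near G, 0 < (iter i F (f t)).1.
    by near=> t; case/andP: (q0 i t).
  have n2 : \forall t \near G, 0 < (iter i F (f t)).2.
    by near=> t; case/andP: (q0 i t).
  have k1 := cvg_tropical_step a0 n1 n2 h1 h2.
  split; first exact: k1.
  have n3 : \forall t \near G, 0 < (iter i.+1 F (f t)).1.
    by near=> t; case/andP: (q0 i.+1 t).
  exact: (cvg_tropical_step b0 n2 n3 h2 k1).
have lk (k : R) : (fun t => l t * k) @ G --> 0.
  by rewrite -[X in _ --> X](mul0r k); apply: cvgM => //; exact: cvg_cst.
have k1 : (fun t => l t * ln (iter i F (f t)).1 - l t * ln c.1) @ G -->
    (iter i tropical_map p).1 by rewrite -[X in _ --> X]subr0; exact: cvgB.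
have k2 : (fun t => l t * ln (iter i F (f t)).2 - l t * ln c.2) @ G -->
    (iter i tropical_map p).2 by rewrite -[X in _ --> X]subr0; exact: cvgB.
split; [apply: cvg_trans k1 | apply: cvg_trans k2]; apply: near_eq_cvg; near=> t;
  by rewrite /= mulrBr.
Unshelve. all: by end_near. Qed.

End Filter.

Definition tropical_orbit : seq (R * R) :=
  [:: (1, 0); (-1, 0); (1, 1); (0, -1); (0, 1)].

Lemma tropical_mapE : [/\ tropical_map (1, 0) = (-1, 0), tropical_map (-1, 0) = (1, 1),
  tropical_map (1, 1) = (0, -1), tropical_map (0, -1) = (0, 1) &
  tropical_map (0, 1) = (1, 0)].
Proof using Type.
have m1 : Num.max 0 1 = 1 :> R by rewrite max_r.
have mN : Num.max 0 (-1) = 0 :> R by rewrite max_l // oppr_le0.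
have m0 : Num.max 0 0 = 0 :> R by rewrite maxxx.
by split; rewrite /tropical_map /tropical_step /=;
  rewrite !(m1, mN, m0, subr0, sub0r, opprK, subrr, m1, mN, m0, subr0, sub0r, opprK, oppr0, subrr).
Qed.

Lemma tropical_apart p : p \in tropical_orbit ->
  tropical_map p \in tropical_orbit /\
  apart (ortho_coord c p) (ortho_coord c (tropical_map p)).
Proof using a0 b0 cc.
have [e1 e2 e3 e4 e5] := tropical_mapE.
have n01 : (1 : R) != 0 by exact: oner_neq0.
have ap q q' : q != (0, 0) -> q' != (0, 0) ->
    (forall l : R, 0 < l -> q' = (l * q.1, l * q.2) -> False) ->
    apart (ortho_coord c q) (ortho_coord c q').
  move=> q0 q0' h; apply: apart_intro; [exact: ortho_neq0|exact: ortho_neq0|].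
  by move=> l l0 k1 k2; apply: (h l l0); exact: ortho_inj k1 k2.
have nz (x y : R) : (x != 0) || (y != 0) -> (x, y) != (0, 0).
  by rewrite -negb_and; apply: contra => /eqP[-> ->]; rewrite !eqxx.
rewrite !inE => /or4P[/eqP->|/eqP->|/eqP->|/orP[/eqP->|/eqP->]];
  rewrite ?(e1, e2, e3, e4, e5); split; rewrite ?inE ?eqxx ?orbT //;
  (apply: ap; [apply: nz|apply: nz|]; rewrite ?oppr_eq0 ?n01 ?orbT //);
  move=> l l0 /= e; have /= k1 := congr1 fst e; have /= k2 := congr1 snd e;
  (suff : (0 : R) < 0 by rewrite ltxx); lra.
Qed.

(** Two of the five angles are between antipodal vectors and equal [pi]; the other three lie in []0,
    pi[]. The total is a multiple of [2 * pi] strictly between [2 * pi] and [6 * pi]. *)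
Lemma tropical_winding p : p \in tropical_orbit ->
  winding (fun i => ortho_coord c (iter i tropical_map p)) 5 = 2 * (2 * pi).
Proof using a0 b0 cc.
have [e1 e2 e3 e4 e5] := tropical_mapE.
have orb q i : q \in tropical_orbit -> iter i tropical_map q \in tropical_orbit.
  by move=> q0; elim: i => //= i /tropical_apart[].
have cl : exists m : nat,
    winding (fun i => ortho_coord c (iter i tropical_map (1, 0))) 5 = m%:R * (2 * pi).
  apply: winding_closed => [i|]; last by rewrite /= !(e1, e2, e3, e4, e5).
  by have [] := tropical_apart (orb (1, 0) i (mem_head _ _)).
have m1 : (-1, 0) \in tropical_orbit by rewrite !inE eqxx orbT.
have m2 : (1, 1) \in tropical_orbit by rewrite !inE eqxx !orbT.
have m4 : (0, 1) \in tropical_orbit by rewrite !inE eqxx !orbT.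
have [_ p2] := tropical_apart m1; have [_ p3] := tropical_apart m2.
have [_ p5] := tropical_apart m4.
rewrite e2 in p2; rewrite e3 in p3; rewrite e5 in p5.
have cr q q' : q.1 * q'.2 - q.2 * q'.1 < 0 -> 0 < cross (ortho_coord c q) (ortho_coord c q').
  move=> h; rewrite cross_ortho mulNr oppr_gt0 pmulr_rlt0 //.
  by rewrite mulr_gt0 // sqrtr_gt0 ?slope2_gt0 ?ortho_disc_gt0.
have h2 : angle (ortho_coord c (-1, 0)) (ortho_coord c (1, 1)) < pi.
  by apply: (angle_ltpi p2); apply: cr => /=; lra.
have h3 : angle (ortho_coord c (1, 1)) (ortho_coord c (0, -1)) < pi.
  by apply: (angle_ltpi p3); apply: cr => /=; lra.
have h5 : angle (ortho_coord c (0, 1)) (ortho_coord c (1, 0)) < pi.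
  by apply: (angle_ltpi p5); apply: cr => /=; lra.
have h1 : angle (ortho_coord c (1, 0)) (ortho_coord c (-1, 0)) = pi.
  by apply: angle_antipodal; rewrite cross_ortho /=; ring.
have h4 : angle (ortho_coord c (0, -1)) (ortho_coord c (0, 1)) = pi.
  by apply: angle_antipodal; rewrite cross_ortho /=; ring.
have g2 := angle_gt0 (ortho_coord c (-1, 0)) (ortho_coord c (1, 1)).
have g3 := angle_gt0 (ortho_coord c (1, 1)) (ortho_coord c (0, -1)).
have g5 := angle_gt0 (ortho_coord c (0, 1)) (ortho_coord c (1, 0)).
case: cl => m; rewrite /winding !big_ord_recl !big_ord0 /=.
rewrite !(e1, e2, e3, e4, e5) h1 h4 => S.
set t2 := angle (ortho_coord c (-1, 0)) _ in h2 g2 S *.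
set t3 := angle (ortho_coord c (1, 1)) _ in h3 g3 S *.
set t5 := angle (ortho_coord c (0, 1)) _ in h5 g5 S *.
have pi0 := @pi_gt0 R.
have {}S : pi + (t2 + (t3 + (pi + (t5 + 0)))) = 2 * (2 * pi).
  rewrite S; congr (_ * _).
  have h6 : 1%:R * (2 * pi) < m%:R * (2 * pi) :> R by rewrite -S; lra.
  have h7 : m%:R * (2 * pi) < 3%:R * (2 * pi) :> R by rewrite -S; lra.
  have p20 : 0 < 2 * pi :> R by rewrite mulr_gt0.
  move: h6 h7; rewrite !(ltr_pM2r p20) !ltr_nat.
  by case: m {S} => [|[|[|]]].
rewrite !inE => /or4P[/eqP->|/eqP->|/eqP->|/orP[/eqP->|/eqP->]];
  rewrite !(e1, e2, e3, e4, e5) ?h1 ?h4 -/t2 -/t3 -/t5; lra.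
Qed.

Lemma rotation5_infinity j :
  (fun t => rotation a b c 5 (iter j F (exp_coord c (t, 0)))) @ +oo --> 2 * (2 * pi).
Proof using a0 b0 cc.
pose P i := iter i tropical_map (1, 0).
have orb i : P i \in tropical_orbit.
  by elim: i => [|i /tropical_apart[]//]; exact: mem_head.
rewrite -(tropical_winding (orb j)).
pose f t := exp_coord c (t, 0).
have l0 : \forall t \near (+oo : set_system R), 0 < t^-1.
  by near=> t; rewrite invr_gt0; near: t; exact: nbhs_pinfty_gt.
have lc : (fun t : R => t^-1) @ +oo --> (0 : R).
  apply/(gtr0_cvgV0 (f := id)); last exact: cvg_id.
  by near=> t; near: t; exact: nbhs_pinfty_gt.
have f0 t : quadrant (f t) by exact: quadrant_exp.
have /andP[c1 c2] := cq.
have lk (k : R) : (fun t : R => t^-1 * k) @ +oo --> (0 : R).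
  by rewrite -[X in _ --> X](mul0r k); apply: cvgM => //; exact: cvg_cst.
have l1 : (fun t => t^-1 * ln (f t).1) @ +oo --> (1 : R).
  have h : (fun t : R => t^-1 * ln c.1 + 1) @ +oo --> (1 : R).
    by rewrite -[X in _ --> X]add0r; apply: cvgD => //; exact: cvg_cst.
  apply: cvg_trans h; apply: near_eq_cvg; near=> t.
  have t0 : 0 < t by near: t; exact: nbhs_pinfty_gt.
  by rewrite /= lnM ?posrE ?expR_gt0 // expRK; field; rewrite gt_eqF.
have l2 : (fun t => t^-1 * ln (f t).2) @ +oo --> (0 : R).
  by under eq_fun do rewrite /= expR0 mulr1; exact: lk.
have FF : Filter (+oo : set_system R) by exact: proper_pinfty_nbhs.
have cv i := cvg_iter_tropical (FG := FF) l0 lc (p := (1, 0)) i f0 l1 l2.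
apply: (cvg_rotation_asymptotic _ l0) => // i.
- by rewrite -iterD; under eq_fun do rewrite -iterD; have [] := cv (i + j)%N.
- by rewrite -iterD; under eq_fun do rewrite -iterD; have [] := cv (i + j)%N.
- by rewrite -!iterD addSn; have [] := tropical_apart (orb (i + j)%N).
Unshelve. all: by end_near. Qed.

End Infinity.

(** * Existence and range of rotation numbers *)

Section RotationNumber.
Context {R : realType} (a b : R) (c : R * R).
Hypotheses (a0 : 0 < a) (b0 : 0 < b) (cc : critical a b c).

Let cq : quadrant c. Proof. by case/and3P: cc. Qed.
Let c_gt1 : 1 < c.1 * c.2. Proof. exact: critical_prod_gt1 cc. Qed.
Let F := lyness_map a b.
Let rot := rotation a b c.
Let pi0 : 0 < pi :> R. Proof. exact: pi_gt0. Qed.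

(** On the segment from [c] to [z], [rot n] varies continuously from its limit
    [n%:R * critical_angle c] to its value at [z]. *)
Lemma rotation_ivt z n (l : R) : quadrant z -> z != c ->
  (n%:R * critical_angle c - l) * (rot n z - l) < 0 ->
  exists w, [/\ quadrant w, w != c & rot n w = l].
Proof using a0 b0 cc.
move=> z0 zc ll.
pose g s := rot n (toward c z s).
have gc s : 0 < s <= 1 -> {for s, continuous g}.
  move=> /andP[s0 s1]; apply: cvg_rotation => //;
    rewrite ?toward_neq ?quadrant_toward ?(ltW s0) //; exact: continuous_affine.
have lim0 := rotation_near_critical a0 b0 cc (n := n) z0 zc.
have h0 : \forall s \near (0 : R)^'+, (g s - l) * (rot n z - l) < 0.
  have : (fun s => (g s - l) * (rot n z - l)) @ (0 : R)^'+ --> (n%:R * critical_angle c - l) * (rot n z - l).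
    by apply: cvgM; [apply: cvgB => //; exact: cvg_cst | exact: cvg_cst].
  by move=> /cvgr_lt; apply.
have [s [s0 s1 hs]] : exists s : R, [/\ 0 < s, s < 1 & (g s - l) * (rot n z - l) < 0].
  near (0 : R)^'+ => s; exists s; split.
  - by near: s; exact: nbhs_right_gt.
  - by near: s; exact: nbhs_right_lt.
  - by near: s.
have [||x /andP[sx x1] gx] := @ivt_sign R g s 1 l (ltW s1).
- by move=> x /andP[sx x1]; apply: gc; rewrite x1 andbT (lt_le_trans s0).
- by rewrite [g 1]/g toward1 ltW.
- have x0 : 0 < x by exact: lt_le_trans sx.
  by exists (toward c z x); rewrite quadrant_toward ?toward_neq // ?x1 ?ltW.
Unshelve. all: by end_near. Qed.

(** With [x = pi / 3], the triple angle formula turns [cos (3 * x) = -1] into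
    [(cos x + 1) * (2 * cos x - 1) ^+ 2 = 0]. *)
Lemma cos_pi_third : cos (pi / 3) = 1 / 2 :> R.
Proof using Type.
set x := pi / 3.
have c0 : 0 < cos x by apply: cos_gt0_pihalf; rewrite /x; have := @pi_gt0 R; lra.
have : cos (x + (x + x)) = -1 by rewrite -cospi; congr cos; rewrite /x; field.
rewrite cosD cosD sinD => e.
have {}e : (cos x + 1) * (2 * cos x - 1) ^+ 2 = 0.
  have s2 := sin2cos2 x.
  transitivity (cos x * (cos x * cos x - sin x * sin x) - sin x * (sin x * cos x + cos x * sin x)
     + 1 + 3 * cos x * (sin x ^+ 2 - (1 - cos x ^+ 2))); first by ring.
  by rewrite e s2; ring.
move/eqP: e; rewrite mulf_eq0 sqrf_eq0 gt_eqF ?addr_gt0 //= subr_eq0 => /eqP e.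
lra.
Qed.

Lemma critical_angle_gt : 2 * pi < 3 * critical_angle c.
Proof using a0 b0 cc.
have /andP[f0 f1] := critical_angle_itv cq c_gt1.
have x0 : 2 * pi / 3 = pi / 3 + pi / 3 :> R by field.
have cx : cos (2 * pi / 3) = - (1 / 2) :> R.
  by rewrite x0 cosD -!expr2 sin2cos2 cos_pi_third; field.
have : cos (critical_angle c) < cos (2 * pi / 3).
  by rewrite cx cos_critical_angle //; have := slope_prod_lt1 cq c_gt1; lra.
have i1 : critical_angle c \in `[0, pi] by rewrite in_itv /= !ltW.
have i2 : 2 * pi / 3 \in `[0, (pi : R)] by rewrite in_itv /=; apply/andP; split; lra.
by rewrite (ltr_cos i2 i1); lra.
Qed.

(** One full turn would make the point fixed by the second iterate, against [fixed2]. Near [c] the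
    value is below one turn, so it stays below. [rotation3_gt] is the mirror argument with [fixed3]
    and [critical_angle_gt]. *)
Lemma rotation2_lt z : quadrant z -> z != c -> rot 2 z < 2 * pi.
Proof using a0 b0 cc.
move=> z0 zc; have /andP[f0 f1] := critical_angle_itv cq c_gt1.
have ne w : quadrant w -> w != c -> rot 2 w != 2 * pi.
  move=> w0 wc; apply/eqP => e; move/eqP: (wc); apply.
  apply/(critical_uniq a0 b0 _ cc)/(fixed2 a0 b0 w0).
  by apply: (rotation_multiple a0 b0 cc (m := 1)) => //; rewrite mul1r.
rewrite ltNge; apply/negP => h.
have [|w [w0 wc we]] := @rotation_ivt z 2 (2 * pi) z0 zc.
  rewrite nmulr_rlt0; first by rewrite subr_gt0 lt_neqAle h eq_sym ne.
  by lra.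
by have := ne w w0 wc; rewrite we eqxx.
Qed.

Lemma rotation3_gt z : quadrant z -> z != c -> 2 * pi < rot 3 z.
Proof using a0 b0 cc.
move=> z0 zc; have f0 := critical_angle_gt.
have ne w : quadrant w -> w != c -> rot 3 w != 2 * pi.
  move=> w0 wc; apply/eqP => e; move/eqP: (wc); apply.
  apply/(critical_uniq a0 b0 _ cc)/(fixed3 a0 b0 w0).
  by apply: (rotation_multiple a0 b0 cc (m := 1)) => //; rewrite mul1r.
rewrite ltNge; apply/negP => h.
have [|w [w0 wc we]] := @rotation_ivt z 3 (2 * pi) z0 zc.
  rewrite pmulr_rlt0; first by rewrite subr_lt0 lt_neqAle h ne.
  by lra.
by have := ne w w0 wc; rewrite we eqxx.
Qed.

Lemma rotation_shift n j z : iter n F z = z -> rot n (iter j F z) = rot n z.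
Proof using Type.
move=> zE; have := rotationD a b c n j z; rewrite addnC rotationD zE -/F -/rot.
by rewrite [RHS]addrC => /addrI.
Qed.

Lemma rotation_average n m z : iter n F z = z ->
  \sum_(i < n) rot m (iter i F z) = m%:R * rot n z.
Proof using Type.
move=> zE; rewrite /rot rotation_exchange.
under eq_bigr => j _ do rewrite -/F -/rot rotation_shift //.
by rewrite sumr_const card_ord mulr_natl.
Qed.

(** Averaging [rotation3_gt] and [rotation2_lt] over the cycle turns bounds on 3 and 2 steps into
    bounds on [q / n]. *)
Lemma periodic_rotation_range n q z : (0 < n)%N -> quadrant z -> z != c ->
  iter n F z = z -> rot n z = q%:R * (2 * pi) -> (n < 3 * q)%N /\ (2 * q < n)%N.
Proof using a0 b0 cc.
move=> n0 z0 zc zE rE.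
have iq i : quadrant (iter i F z) by exact: quadrant_iter.
have ic i : iter i F z != c by exact: iter_neq_critical.
have p2 : 0 < 2 * pi :> R by rewrite mulr_gt0.
have cst (x : R) : \sum_(i < n) x = n%:R * x by rewrite sumr_const card_ord mulr_natl.
have n0' : has xpredT (index_enum 'I_n).
  by apply/hasP; exists (Ordinal n0) => //; exact: mem_index_enum.
split; rewrite -(ltr_nat R) natrM -(ltr_pM2r p2) -!mulrA -rE -rotation_average // -cst.
- by apply: (ltr_sum n0') => i _; exact: rotation3_gt.
- by apply: (ltr_sum n0') => i _; exact: rotation2_lt.
Qed.

(** Computing the rotation of [n * d] steps in two ways gives [d * q = n * m]. *)
Lemma prime_rotation n q d z : (0 < n)%N -> coprime n q -> quadrant z -> z != c ->
  rot n z = q%:R * (2 * pi) -> iter d F z = z -> (n %| d)%N.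
Proof using a0 b0 cc.
move=> n0 nq z0 zc rE dE; have nE := rotation_multiple a0 b0 cc z0 zc rE.
have [m mE] := rotation_closed a0 b0 cc z0 zc dE.
have p2 : 2 * pi != 0 :> R by rewrite gt_eqF // mulr_gt0.
have : d%:R * rot n z = n%:R * rot d z.
  by rewrite /rot -!rotation_periodic // mulnC.
rewrite rE /rot mE [X in X = _]mulrA [X in _ = X]mulrA => /(mulIf p2) /eqP; rewrite -!natrM eqr_nat => /eqP e.
by rewrite -(Gauss_dvdl _ nq) e dvdn_mulr.
Qed.

(** [rotation_exchange] turns the sum of [rot n] over five points into a sum of [n] values of
    [rot 5], each tending to two turns. A sum is used because the separate terms need not converge
    to two fifths of [n] turns. *)
Lemma infinity_rotation n : (0 < n)%N -> forall e, 0 < e ->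
  exists z, [/\ quadrant z, z != c &
    `|\sum_(i < 5) rot n (iter i F z) - n%:R * (2 * (2 * pi))| < e].
Proof using a0 b0 cc.
move=> n0 e e0.
have h : (fun t => \sum_(j < n) rot 5 (iter j F (exp_coord c (t, 0)))) @ +oo -->
    n%:R * (2 * (2 * pi)).
  have -> : n%:R * (2 * (2 * pi)) = \sum_(j < n) (2 * (2 * pi)) :> R.
    by rewrite sumr_const card_ord mulr_natl.
  elim: (n) => [|k IH].
    by rewrite big_ord0; under eq_fun do rewrite big_ord0; exact: cvg_cst.
  rewrite big_ord_recr /=; under eq_fun do rewrite big_ord_recr /=.
  by apply: cvgD => //; exact: rotation5_infinity.
move/cvgrPdist_lt: h => /(_ e e0) h.
near (+oo : set_system R) => t.
have t0 : 0 < t by near: t; exact: nbhs_pinfty_gt.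
exists (exp_coord c (t, 0)); split.
- exact: quadrant_exp.
- rewrite -log_coord_eq0 ?quadrant_exp // exp_coordK //.
  by apply/eqP => -[t1]; move: t0; rewrite t1 ltxx.
- by rewrite /rot rotation_exchange distrC; near: t.
Unshelve. all: by end_near. Qed.

Lemma exists_rotation n q : (0 < n)%N ->
  (n%:R * critical_angle c - q%:R * (2 * pi)) * (2 * n%:R - 5 * q%:R) < 0 ->
  exists z, [/\ quadrant z, z != c & rot n z = q%:R * (2 * pi)].
Proof using a0 b0 cc.
move=> n0 nq.
(* Within this tolerance the five-point sum minus [5 * q] turns has the sign of [2 * n - 5 * q], so
   at least one of the five terms minus [q] turns has it too. *)
have e0 : 0 < 2 * pi * `|2 * n%:R - 5 * q%:R| :> R.
  rewrite mulr_gt0 ?mulr_gt0 // normr_gt0; apply: contraTneq nq => ->.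
  by rewrite mulr0 ltxx.
have [z [z0 zc]] := infinity_rotation n0 e0.
set S := \sum_(_ < _) _ => hS.
have [i hi] : exists i : 'I_5,
    (n%:R * critical_angle c - q%:R * (2 * pi)) * (rot n (iter i F z) - q%:R * (2 * pi)) < 0.
  apply/existsP; rewrite -[X in is_true X]negbK negb_exists; apply/negP => /forallP hall.
  have : 0 <= \sum_(i < 5) (n%:R * critical_angle c - q%:R * (2 * pi)) *
      (rot n (iter i F z) - q%:R * (2 * pi)).
    by apply: sumr_ge0 => i _; rewrite leNgt.
  rewrite -mulr_sumr sumrB -/S sumr_const card_ord -[(q%:R * _) *+ 5]mulr_natl.
  move: hS nq; set X := _ * critical_angle c - _.
  have [k0|k0] := ltP 0 (2 * n%:R - 5 * q%:R : R).
    rewrite (gtr0_norm k0) ltr_norml => /andP[h1 h2].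
    rewrite pmulr_llt0 // => X0; rewrite nmulr_rge0 //; lra.
  rewrite (ler0_norm k0) ltr_norml => /andP[h1 h2].
  move=> nq; have {}k0 : 2 * n%:R - 5 * q%:R < 0 :> R.
    by rewrite lt_neqAle k0 andbT; apply: contraTneq nq => ->; rewrite mulr0 ltxx.
  move: nq; rewrite nmulr_llt0 // => X0; rewrite pmulr_rge0 //; lra.
apply: (rotation_ivt _ _ hi); first exact: quadrant_iter.
exact: iter_neq_critical.
Qed.

End RotationNumber.

(** * The sign of the five-step rotation on a level *)

Lemma same_sign_path (R : realType) (f : R -> R) (u v l : R) : u <= v ->
  (forall x, u <= x <= v -> {for x, continuous f}) ->
  (forall x, u <= x <= v -> f x != l) -> 0 < (f u - l) * (f v - l).
Proof.
move=> uv fc fl; rewrite ltNge; apply/negP => h.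
have [x xuv fx] := ivt_sign uv fc h.
by have := fl x xuv; rewrite fx eqxx.
Qed.

Lemma same_sign_trans (R : realType) (y x z : R) : 0 < x * y -> 0 < y * z -> 0 < x * z.
Proof.
move=> xy yz; have y0 : y != 0 by apply: contraTneq xy => ->; rewrite mulr0 ltxx.
have : 0 < (x * y) * (y * z) by rewrite mulr_gt0.
have -> : x * y * (y * z) = y ^+ 2 * (x * z) by ring.
by rewrite pmulr_rgt0 // lt0r sqr_ge0 sqrf_eq0 y0.
Qed.

Section Torsion5Sign.
Context {R : realType} (a b : R) (c : R * R).
Hypotheses (a0 : 0 < a) (b0 : 0 < b) (cc : critical a b c).

Let cq : quadrant c. Proof. by case/and3P: cc. Qed.
Let c_gt1 : 1 < c.1 * c.2. Proof. exact: critical_prod_gt1 cc. Qed.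
Let F := lyness_map a b.
Let rot := rotation a b c.
Let pi0 : 0 < pi :> R. Proof. exact: pi_gt0. Qed.

Definition polar (s t : R) : R * R := exp_coord c (s * cos t, s * sin t).

Lemma cos_sin_neq0 (t : R) : (cos t, sin t) != (0, 0).
Proof using Type.
apply/eqP => -[h1 h2]; have := cos2Dsin2 t.
by rewrite h1 h2 expr0n addr0 => /eqP; rewrite eq_sym oner_eq0.
Qed.

Lemma polar_neq (s t : R) : 0 < s -> polar s t != c.
Proof using cc.
move=> s0; rewrite -log_coord_eq0 ?quadrant_exp // exp_coordK //.
apply: contra (cos_sin_neq0 t) => /eqP[/eqP + /eqP].
by rewrite !mulf_eq0 gt_eqF //= => /eqP-> /eqP->.
Qed.

Lemma polar_exists z : quadrant z -> z != c -> exists2 s, 0 < s & exists t, z = polar s t.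
Proof using cc.
move=> z0; rewrite -(log_coord_eq0 cq z0) -{2}(log_coordK cq z0).
case: (log_coord c z) => x y p0.
have s0 : 0 < nrm (x, y) by rewrite nrm_gt0.
have s2 := sqr_nrm (x, y); rewrite /dot /= in s2.
set s := nrm (x, y) in s0 s2 *; exists s => //.
have xs : -1 <= x / s <= 1.
  rewrite ler_pdivlMr // ler_pdivrMr // mulN1r mul1r -ler_norml.
  by rewrite -(ler_sqr (normr_ge0 _) (ltW s0)) ?nnegrE // real_normK ?num_real // s2 expr2; nra.
have cx : s * cos (acos (x / s)) = x by rewrite acosK ?in_itv //= mulrC divfK ?gt_eqF.
have sx : s * sin (acos (x / s)) = `|y|.
  rewrite sin_acos // -[X in X * _]ger0_norm ?(ltW s0) // -sqrtr_sqr -sqrtrM ?sqr_ge0 //.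
  rewrite -sqrtr_sqr; congr Num.sqrt.
  by rewrite mulrBr mulr1 -exprMn [s * _]mulrC divfK ?gt_eqF // s2; ring.
have [y0|y0] := leP 0 y.
  by exists (acos (x / s)); rewrite /polar cx sx ger0_norm.
by exists (- acos (x / s)); rewrite /polar cosN sinN mulrN cx sx ltr0_norm // opprK.
Qed.

Lemma polar_level (s s' t : R) : 0 < s -> s <= s' ->
  lyness_inv a b (polar s t) <= lyness_inv a b (polar s' t).
Proof using a0 b0 cc.
move=> s0; rewrite le_eqVlt => /orP[/eqP->//|ss]; apply: ltW.
have -> : polar s' t = exp_coord c ((s' / s) * (s * cos t, s * sin t).1, (s' / s) * (s * cos t, s * sin t).2).
  by rewrite /polar /= !mulrA divfK ?gt_eqF.
apply: lyness_inv_ray => //; last by rewrite ltr_pdivlMr // mul1r.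
apply: contra (cos_sin_neq0 t) => /eqP[/eqP + /eqP].
by rewrite !mulf_eq0 gt_eqF //= => /eqP-> /eqP->.
Qed.

Lemma level_gt_critical z : quadrant z -> z != c -> lyness_inv a b c < lyness_inv a b z.
Proof using a0 b0 cc.
move=> z0 zc; rewrite -(log_coordK cq z0) lyness_inv_min //.
by rewrite log_coord_eq0.
Qed.

(** Exactly two turns would make [z] fixed by the fifth iterate, so [periodic5_torsion] applies. *)
Lemma rotation5_neq z : quadrant z -> z != c ->
  torsion5 a b (lyness_inv a b z) != 0 -> rot 5 z != 2 * (2 * pi).
Proof using a0 b0 cc.
move=> z0 zc; apply: contra => /eqP e; apply/eqP.
have [|//] := periodic5_torsion a0 b0 z0 (rotation_multiple a0 b0 cc (m := 2) z0 zc e).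
by move=> /(critical_uniq a0 b0)/(_ cc) /eqP; rewrite (negPf zc).
Qed.

Lemma continuous_rotation_radius n t (s : R) : 0 < s ->
  {for s, continuous (fun s => rot n (polar s t))}.
Proof using a0 b0 cc.
move=> s0; apply: cvg_rotation; rewrite ?polar_neq ?quadrant_exp //=;
  (apply: cvgM; first exact: cvg_cst);
  apply: (@continuous_cvg _ R R _ _ _ expR); try exact: continuous_expR;
  by apply: cvgM; [exact: cvg_id|exact: cvg_cst].
Qed.

Lemma continuous_rotation_angle n (s t : R) : 0 < s ->
  {for t, continuous (fun t => rot n (polar s t))}.
Proof using a0 b0 cc.
move=> s0; apply: cvg_rotation; rewrite ?polar_neq ?quadrant_exp //=;
  (apply: cvgM; first exact: cvg_cst);
  apply: (@continuous_cvg _ R R _ _ _ expR); try exact: continuous_expR;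
  (apply: cvgM; first exact: cvg_cst); [exact: continuous_cos|exact: continuous_sin].
Qed.

Let g (z : R * R) : R := rot 5 z - 2 * (2 * pi).
Let torsion_free z := torsion5 a b (lyness_inv a b z) != 0.

Lemma radial_same_sign s s' t : 0 < s -> s <= s' ->
  (forall r, s <= r <= s' -> torsion_free (polar r t)) ->
  0 < g (polar s t) * g (polar s' t).
Proof using a0 b0 cc.
move=> s0 ss h; apply: (@same_sign_path R (fun r => rot 5 (polar r t))) => // r /andP[sr rs].
- by apply: continuous_rotation_radius; exact: lt_le_trans sr.
- apply: rotation5_neq; rewrite ?quadrant_exp ?polar_neq ?(lt_le_trans s0) //.
  by apply: h; rewrite sr.
Qed.

Lemma angular_same_sign s t t' : 0 < s ->
  (forall r, torsion_free (polar s r)) -> 0 < g (polar s t) * g (polar s t').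
Proof using a0 b0 cc.
move=> s0 h; wlog tt : t t' / t <= t'.
  by have [tt|/ltW tt] := leP t t'; last rewrite mulrC; apply.
apply: (@same_sign_path R (fun r => rot 5 (polar s r))) => // r _.
- exact: continuous_rotation_angle.
- by apply: rotation5_neq; rewrite ?quadrant_exp ?polar_neq //; exact: h.
Qed.

(* torsion5 is affine in the level, so it keeps its sign either on all levels *)
(* above that of z and w or on all levels below; the two points are joined    *)
(* within that region through a large, respectively small, circle.            *)
Lemma rotation5_same_sign z w : quadrant z -> quadrant w -> z != c ->
  lyness_inv a b w = lyness_inv a b z -> torsion_free z -> 0 < g z * g w.
Proof using a0 b0 cc.
move=> z0 w0 zc wz Tz.
have hz := level_gt_critical z0 zc.
have wc : w != c by apply: contraTneq hz => e; rewrite -wz e ltxx.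
have [s s0 [t zE]] := polar_exists z0 zc.
have [s' s'0 [t' wE]] := polar_exists w0 wc.
set h := lyness_inv a b z in hz wz Tz.
have above_below : (forall k, h <= k -> torsion5 a b k != 0) \/
    (forall k, k <= h -> torsion5 a b k != 0).
  have e k : torsion5 a b k * torsion5 a b h =
      torsion5 a b h ^+ 2 + (k - h) * ((a * b - 1) * torsion5 a b h).
    by rewrite /torsion5; ring.
  have T2 : 0 < torsion5 a b h ^+ 2 by rewrite lt0r sqr_ge0 sqrf_eq0 andbT; exact: Tz.
  have [d0|d0] := leP 0 ((a * b - 1) * torsion5 a b h); [left|right] => k kh;
    apply/eqP => Tk; move: (e k); rewrite Tk mul0r.
    have : 0 <= (k - h) * ((a * b - 1) * torsion5 a b h) by rewrite mulr_ge0 // subr_ge0.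
    lra.
  have : 0 <= (k - h) * ((a * b - 1) * torsion5 a b h) by rewrite mulr_le0 ?(ltW d0) // subr_le0.
  lra.
have Vz : lyness_inv a b (polar s t) = h by rewrite -zE.
have Vw : lyness_inv a b (polar s' t') = h by rewrite -wE.
rewrite zE wE; case: above_below => Th.
- have [m m0 hm] := lyness_inv_lower a0 b0 cc.
  (* By [lyness_inv_lower] and [|cos r| + |sin r| >= 1], the whole circle of radius [S] lies on
     levels at least [h]. *)
  pose S := Num.max (Num.max s s') (h / m).
  have sS : s <= S by rewrite !le_max lexx.
  have s'S : s' <= S by rewrite !le_max lexx orbT.
  have S0 : 0 < S by exact: lt_le_trans sS.
  have hS : h <= m * S by rewrite mulrC -ler_pdivrMr // !le_max lexx !orbT.
  have circ r : torsion_free (polar S r).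
    apply: Th; apply: le_trans (hm _) => /=; apply: le_trans hS _.
    have e : `|cos r| ^+ 2 + `|sin r| ^+ 2 = 1.
      by rewrite !real_normK ?num_real // cos2Dsin2.
    have e1 : 1 <= `|cos r| + `|sin r|.
      have := cos_max r; have := sin_max r.
      have := normr_ge0 (cos r); have := normr_ge0 (sin r); nra.
    rewrite ler_wpM2l ?(ltW m0) // !normrM (gtr0_norm S0) -mulrDr.
    by rewrite -[leLHS]mulr1 ler_wpM2l ?(ltW S0).
  apply: (@same_sign_trans _ (g (polar S t))).
    apply: radial_same_sign => // r /andP[r1 _]; apply: Th; rewrite -Vz.
    exact: polar_level.
  apply: (@same_sign_trans _ (g (polar S t'))); first exact: angular_same_sign.
  rewrite mulrC; apply: radial_same_sign => // r /andP[r1 _]; apply: Th; rewrite -Vw.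
  exact: polar_level.
- have hc0 : 0 < lyness_inv a b c.
    have /andP[c1 c2] := cq; rewrite /lyness_inv.
    by rewrite !(addr_gt0, mulr_gt0, divr_gt0, exprn_gt0, invr_gt0).
  (* By [lyness_inv_upper], the whole circle of radius [S] lies on levels at most [h]. *)
  pose S := Num.min (Num.min s s') (ln (h / lyness_inv a b c) / 2).
  have L0 : 0 < ln (h / lyness_inv a b c) / 2.
    by rewrite divr_gt0 // ln_gt0 // ltr_pdivlMr // mul1r.
  have Ss : S <= s by rewrite !ge_min lexx.
  have Ss' : S <= s' by rewrite !ge_min lexx orbT.
  have S0 : 0 < S by rewrite !lt_min s0 s'0 L0.
  have hS : lyness_inv a b c * expR (2 * S) <= h.
    rewrite mulrC -ler_pdivlMr // -[leRHS]lnK ?posrE ?divr_gt0 //; last exact: lt_trans hz.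
    by rewrite ler_expR mulrC -ler_pdivlMr // !ge_min lexx !orbT.
  have circ r : torsion_free (polar S r).
    apply: Th; apply: le_trans hS; apply: lyness_inv_upper => //=;
      rewrite normrM (gtr0_norm S0) ler_piMr ?(ltW S0) //; [exact: cos_max|exact: sin_max].
  apply: (@same_sign_trans _ (g (polar S t))).
    rewrite mulrC; apply: radial_same_sign => // r /andP[r1 r2]; apply: Th; rewrite -Vz.
    by apply: polar_level => //; exact: lt_le_trans r1.
  apply: (@same_sign_trans _ (g (polar S t'))); first exact: angular_same_sign.
  apply: radial_same_sign => // r /andP[r1 r2]; apply: Th; rewrite -Vw.
  by apply: polar_level => //; exact: lt_le_trans r1.
Qed.

(** The ten steps make four turns, the only count allowed by [periodic_rotation_range]. Off the
    torsion level, the two halves would then deviate from two turns by opposite nonzero amounts,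
    against [rotation5_same_sign]. *)
Lemma periodic10 z : quadrant z -> iter 10 F z = z -> iter 5 F z = z.
Proof using a0 b0 cc.
move=> z0 zE; have [->|zc] := eqVneq z c.
  have e : F c = c by apply/eqP; rewrite critical_fixed.
  by rewrite /= !e.
have [T0|T0] := eqVneq (torsion5 a b (lyness_inv a b z)) 0; first exact: torsion5_periodic.
have [q qE] := rotation_closed a0 b0 cc z0 zc zE.
have [|q1 q2] := periodic_rotation_range a0 b0 cc _ z0 zc zE qE; first by [].
have q4 : q = 4%N by move: q1 q2; case: q {qE} => [|[|[|[|[|q]]]]] //; rewrite !mulnS.
have w0 : quadrant (iter 5 F z) by exact: quadrant_iter.
have := rotation5_same_sign z0 w0 zc (lyness_inv_iter 5 a0 b0 z0) T0.
have := rotationD a b c 5 5 z; rewrite qE q4 -/F -/rot /g.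
set x := rot 5 z; set y := rot 5 _ => e.
have -> : y - 2 * (2 * pi) = - (x - 2 * (2 * pi)).
  by have : x + y = 4 * (2 * pi) by []; lra.
rewrite mulrN -expr2 oppr_gt0 => h.
by have := le_lt_trans (sqr_ge0 (x - 2 * (2 * pi))) h; rewrite ltxx.
Qed.

End Torsion5Sign.

(** * The resonant case, where sigma is 2/5 *)

Section Resonance.
Context {R : realType} (a b : R) (c : R * R).
Hypotheses (a0 : 0 < a) (b0 : 0 < b) (cc : critical a b c).

Let cq : quadrant c. Proof. by case/and3P: cc. Qed.
Let F := lyness_map a b.
Let rot := rotation a b c.
Let pi0 : 0 < pi :> R. Proof. exact: pi_gt0. Qed.

(** Every term of the invariant is positive, hence at most [h], which confines the level to a box
    away from the axes; clearing denominators makes it the zero set of the polynomial [P] there. *)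
Lemma compact_level (h : R) : compact [set z : R * R | quadrant z /\ lyness_inv a b z = h].
Proof using a0 b0.
have [h0|h0] := leP h 0.
  rewrite (_ : [set z | _] = set0); first exact: compact0.
  rewrite -subset0 => -[x y] [/andP[/= x0 y0]] /= e; move: h0; rewrite -e leNgt => /negP; apply.
  by rewrite /lyness_inv /= !(addr_gt0, divr_gt0, mulr_gt0, exprn_gt0).
pose m1 := (b + a ^+ 2) / h; pose m2 := (a + b ^+ 2) / h.
have m10 : 0 < m1 by rewrite divr_gt0 ?addr_gt0 ?exprn_gt0.
have m20 : 0 < m2 by rewrite divr_gt0 ?addr_gt0 ?exprn_gt0.
pose P (z : R * R) := (a * z.2 + b) * (z.1 * z.1 + a + z.2) + z.1 * (b * (z.2 * z.2) + (a + b * b) - h * z.2).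
have VP x y : 0 < x -> 0 < y -> (lyness_inv a b (x, y) = h) <-> (P (x, y) = 0).
  move=> x0 y0; have -> : P (x, y) = (lyness_inv a b (x, y) - h) * (x * y).
    by rewrite /P /lyness_inv /=; field; rewrite !gt_eqF.
  split=> [->|]; first by rewrite subrr mul0r.
  by move/eqP; rewrite !mulf_eq0 (gt_eqF x0) (gt_eqF y0) !orbF subr_eq0 => /eqP.
have bounds x y : 0 < x -> 0 < y -> lyness_inv a b (x, y) = h ->
    (m1 <= x <= h / a) /\ (m2 <= y <= h / b).
  move=> x0 y0; rewrite /lyness_inv /= => e.
  have t1 : 0 < a * x by rewrite mulr_gt0.
  have t2 : 0 < b * y by rewrite mulr_gt0.
  have t3 : 0 < b * (x / y) by rewrite !(divr_gt0, mulr_gt0).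
  have t4 : 0 < a * (y / x) by rewrite !(divr_gt0, mulr_gt0).
  have t5 : 0 < (a + b ^+ 2) / y by rewrite divr_gt0 ?addr_gt0 ?exprn_gt0.
  have t6 : 0 < (b + a ^+ 2) / x by rewrite divr_gt0 ?addr_gt0 ?exprn_gt0.
  have t7 : 0 < a * b / (x * y) by rewrite !(divr_gt0, mulr_gt0).
  rewrite /m1 /m2 !ler_pdivrMr // !ler_pdivlMr //.
  rewrite [x * h]mulrC [y * h]mulrC -!ler_pdivrMr //.
  by split; apply/andP; split; lra.
apply: (@subclosed_compact _ _ (`[m1, h / a] `*` `[m2, h / b])).
- rewrite (_ : [set z | _] = [set z | m1 <= z.1] `&` [set z | m2 <= z.2] `&` [set z | P z = 0]).
    apply: closedI; first apply: closedI.
    + apply: (@closed_comp _ _ fst [set t | m1 <= t]) => [z _|]; [exact: cvg_fst|exact: closed_ge].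
    + apply: (@closed_comp _ _ snd [set t | m2 <= t]) => [z _|]; [exact: cvg_snd|exact: closed_ge].
    + apply: (@closed_comp _ _ P [set t | t = 0]) => [z _|]; last exact: closed_eq.
      have f1 : (fun z : R * R => z.1) @ z --> z.1 by exact: cvg_fst.
      have f2 : (fun z : R * R => z.2) @ z --> z.2 by exact: cvg_snd.
      have fk (k : R) : (fun _ : R * R => k) @ z --> k by exact: cvg_cst.
      apply: cvgD; apply: cvgM => //.
      * by apply: cvgD => //; apply: cvgM.
      * by do 2 (apply: cvgD => //); apply: cvgM.
      * apply: cvgB; last by apply: cvgM.
        by apply: cvgD => //; apply: cvgM => //; apply: cvgM.
  apply/seteqP; split => -[x y] /=.
    move=> [/andP[/= x0 y0] Vh]; split; last by apply/VP.
    by have [/andP[? _] /andP[? _]] := bounds x y x0 y0 Vh.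
  move=> [[/= h1 h2] h3]; have x0 : 0 < x by exact: lt_le_trans h1.
  have y0 : 0 < y by exact: lt_le_trans h2.
  by rewrite /quadrant /= x0 y0; split => //; apply/VP.
- by apply: compact_setX; exact: segment_compact.
- move=> [x y] [/andP[/= x0 y0] Vh] /=; rewrite !in_itv /=.
  by have [? ?] := bounds x y x0 y0 Vh.
Qed.

(** The distance of [rot 5] from two turns is continuous and nonzero on a compact level, so has a
    positive minimum, and [rotation5_same_sign] fixes the side along the orbit. *)
Lemma level_gap z : quadrant z -> z != c -> torsion5 a b (lyness_inv a b z) != 0 ->
  exists2 e, 0 < e & (forall j, 2 * (2 * pi) + e <= rot 5 (iter j F z)) \/
                     (forall j, rot 5 (iter j F z) <= 2 * (2 * pi) - e).
Proof using a0 b0 cc.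
move=> z0 zc T0; set h := lyness_inv a b z in T0.
pose A := [set w : R * R | quadrant w /\ lyness_inv a b w = h].
have Ac w : A w -> w != c.
  move=> [w0 wh]; have := level_gt_critical a0 b0 cc z0 zc.
  by apply: contraTneq => e; rewrite -/h -wh e ltxx.
pose f (w : R * R) := `|rot 5 w - 2 * (2 * pi)|.
have [|||w wA wmin] := @compact_EVT_min (R * R)%type R f A.
- by exists z.
- exact: compact_level.
- apply: continuous_in_subspaceT => w; rewrite inE => wA.
  apply: cvg_norm; apply: cvgB; last exact: cvg_cst.
  by apply: (cvg_rotation a0 b0 cc) => //; [exact: wA.1 | exact: Ac | exact: cvg_fst | exact: cvg_snd].
rewrite inE in wA; have [w0 wh] := wA.
exists (f w).
  rewrite normr_gt0 subr_eq0; apply: (rotation5_neq a0 b0 cc) => //; first exact: Ac.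
  by rewrite wh.
have iA j : A (iter j F z) by split; [exact: quadrant_iter|exact: lyness_inv_iter].
have hmin j : f w <= f (iter j F z) by apply: wmin; rewrite inE.
have sgn j : 0 < (rot 5 z - 2 * (2 * pi)) * (rot 5 (iter j F z) - 2 * (2 * pi)).
  by have [q e] := iA j; exact: rotation5_same_sign.
have [s0|s0] := ltP 0 (rot 5 z - 2 * (2 * pi)); [left|right] => j.
  have := sgn j; rewrite pmulr_rgt0 // => s1; have := hmin j.
  by rewrite {2}/f gtr0_norm //; lra.
have s1 : rot 5 (iter j F z) - 2 * (2 * pi) <= 0.
  rewrite leNgt; apply/negP => s1; have := sgn j; rewrite pmulr_lgt0 // => s2.
  by move: s0; rewrite leNgt s2.
by have := hmin j; rewrite {2}/f ler0_norm //; lra.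
Qed.

(** On the level given by [level_gap], one of five consecutive values of [rot n] differs from two
    fifths of [n] turns by at least [n * e / 5], on a fixed side; at [c] the limit is exactly two
    fifths. All values between are attained. *)
Lemma resonant_rotation : (a, b) <> (1, 1) -> 5 * critical_angle c = 2 * (2 * pi) ->
  exists2 d : R, 0 < d &
    (forall n q : nat, 2 * n%:R < 5 * q%:R :> R -> 5 * q%:R < (2 + d) * n%:R ->
       exists z, [/\ quadrant z, z != c & rot n z = q%:R * (2 * pi)]) \/
    (forall n q : nat, (2 - d) * n%:R < 5 * q%:R -> 5 * q%:R < 2 * n%:R :> R ->
       exists z, [/\ quadrant z, z != c & rot n z = q%:R * (2 * pi)]).
Proof using a0 b0 cc.
move=> ab phi.
have [z [z0 zc T0]] : exists z, [/\ quadrant z, z != c & torsion5 a b (lyness_inv a b z) != 0].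
  (* Two points of one ray have different levels, and by [torsion5_inj] at most one level is
     exceptional. *)
  pose z1 := exp_coord c (1, 0); pose z2 := exp_coord c (2, 0).
  have V12 : lyness_inv a b z1 < lyness_inv a b z2.
    have -> : z2 = exp_coord c (2 * ((1, 0) : R * R).1, 2 * ((1, 0) : R * R).2) by rewrite /z2 /= mulr1 mulr0.
    apply: lyness_inv_ray => //; last by rewrite ltr1n.
    by apply/eqP => -[] /eqP; rewrite oner_eq0.
  have ne (x : R) : x != 0 -> exp_coord c (x, 0) != c.
    move=> x0; rewrite -log_coord_eq0 ?quadrant_exp // exp_coordK //.
    by apply: contraNneq x0 => -[->].
  have [T1|T1] := eqVneq (torsion5 a b (lyness_inv a b z1)) 0; last first.
    by exists z1; rewrite ?quadrant_exp ?ne ?oner_neq0.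
  exists z2; rewrite ?quadrant_exp ?ne ?pnatr_eq0 //; split => //.
  apply/eqP => T2; have := torsion5_inj a0 b0 ab T1 T2.
  by move=> e; move: V12; rewrite e ltxx.
have [e e0 gap] := level_gap z0 zc T0.
have p2 : 0 < 2 * pi :> R by rewrite mulr_gt0.
have sumE n : \sum_(i < 5) rot n (iter i F z) = \sum_(j < n) rot 5 (iter j F z).
  exact: rotation_exchange.
have cst (n : nat) (x : R) : \sum_(i < n) x = n%:R * x by rewrite sumr_const card_ord mulr_natl.
have phiE (n : nat) : n%:R * critical_angle c = 2 / 5 * n%:R * (2 * pi).
  have e5 : critical_angle c = 2 / 5 * (2 * pi) by lra.
  by rewrite e5; ring.
exists (e / (2 * pi)); first by rewrite divr_gt0.
have dE (n : nat) : e * n%:R = e / (2 * pi) * n%:R * (2 * pi).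
  by rewrite [RHS]mulrAC divfK ?gt_eqF.
case: gap => gap; [left|right] => n q nq1 nq2.
- have [i hi] : exists i : 'I_5, q%:R * (2 * pi) < rot n (iter i F z).
    apply/existsP; rewrite -[X in is_true X]negbK negb_exists; apply/negP => /forallP hall.
    have : \sum_(i < 5) rot n (iter i F z) <= \sum_(i < 5) q%:R * (2 * pi).
      by apply: ler_sum => i _; rewrite leNgt.
    have : \sum_(j < n) (2 * (2 * pi) + e) <= \sum_(j < n) rot 5 (iter j F z).
      by apply: ler_sum => j _; exact: gap.
    rewrite sumE !cst mulrDr [n%:R * e]mulrC dE => h1 h2.
    have : (5 * q%:R) * (2 * pi) < ((2 + e / (2 * pi)) * n%:R) * (2 * pi) by rewrite ltr_pM2r.
    lra.
  have [|||w hw] := rotation_ivt a0 b0 cc (n := n) (l := q%:R * (2 * pi)) (z := iter i F z).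
  + exact: quadrant_iter.
  + exact: iter_neq_critical.
  + rewrite nmulr_rlt0 ?subr_gt0 // phiE -mulrBl nmulr_rlt0 //; lra.
  + by exists w.
- have [i hi] : exists i : 'I_5, rot n (iter i F z) < q%:R * (2 * pi).
    apply/existsP; rewrite -[X in is_true X]negbK negb_exists; apply/negP => /forallP hall.
    have : \sum_(i < 5) q%:R * (2 * pi) <= \sum_(i < 5) rot n (iter i F z).
      by apply: ler_sum => i _; rewrite leNgt.
    have : \sum_(j < n) rot 5 (iter j F z) <= \sum_(j < n) (2 * (2 * pi) - e).
      by apply: ler_sum => j _; exact: gap.
    rewrite sumE !cst mulrBr [n%:R * e]mulrC dE => h1 h2.
    have : ((2 - e / (2 * pi)) * n%:R) * (2 * pi) < (5 * q%:R) * (2 * pi) by rewrite ltr_pM2r.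
    lra.
  have [|||w hw] := rotation_ivt a0 b0 cc (n := n) (l := q%:R * (2 * pi)) (z := iter i F z).
  + exact: quadrant_iter.
  + exact: iter_neq_critical.
  + rewrite pmulr_rlt0 ?subr_lt0 // phiE -mulrBl pmulr_rgt0 //; lra.
  + by exists w.
Qed.

End Resonance.

(** * Rigidity of periodic level curves *)

Section PointwiseDerivatives.
Context {R : realType}.
Implicit Types (f g : R -> R) (t df dg : R).

Lemma is_derive_add f g t df dg : is_derive t 1 f df -> is_derive t 1 g dg ->
  is_derive t 1 (fun x => f x + g x) (df + dg).
Proof. by move=> *; exact: is_deriveD. Qed.

Lemma is_derive_sub f g t df dg : is_derive t 1 f df -> is_derive t 1 g dg ->
  is_derive t 1 (fun x => f x - g x) (df - dg).
Proof. by move=> *; exact: is_deriveB. Qed.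

Lemma is_derive_mul f g t df dg : is_derive t 1 f df -> is_derive t 1 g dg ->
  is_derive t 1 (fun x => f x * g x) (df * g t + f t * dg).
Proof.
move=> hf hg; apply: (is_derive_eq (is_deriveM hf hg)).
by rewrite addrC [df * _]mulrC.
Qed.

Lemma is_derive_inv f t df : f t != 0 -> is_derive t 1 f df ->
  is_derive t 1 (fun x => (f x)^-1) (- df / f t ^+ 2).
Proof.
move=> f0 hf; apply: (is_derive_eq (is_deriveV f0 hf)).
by rewrite -[LHS]/(- f t ^- 2 * df) mulNr mulrC mulNr.
Qed.

Lemma is_derive_sqrt f t df : 0 < f t -> is_derive t 1 f df ->
  is_derive t 1 (fun x => Num.sqrt (f x)) (df / (2 * Num.sqrt (f t))).
Proof.
move=> f0 hf; apply: (is_derive_eq (is_derive1_comp (is_derive1_sqrt f0) hf)).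
by rewrite mulrC.
Qed.

Lemma is_derive_continuous f t df : is_derive t 1 f df -> {for t, continuous f}.
Proof. by move=> hf; apply/differentiable_continuous/derivable1_diffP; case: hf. Qed.

Lemma derive_mvt f (f' : R -> R) (u v : R) : u < v ->
  (forall x, u <= x <= v -> is_derive x 1 f (f' x)) ->
  exists2 x, u < x < v & f v - f u = f' x * (v - u).
Proof.
move=> uv hf; have [||x xuv e] := @MVT R f f' u v uv.
- by move=> x; rewrite in_itv /= => /andP[ux xv]; apply: hf; rewrite !ltW.
- apply: continuous_in_subspaceT => x; rewrite inE /= in_itv /= => xuv.
  exact: is_derive_continuous (hf x xuv).
- by exists x => //; move: xuv; rewrite in_itv.
Qed.

Lemma antiderivative_exists f (u v : R) : u < v ->
  (forall x, u <= x <= v -> {for x, continuous f}) ->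
  exists W : R -> R, forall x, u < x < v -> is_derive x 1 W (f x).
Proof.
move=> uv fc.
have fi : lebesgue_measure.-integrable `[u, v] (EFin \o f).
  apply: continuous_compact_integrable; first exact: segment_compact.
  by apply: continuous_in_subspaceT => x; rewrite inE /= in_itv /=; exact: fc.
exists (fun x => \int[lebesgue_measure]_(t in `[u, x]) f t)%R => x /andP[ux xv].
have [|d e] := @continuous_FTC1_closed R f u x v xv fi ux; first by apply: fc; rewrite !ltW.
by apply: DeriveDef => //; rewrite -derive1E.
Qed.

(* Both w^-1 dt and its pullback by g have the antiderivative W.              *)
Lemma flow_rigidity (w g : R -> R) (t0 r r' : R) : 0 < r -> r' <= r ->
  (forall x, `|x - t0| <= r -> {for x, continuous w}) ->
  (forall x, `|x - t0| <= r -> w x != 0) -> g t0 = t0 ->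
  (forall t, `|t - t0| < r' -> `|g t - t0| < r /\ is_derive t 1 g (w (g t) / w t)) ->
  forall t, `|t - t0| < r' -> g t = t.
Proof.
move=> r0 rr wc w0 gt0 hg.
have lt_r' t : `|t - t0| < r' -> `|t - t0| < r by move=> tr; exact: lt_le_trans tr rr.
have nE x : (`|x - t0| < r) = (t0 - r < x < t0 + r) by rewrite ltr_distl.
have nE1 x : (`|x - t0| < r') = (t0 - r' < x < t0 + r') by rewrite ltr_distl.
have nE' x : (`|x - t0| <= r) = (t0 - r <= x <= t0 + r) by rewrite ler_distl.
have [||W hW] := @antiderivative_exists (fun x => (w x)^-1) (t0 - r) (t0 + r).
- lra.
- by move=> x; rewrite -nE' => xr; apply: cvgV; [exact: w0|exact: wc].
have hd t : `|t - t0| < r' -> is_derive t 1 (fun x => W (g x) - W x) 0.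
  move=> tr; have [gr dg] := hg t tr.
  have h1 : is_derive t 1 (fun x => W (g x)) ((w (g t))^-1 * (w (g t) / w t)).
    by apply: is_derive1_comp => //; apply: hW; rewrite -nE.
  have h2 : is_derive t 1 W (w t)^-1 by apply: hW; rewrite -nE lt_r'.
  apply: (is_derive_eq (is_derive_sub h1 h2)).
  by rewrite mulKf ?subrr // w0 // ltW // lt_r'.
have cst t : `|t - t0| < r' -> W (g t) = W t.
  move=> tr; apply/eqP; rewrite -subr_eq0.
  have [tt|tt|->] := ltgtP t t0; last by rewrite gt0 subrr.
    have [|x _] := @derive_mvt (fun x => W (g x) - W x) (fun=> 0) t t0 tt.
      move=> x /andP[x1 x2]; apply: hd; rewrite nE1.
      by move: tr; rewrite nE1 => /andP[? ?]; apply/andP; split; lra.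
    by rewrite gt0 subrr sub0r mul0r => /eqP; rewrite oppr_eq0.
  have [|x _] := @derive_mvt (fun x => W (g x) - W x) (fun=> 0) t0 t tt.
    move=> x /andP[x1 x2]; apply: hd; rewrite nE1.
    by move: tr; rewrite nE1 => /andP[? ?]; apply/andP; split; lra.
  by rewrite gt0 subrr subr0 mul0r => /eqP.
have inj x y : `|x - t0| < r -> `|y - t0| < r -> x < y -> W x != W y.
  rewrite !nE => /andP[x1 x2] /andP[y1 y2] xy.
  have [|z /andP[z1 z2]] := @derive_mvt W (fun x => (w x)^-1) x y xy.
    by move=> z /andP[z1 z2]; apply: hW; apply/andP; split; lra.
  move=> e; apply/eqP => Wxy; move/eqP: e; rewrite Wxy subrr eq_sym mulf_eq0 invr_eq0.
  rewrite (negPf (w0 _ _)) /=; first by rewrite subr_eq0 gt_eqF.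
  by rewrite nE'; apply/andP; split; lra.
move=> t tr; have [gr _] := hg t tr; have e := cst t tr.
have [h|h|//] := ltgtP (g t) t.
  by have := inj _ _ gr (lt_r' _ tr) h; rewrite e eqxx.
by have := inj _ _ (lt_r' _ tr) gr h; rewrite e eqxx.
Qed.

End PointwiseDerivatives.

Section Porism.
Context {R : realType}.
Implicit Types (a b x y t l : R).

(* First component of the Hamiltonian field of lyness_inv for the area form   *)
(* dx dy / (x y); by symmetry the second one is - level_flow b a y x.         *)
Definition level_flow a b x y : R := (b * x + a) * (y - (b + x) / y).

(** One step carries the field of [lyness_inv a b] to that of [lyness_inv b a], with the same speed
    factor [l]; two steps thus preserve the field. *)
Lemma level_flow_step a b (f g : R -> R) t l : 0 < f t -> 0 < g t -> 0 < a ->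
  is_derive t 1 f (l * level_flow a b (f t) (g t)) ->
  is_derive t 1 g (- l * level_flow b a (g t) (f t)) ->
  is_derive t 1 (fun s => (a + g s) / f s)
    (- l * level_flow a b ((a + g t) / f t) (g t)) /\
  is_derive t 1 g (l * level_flow b a (g t) ((a + g t) / f t)).
Proof.
move=> f0 g0 a0 df dg.
have ag : 0 < a + g t by rewrite addr_gt0.
split.
  apply: (is_derive_eq (is_derive_mul (is_derive_add (is_derive_cst a t 1) dg) (is_derive_inv _ df))).
    by rewrite gt_eqF.
  by rewrite /= /level_flow; field; rewrite !gt_eqF.
apply: (is_derive_eq dg); rewrite /= /level_flow; field.
by rewrite !gt_eqF.
Qed.

Lemma level_flow_iter a b (f g : R -> R) t l i : 0 < a -> 0 < b -> 0 < f t -> 0 < g t ->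
  is_derive t 1 f (l * level_flow a b (f t) (g t)) ->
  is_derive t 1 g (- l * level_flow b a (g t) (f t)) ->
  let w s := iter i (lyness_map a b) (f s, g s) in
  is_derive t 1 (fun s => (w s).1) (l * level_flow a b (w t).1 (w t).2) /\
  is_derive t 1 (fun s => (w s).2) (- l * level_flow b a (w t).2 (w t).1).
Proof.
move=> a0 b0 f0 g0 df dg; elim: i => //= i [h1 h2].
have /andP[w1 w2] : quadrant (iter i (lyness_map a b) (f t, g t)).
  by apply: quadrant_iter; rewrite /quadrant /= ?f0.
pose x s := (iter i (lyness_map a b) (f s, g s)).1.
pose y s := (iter i (lyness_map a b) (f s, g s)).2.
have [k1 k2] := @level_flow_step a b x y t l w1 w2 a0 h1 h2.
have x0 : 0 < (a + y t) / x t by rewrite divr_gt0 // addr_gt0.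
have [k3 k4] := @level_flow_step b a y (fun s => (a + y s) / x s) t l w2 x0 b0 k2 k1.
by split.
Qed.

Section Branch.
Context (a b h e : R).
Hypotheses (a0 : 0 < a) (b0 : 0 < b) (e2 : e * e = 1).

(** Over [x], the level [h] has the two ordinates [y] and [(b + x) / y], with sum [S x], product
    [b + x] and discriminant [D x]. The sign [e] selects the branch [Y], and [w] is the first
    component of the field on it. *)
Let S x : R := (h * x - a * (x * x) - (b + a * a)) / (b * x + a).
Let D x : R := S x * S x - 4 * (b + x).
Let Y x : R := (S x + e * Num.sqrt (D x)) / 2.
Let w x : R := (b * x + a) * (e * Num.sqrt (D x)).

Lemma level_trace x y : 0 < x -> 0 < y ->
  (lyness_inv a b (x, y) = h) <-> (y + (b + x) / y = S x).
Proof using a0 b0.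
move=> x0 y0; have bx : 0 < b * x + a by rewrite addr_gt0 ?mulr_gt0.
have E : lyness_inv a b (x, y) - h = (y + (b + x) / y - S x) * (b * x + a) / x.
  by rewrite /lyness_inv /S /=; field; rewrite !gt_eqF.
split => H.
  apply/eqP; rewrite -subr_eq0; move/eqP: E; rewrite H subrr eq_sym.
  by rewrite !mulf_eq0 invr_eq0 (gt_eqF bx) (gt_eqF x0) !orbF.
by apply/eqP; rewrite -subr_eq0 E H subrr !mul0r.
Qed.

Lemma branch_level x : 0 < x -> 0 < Y x -> 0 < D x ->
  lyness_inv a b (x, Y x) = h /\ Y x - (b + x) / Y x = e * Num.sqrt (D x).
Proof using a0 b0 e2.
move=> x0 Y0 D0; have sD : Num.sqrt (D x) * Num.sqrt (D x) = D x.
  by rewrite -expr2 sqr_sqrtr // ltW.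
have q : Y x * (S x - Y x) = b + x.
  transitivity ((S x * S x - (e * e) * (Num.sqrt (D x) * Num.sqrt (D x))) / 4).
    by rewrite /Y; field.
  by rewrite e2 sD /D; field.
have dv : (b + x) / Y x = S x - Y x by rewrite -q mulrC mulKf // gt_eqF.
split; last by rewrite dv /Y; field.
by apply/(level_trace x0 Y0); rewrite dv; ring.
Qed.

Lemma branch_uniq x y : 0 < x -> 0 < y -> lyness_inv a b (x, y) = h ->
  0 < e * (y - (b + x) / y) -> [/\ 0 < D x, y = Y x & level_flow a b x y = w x].
Proof using a0 b0 e2.
move=> x0 y0 /(level_trace x0 y0) HS e0.
have DE : D x = (e * (y - (b + x) / y)) ^+ 2.
  transitivity ((e * e) * (y - (b + x) / y) ^+ 2); last by ring.
  by rewrite e2 /D -HS; field; rewrite gt_eqF.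
have sD : Num.sqrt (D x) = e * (y - (b + x) / y) by rewrite DE sqrtr_sqr gtr0_norm.
have esD : e * Num.sqrt (D x) = y - (b + x) / y by rewrite sD mulrA e2 mul1r.
split; first by rewrite DE exprn_gt0.
  by rewrite /Y esD -HS; field; rewrite gt_eqF.
by rewrite /w esD.
Qed.

Lemma is_derive_trace x : 0 < x ->
  is_derive x 1 S ((h - 2 * a * x - b * S x) / (b * x + a)).
Proof using a0 b0.
move=> x0; have bx : 0 < b * x + a by rewrite addr_gt0 ?mulr_gt0.
have idx := is_derive_id x (1 : R).
have cst (k : R) : is_derive x 1 (fun=> k) 0 := is_derive_cst k x 1.
apply: (is_derive_eq (is_derive_mul
  (is_derive_sub (is_derive_sub (is_derive_mul (cst h) idx)
     (is_derive_mul (cst a) (is_derive_mul idx idx))) (cst (b + a * a)))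
  (is_derive_inv _ (is_derive_add (is_derive_mul (cst b) idx) (cst a))))).
  by rewrite gt_eqF.
by rewrite /S; field; rewrite gt_eqF.
Qed.

(** The branch is a trajectory of the field: its slope is the quotient of the two components. *)
Lemma is_derive_branch x : 0 < x -> 0 < Y x -> 0 < D x ->
  is_derive x 1 Y (- (w x)^-1 * level_flow b a (Y x) x).
Proof using a0 b0 e2.
move=> x0 Y0 D0; have [L dY] := branch_level x0 Y0 D0.
have bx : 0 < b * x + a by rewrite addr_gt0 ?mulr_gt0.
have idx := is_derive_id x (1 : R).
have cst (k : R) : is_derive x 1 (fun=> k) 0 := is_derive_cst k x 1.
have dS := is_derive_trace x0.
have dD := is_derive_sub (is_derive_mul dS dS) (is_derive_mul (cst 4) (is_derive_add (cst b) idx)).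
apply: (is_derive_eq (is_derive_mul (is_derive_add dS (is_derive_mul (cst e)
   (is_derive_sqrt (f := D) D0 dD))) (cst 2^-1))).
have SE : S x = Y x + (b + x) / Y x by rewrite -(iffLR (level_trace x0 Y0) L).
have q0 : Num.sqrt (D x) != 0 by rewrite gt_eqF // sqrtr_gt0.
have e_neq0 : e != 0 by apply: contra_eq_neq e2 => ->; rewrite mulr0 eq_sym oner_neq0.
have dY0 : Y x - (b + x) / Y x != 0 by rewrite dY mulf_neq0.
have YY : Y x * Y x - (b + x) != 0.
  have -> : Y x * Y x - (b + x) = Y x * (Y x - (b + x) / Y x) by field; rewrite gt_eqF.
  by rewrite mulf_neq0 // gt_eqF.
have sV : e / Num.sqrt (D x) = (Y x - (b + x) / Y x)^-1.
  rewrite dY invfM; congr (_ * _).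
  by apply: (mulfI e_neq0); rewrite e2 divff.
have hE : h = (S x * (b * x + a) + a * (x * x) + (b + a * a)) / x.
  by rewrite /S; field; rewrite !gt_eqF.
set X := Num.sqrt (D x) in q0 sV *.
transitivity (((h - 2 * a * x - b * S x) / (b * x + a)
   + (e / X) * (S x * ((h - 2 * a * x - b * S x) / (b * x + a)) - 2)) / 2).
  by field; rewrite q0 gt_eqF.
rewrite sV /w -/X /level_flow -[X in _ = - (_ * X)^-1 * _]dY.
set s := S x in SE hE *; set y := Y x in SE Y0 YY *; rewrite hE SE.
by field; rewrite YY !gt_eqF.
Qed.

End Branch.

(** Parametrized by abscissa, the arc follows the field with factor [(w t)^-1], and its image under
    [iter p] does so with the same factor. [flow_rigidity] then makes the first coordinate of the
    image the identity. The condition on [z] excludes vertical tangents, where the two branches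
    meet. *)
Lemma porism_arc a b z p : 0 < a -> 0 < b -> quadrant z -> z.2 ^+ 2 != b + z.1 ->
  iter p (lyness_map a b) z = z ->
  exists Y : R -> R, Y z.1 = z.2 /\
    exists2 r, 0 < r & forall t, `|t - z.1| < r ->
      [/\ {for t, continuous Y}, quadrant (t, Y t) &
          iter p (lyness_map a b) (t, Y t) = (t, Y t)].
Proof.
case: z => x0 y0 a0 b0 /= z0; have /andP[/= x00 y00] := z0 => zne zE.
pose h := lyness_inv a b (x0, y0).
pose d0 := y0 - (b + x0) / y0.
have d00 : d0 != 0.
  apply: contra zne => /eqP d0E; apply/eqP.
  have -> : y0 ^+ 2 = y0 * d0 + (b + x0) by rewrite /d0; field; rewrite gt_eqF.
  by rewrite d0E mulr0 add0r.
pose e := Num.sg d0.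
have e2 : e * e = 1 by rewrite -expr2 sqr_sg d00.
have e0 : 0 < e * d0 by rewrite /e -normrEsg normr_gt0.
pose S x : R := (h * x - a * (x * x) - (b + a * a)) / (b * x + a).
pose D x : R := S x * S x - 4 * (b + x).
pose Y x : R := (S x + e * Num.sqrt (D x)) / 2.
pose w x : R := (b * x + a) * (e * Num.sqrt (D x)).
have [D0 YE wE] : [/\ 0 < D x0, y0 = Y x0 & level_flow a b x0 y0 = w x0].
  exact (branch_uniq a0 b0 e2 x00 y00 (erefl h) e0).
exists Y; split; first by rewrite -YE.
have wne x : 0 < x -> 0 < D x -> w x != 0.
  move=> xp Dx; have bx : b * x + a != 0 by rewrite gt_eqF // addr_gt0 // mulr_gt0.
  have e_neq0 : e != 0 by rewrite sgr_eq0.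
  have sD : Num.sqrt (D x) != 0 by rewrite gt_eqF // sqrtr_gt0.
  exact: mulf_neq0 bx (mulf_neq0 e_neq0 sD).
have dY x : 0 < x -> 0 < Y x -> 0 < D x ->
    is_derive x 1 Y (- (w x)^-1 * level_flow b a (Y x) x).
  exact: is_derive_branch.
have Ypos : 0 < Y x0 by rewrite -YE.
have cD x : 0 < x -> {for x, continuous D}.
  move=> xp; have cS := is_derive_continuous (is_derive_trace h a0 b0 xp).
  apply: cvgB; first by apply: cvgM; exact: cS.
  apply: cvgM; first exact: cvg_cst.
  by apply: cvgD; [exact: cvg_cst|exact: cvg_id].
have cY := is_derive_continuous (dY _ x00 Ypos D0).
pose f1 t := (iter p (lyness_map a b) (t, Y t)).1.
pose f2 t := (iter p (lyness_map a b) (t, Y t)).2.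
have fq t : 0 < t -> 0 < Y t -> quadrant (f1 t, f2 t).
  move=> t0 Yt; rewrite /f1 /f2 -surjective_pairing; apply: quadrant_iter => //.
  by rewrite /quadrant /= t0.
have fd t : 0 < t -> 0 < Y t -> 0 < D t ->
  is_derive t 1 f1 ((w t)^-1 * level_flow a b (f1 t) (f2 t)) /\
  is_derive t 1 f2 (- (w t)^-1 * level_flow b a (f2 t) (f1 t)).
  move=> t0 Yt Dt.
  have BY : Y t - (b + t) / Y t = e * Num.sqrt (D t).
    by have [] := branch_level a0 b0 e2 t0 Yt Dt.
  have wt : w t = level_flow a b t (Y t) by rewrite /w /level_flow BY.
  have wt0 := wne _ t0 Dt.
  have did : is_derive t 1 (id : R -> R) ((w t)^-1 * level_flow a b t (Y t)).
    by apply: (is_derive_eq (is_derive_id t (1 : R))); rewrite -wt mulVf.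
  exact: (@level_flow_iter a b id Y t (w t)^-1 p a0 b0 t0 Yt did (dY t t0 Yt Dt)).
have f1x : f1 x0 = x0 by rewrite /f1 -YE zE.
have f2x : f2 x0 = y0 by rewrite /f2 -YE zE.
have [df1 df2] := fd _ x00 Ypos D0.
have cf1 := is_derive_continuous df1; have cf2 := is_derive_continuous df2.
have near_x0 : \forall t \near x0, [/\ 0 < t, 0 < Y t & 0 < D t].
  near=> t; split.
  - by near: t; exact: (cvgr_gt x0 cvg_id).
  - by near: t; exact: (cvgr_gt _ cY).
  - by near: t; exact: (cvgr_gt _ (cD _ x00)).
have [r r0 hr] : exists2 r, 0 < r & forall t, `|t - x0| <= r -> [/\ 0 < t, 0 < Y t & 0 < D t].
  have /nbhs_ballP[r /= r0 hr] := near_x0; exists (r / 2); first by rewrite divr_gt0.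
  by move=> t tr; apply: hr; rewrite /ball /= distrC; apply: le_lt_trans tr _; lra.
have near2 : \forall t \near x0, `|f1 t - x0| < r /\ 0 < e * (f2 t - (b + f1 t) / f2 t).
  have l1 : (fun t => f1 t - x0) @ x0 --> f1 x0 - x0 by apply: cvgB; [exact: cf1|exact: cvg_cst].
  have l2 : (fun t => e * (f2 t - (b + f1 t) / f2 t)) @ x0 -->
      e * (f2 x0 - (b + f1 x0) / f2 x0).
    apply: cvgM; first exact: cvg_cst.
    apply: cvgB; first exact: cf2.
    apply: cvgM; first by apply: cvgD; [exact: cvg_cst|exact: cf1].
    by apply: cvgV; [rewrite f2x gt_eqF|exact: cf2].
  rewrite f1x f2x in l2.
  have l1' : (fun t => `|f1 t - x0|) @ x0 --> `|f1 x0 - x0| by exact: cvg_norm.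
  rewrite f1x subrr normr0 in l1'.
  have n1 : \forall t \near x0, `|f1 t - x0| < r by move/cvgr_lt: l1'; apply.
  have n2 : \forall t \near x0, 0 < e * (f2 t - (b + f1 t) / f2 t) by move/cvgr_gt: l2; apply.
  by near=> t; split; near: t.
have [r' r'0 hr'] : exists2 r', 0 < r' & r' <= r /\ forall t, `|t - x0| < r' ->
    `|f1 t - x0| < r /\ 0 < e * (f2 t - (b + f1 t) / f2 t).
  have /nbhs_ballP[s /= s0 hs] := near2; exists (Num.min s r); first by rewrite lt_min s0.
  split=> [|t]; first by rewrite ge_min lexx orbT.
  by rewrite lt_min => /andP[ts _]; apply: hs; rewrite /ball /= distrC.
have [rr hr2] := hr'.
(* The sign condition in [r'] keeps the image on the same branch as [z]. *)
have onbranch t : `|t - x0| < r' -> f2 t = Y (f1 t) /\ level_flow a b (f1 t) (f2 t) = w (f1 t).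
  move=> tr; have [t0 Yt Dt] := hr t (ltW (lt_le_trans tr rr)).
  have [h1 h2] := hr2 t tr; have /andP[/= p1 p2] := fq t t0 Yt.
  have Vt : lyness_inv a b (f1 t, f2 t) = h.
    rewrite /f1 /f2 -surjective_pairing lyness_inv_iter // /quadrant /= ?t0 //.
    by have [] := branch_level a0 b0 e2 t0 Yt Dt.
  by have [] := branch_uniq a0 b0 e2 p1 p2 Vt h2.
have fix1 t : `|t - x0| < r' -> f1 t = t.
  apply: (@flow_rigidity R w f1 x0 r r') => // {}t tr.
  - have [t0 Yt Dt] := hr t tr; apply: cvgM.
      by apply: cvgD; [apply: cvgM; [exact: cvg_cst|exact: cvg_id]|exact: cvg_cst].
    apply: cvgM; first exact: cvg_cst.
    by apply: (@continuous_cvg _ R R _ _ _ (@Num.sqrt R)); [exact: sqrt_continuous|exact: cD].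
  - have [t0 Yt Dt] := hr t tr.
    exact: wne.
  - have [t0 Yt Dt] := hr t (ltW (lt_le_trans tr rr)); have [h1 _] := hr2 t tr.
    split => //; have [d1 _] := fd t t0 Yt Dt; apply: (is_derive_eq d1).
    by have [_ ->] := onbranch t tr; rewrite mulrC.
exists r' => // t tr; have [t0 Yt Dt] := hr t (ltW (lt_le_trans tr rr)).
split.
- exact: is_derive_continuous (dY _ t0 Yt Dt).
- by rewrite /quadrant /= t0.
- rewrite [LHS]surjective_pairing -/(f1 t) -/(f2 t) fix1 //.
  by have [-> _] := onbranch t tr; rewrite fix1.
Unshelve. all: by end_near. Qed.

End Porism.

(** * Reduced fractions in short intervals *)

Section Sieve.
Local Open Scope nat_scope.

(** Counts the integers from 1 to [m] that no element of [l] divides; ordinals start at 0, hence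
    [q.+1]. *)
Definition sifted (l : seq nat) (m : nat) : nat :=
  \sum_(q < m) all (fun p => ~~ (p %| q.+1)) l.

(** Legendre's recursion: the survivors of [l] that [p] removes are [p] times the survivors of [l]
    up to [m %/ p]. *)
Lemma sifted_cons p l m : prime p -> all prime l -> p \notin l ->
  sifted (p :: l) m + sifted l (m %/ p) = sifted l m.
Proof.
move=> pp lp pl; have p0 := prime_gt0 pp.
elim: m => [|m IH]; first by rewrite div0n /sifted !big_ord0.
have S1 l' k : sifted l' k.+1 = sifted l' k + all (fun p => ~~ (p %| k.+1)) l'.
  by rewrite /sifted big_ord_recr.
rewrite divnS // !S1 /=; have [pm|pm] /= := boolP (p %| m.+1); last first.
  by rewrite add0n -IH addnAC.
rewrite add1n S1 -IH addn0 addnA.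
suff -> : all (fun p0 => ~~ (p0 %| (m %/ p).+1)) l = all (fun p0 => ~~ (p0 %| m.+1)) l by [].
apply: eq_in_all => r rl; congr (~~ _).
have rp : prime r by exact: (allP lp).
have -> : m.+1 = (m %/ p).+1 * p.
  by rewrite -[LHS](divnK pm) divnS // pm add1n.
rewrite Euclid_dvdM // [r %| p]dvdn_prime2 //.
by case: eqVneq rl pl => [->->//|]; rewrite orbF.
Qed.

End Sieve.

Section CoprimeInterval.
Context {R : realType}.

Definition prime_density (l : seq nat) : R := \prod_(p <- l) (1 - p%:R^-1).

Lemma prime_density_itv l : all prime l -> 0 <= prime_density l <= 1.
Proof.
elim: l => [_|p l IH /=/andP[pp /IH/andP[d0 d1]]].
  by rewrite /prime_density big_nil ler01 lexx.
rewrite /prime_density big_cons -/(prime_density l).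
have p1 : 1 <= p%:R :> R by rewrite ler1n prime_gt0.
have ip : p%:R^-1 <= 1 :> R by rewrite invf_le1 // (lt_le_trans _ p1).
have ip0 : 0 <= p%:R^-1 :> R by rewrite invr_ge0 ler0n.
by rewrite mulr_ge0 ?subr_ge0 //= mulr_ile1 ?subr_ge0 // gerBl.
Qed.

(** Each new prime doubles the error and adds at most 1 for the rounding in [m %/ p]. *)
Lemma sifted_density l m : uniq l -> all prime l ->
  `|(sifted l m)%:R - m%:R * prime_density l| <= 2 ^+ size l - 1.
Proof.
elim: l m => [|p l IH] m.
  move=> _ _; rewrite /sifted /prime_density big_nil mulr1 sum_nat_const card_ord muln1.
  by rewrite subrr normr0 expr0 subrr.
move=> /= /andP[pl ul] /andP[pp lp].
have := sifted_cons m pp lp pl => /(congr1 (fun k => k%:R : R)); rewrite natrD => e.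
have p0 : 0 < p%:R :> R by rewrite ltr0n prime_gt0.
rewrite /prime_density big_cons -/(prime_density l).
have h1 := IH m ul lp; have h2 := IH (m %/ p)%N ul lp.
have /andP[d0 d1] := prime_density_itv lp.
set d := prime_density l in h1 h2 d0 d1 *; set k := (m %/ p)%N in e h2 *.
have km : k%:R <= m%:R / p%:R :> R.
  by rewrite ler_pdivlMr // -natrM ler_nat leq_trunc_div.
have mk : m%:R / p%:R < k%:R + 1 :> R.
  by rewrite ltr_pdivrMr // natr1 -natrM ltr_nat ltn_ceil // prime_gt0.
move: h1 h2; rewrite exprS !ler_norml => /andP[a1 a2] /andP[b1 b2].
have -> : (sifted (p :: l) m)%:R = (sifted l m)%:R - (sifted l k)%:R :> R by rewrite -e; ring.
have -> : m%:R * ((1 - p%:R^-1) * d) = m%:R * d - m%:R / p%:R * d :> R by ring.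
have : (m%:R / p%:R - k%:R) * d <= 1 by rewrite mulr_ile1 ?subr_ge0 //; lra.
have : 0 <= (m%:R / p%:R - k%:R) * d by rewrite mulr_ge0 ?subr_ge0.
rewrite mulrBl => u1 u2; apply/andP; split; lra.
Qed.

(** Lower bounds for [(p - 1) ^ 3 / (8 * p)]: its exact values at 2 and 3, and 1 from 5 on. Only 2
    and 3 contribute, whence the constant 48. *)
Let weight (p : nat) : R := if p == 2 then 16^-1 else if p == 3 then 3^-1 else 1.

Lemma weight_le (p : nat) (P : R) : prime p -> p%:R <= P ->
  weight p * P <= ((1 - p%:R^-1) * P / 2) ^+ 3.
Proof.
move=> pp pP; have p1 : 1 < p%:R :> R by rewrite ltr1n prime_gt1.
have p0 : 0 < p%:R :> R by lra.
have -> : ((1 - p%:R^-1) * P / 2) ^+ 3 = (p%:R - 1) ^+ 3 / (8 * p%:R) * (P / p%:R) ^+ 2 * P.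
  by field; rewrite gt_eqF.
apply: ler_wpM2r; first lra.
have P1 : 1 <= (P / p%:R) ^+ 2.
  by rewrite -[1](expr1n R 2) lerXn2r ?nnegrE ?divr_ge0 ?ler_pdivlMr ?mul1r //; lra.
suff h : weight p <= (p%:R - 1) ^+ 3 / (8 * p%:R).
  apply: le_trans h _; rewrite -[leLHS]mulr1; apply: ler_wpM2l => //.
  by rewrite divr_ge0 ?mulr_ge0 ?exprn_ge0 //; lra.
rewrite /weight; case: (eqVneq p 2%N) => [->|p2]; first lra.
case: (eqVneq p 3%N) => [->|p3]; first lra.
have p5 : 5 <= p%:R :> R.
  rewrite (ler_nat R 5); move: pp p2 p3; clear.
  by case: p => [|[|[|[|[|p]]]]].
rewrite ler_pdivlMr ?mul1r; first nra.
by lra.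
Qed.

Lemma weight_prod l : uniq l -> 48^-1 <= \prod_(p <- l) weight p.
Proof.
move=> ul; have -> : \prod_(p <- l) weight p =
    16^-1 ^+ count_mem 2 l * 3^-1 ^+ count_mem 3 l.
  elim: l {ul} => [|p l IH]; first by rewrite big_nil mulr1.
  rewrite big_cons IH /weight /=.
  case: (eqVneq p 2%N) => [->|p2] /=; first by rewrite exprS; ring.
  case: (eqVneq p 3%N) => [_|p3] /=; first by rewrite !add0n exprS; ring.
  by rewrite mul1r.
rewrite !count_uniq_mem //.
by case: (_ \in _); case: (_ \in _); rewrite ?expr0 ?expr1; lra.
Qed.

(** Multiplicative over the prime powers of [n] ([weight_le]): the totient divided by
    [2 ^ size (primes n)] is at least the cube root of [n / 48], so it outgrows the sieve error. *)
Lemma density_lower n : (0 < n)%N ->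
  n%:R / 48 <= (n%:R * prime_density (primes n) / 2 ^+ size (primes n)) ^+ 3.
Proof.
move=> n0; have nE : n%:R = \prod_(p <- primes n) (p ^ logn p n)%:R :> R.
  by rewrite -natr_prod {1}[n]prod_prime_decomp // prime_decompE big_map.
have pl p : p \in primes n -> prime p by rewrite mem_primes => /and3P[].
have -> : n%:R * prime_density (primes n) / 2 ^+ size (primes n) =
    \prod_(p <- primes n) ((1 - p%:R^-1) * (p ^ logn p n)%:R / 2).
  rewrite nE /prime_density; elim: (primes n) => [|p l IH] /=.
    by rewrite !big_nil expr0 invr1 !mulr1.
  by rewrite !big_cons -IH exprS invfM; ring.
rewrite {1}nE -prodrXl.
apply: le_trans (_ : \prod_(p <- primes n) (weight p * (p ^ logn p n)%:R) <= _).
  rewrite big_split /= mulrC ler_wpM2r ?weight_prod ?primes_uniq //.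
  by apply: prodr_ge0 => p _; rewrite ler0n.
rewrite big_seq_cond [leRHS]big_seq_cond; apply: ler_prod => p /andP[pn _].
have pp := pl p pn; apply/andP; split.
  by rewrite mulr_ge0 ?ler0n // /weight; case: ifP => _; [|case: ifP => _]; rewrite ?ler01 ?invr_ge0 ?ler0n.
apply: weight_le => //; rewrite ler_nat; move: pn; rewrite -logn_gt0.
by case: (logn p n) => // e _; rewrite expnS leq_pmulr // expn_gt0 prime_gt0.
Qed.

(** Were there no such [q], the sieve count would be constant on a long interval, against
    [sifted_density] and [density_lower]. Coprimality to [2 * n] makes [q] odd, as the case [a = b]
    requires. *)
Lemma coprime_in_interval (n : nat) (lo hi : R) : 0 <= lo -> lo < hi ->
  2 ^+ 17 <= n%:R * (hi - lo) ^+ 3 ->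
  exists q : nat, [/\ coprime (2 * n) q, n%:R * lo < q%:R & q%:R < n%:R * hi].
Proof.
move=> lo0 lohi hn.
have L0 : 0 < hi - lo by lra.
have n0 : (0 < n)%N by case: n hn => //; rewrite mul0r; have := exprn_gt0 17 (ltr0Sn R 1); lra.
have n0' : 0 < n%:R :> R by rewrite ltr0n.
set N := (2 * n)%N; set l := primes N.
have lp : all prime l by apply/allP => p; rewrite mem_primes => /and3P[].
have ul : uniq l by exact: primes_uniq.
have N0 : (0 < N)%N by rewrite muln_gt0.
(* Stopping at the midpoint makes the upper bound on [q] strict. *)
pose x := n%:R * lo; pose y := n%:R * ((lo + hi) / 2).
have x0 : 0 <= x by rewrite mulr_ge0 // ltW.
have y0 : 0 <= y by rewrite mulr_ge0 ?(ltW n0') //; lra.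
have /andP[x1 x2] := truncn_itv x0; have /andP[y1 y2] := truncn_itv y0.
set m1 := Num.truncn x in x1 x2; set m2 := Num.truncn y in y1 y2.
have [q [q1 q2 q3]] : exists q : nat, [/\ (m1 < q)%N, (q <= m2)%N & all (fun p => ~~ (p %| q)%N) l].
  apply: contrapT => nq.
  have xy : x <= y by rewrite /x /y ler_pM2l //; lra.
  have m12 : (m1 <= m2)%N by exact: le_truncn.
  have cst k : (k <= m2 - m1)%N -> sifted l (m1 + k) = sifted l m1.
    elim: k => [|k IH] km; first by rewrite addn0.
    rewrite addnS {1}/sifted big_ord_recr -/(sifted l (m1 + k)) IH ?(ltnW km) //=.
    case: (boolP (all _ _)) => [h|_]; last by rewrite addn0.
    exfalso; apply: nq; exists (m1 + k).+1; rewrite ltnS leq_addr; split => //.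
    by rewrite -addnS -leq_subRL.
  have := cst _ (leqnn _); rewrite subnKC // => e.
  have := sifted_density m1 ul lp; have := sifted_density m2 ul lp; rewrite e.
  have d := density_lower N0; rewrite -/l in d.
  have /andP[d0 d1] := prime_density_itv lp.
  set T := 2 ^+ size l in d *; set D := prime_density l in d d0 d1 *.
  have T1 : 1 <= T by rewrite exprn_ege1 // ler1n.
  rewrite !ler_norml => /andP[a1 a2] /andP[b1 b2].
  have : (m2%:R - m1%:R) * D <= 2 * T - 2 by lra.
  have m21 : y - x - 1 <= m2%:R - m1%:R by rewrite -natr1 in y2; lra.
  have yx : y - x = n%:R * (hi - lo) / 2 by rewrite /x /y; field.
  have : (y - x - 1) * D <= (m2%:R - m1%:R) * D by rewrite ler_wpM2r.
  rewrite yx mulrBl mul1r => h1 h2.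
  have {h1 h2} : n%:R * D * (hi - lo) < 4 * T by lra.
  apply/negP; rewrite -leNgt.
  pose X := N%:R * D / T.
  have XE : n%:R * D = X / 2 * T by rewrite /X /N natrM; field; rewrite gt_eqF //; lra.
  rewrite XE mulrAC ler_wpM2r //; first lra.
  suff : 8 <= X * (hi - lo) by lra.
  rewrite -(ler_pXn2r (n := 3)) ?nnegrE //; last first.
    by rewrite mulr_ge0 ?divr_ge0 ?mulr_ge0 ?ler0n //; lra.
  rewrite exprMn; apply: le_trans (_ : N%:R / 48 * (hi - lo) ^+ 3 <= _); last first.
    by rewrite ler_wpM2r // exprn_ge0 // ltW.
  (* The bound [2 ^+ 17] covers [24 * 8 ^+ 3]; a power of two is easily built from the constant
     1. *)
  have -> : N%:R / 48 * (hi - lo) ^+ 3 = (n%:R * (hi - lo) ^+ 3) / 24.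
    by rewrite /N natrM; field.
  by apply: le_trans (_ : 2 ^+ 17 / 24 <= _); [lra | rewrite ler_wpM2r ?invr_ge0 ?ler0n].
have q0 : (0 < q)%N by exact: leq_ltn_trans q1.
exists q; split.
- rewrite coprime_sym coprime_has_primes //; apply/hasPn => p; rewrite -/l => pl.
  by move/allP/(_ p pl): q3; rewrite mem_primes negb_and negb_and => ->; rewrite !orbT.
- by apply: lt_le_trans x2 _; rewrite ler_nat.
- apply: le_lt_trans (_ : y < _); last by rewrite /y ltr_pM2l //; lra.
  by apply: le_trans y1; rewrite ler_nat.
Qed.

End CoprimeInterval.

(** * The program *)

Section ThresholdProgram.
Context {R : realType}.

Fixpoint rexpr_pow2 (n : nat) : rexpr :=
  if n is m.+1 then RAdd (rexpr_pow2 m) (rexpr_pow2 m) else ROne.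

Lemma reval_pow2 (s : nat -> R) n : reval s (rexpr_pow2 n) = 2 ^+ n.
Proof. by elim: n => //= n ->; rewrite exprS; ring. Qed.

Definition cube_times : rexpr := RMul (RReg 0) (RMul (RReg 2) (RMul (RReg 2) (RReg 2))).

Definition threshold_loop : rprog :=
  PWhileLt cube_times (rexpr_pow2 17) (PAssign 0 (RAdd (RReg 0) ROne)).

(** Register 2 receives the distance of the inputs; register 0 is then reset to 0, written [1 - 1],
    and counts up to the threshold. *)
Definition threshold_program : rprog :=
  PSeq (PIfLt (RReg 0) (RReg 1) (PAssign 2 (RSub (RReg 1) (RReg 0)))
                                (PAssign 2 (RSub (RReg 0) (RReg 1))))
       (PSeq (PAssign 0 (RSub ROne ROne)) threshold_loop).

(** The implication makes the predicate satisfiable for every [L], so that [threshold] is total. *)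
Lemma threshold_exists (L : R) : exists N : nat, (0 < L) ==> (2 ^+ 17 <= N%:R * L ^+ 3).
Proof.
exists (Num.truncn (2 ^+ 17 / L ^+ 3)).+1; apply/implyP => L0.
rewrite -ler_pdivrMr ?exprn_gt0 //.
have h : 0 <= 2 ^+ 17 / L ^+ 3 by rewrite divr_ge0 ?exprn_ge0 ?ltW.
by have /andP[_ /ltW] := truncn_itv h.
Qed.

Definition threshold (L : R) : nat := ex_minn (threshold_exists L).

Lemma threshold_spec (L : R) n : 0 < L -> (threshold L <= n)%N -> 2 ^+ 17 <= n%:R * L ^+ 3.
Proof.
move=> L0; rewrite /threshold; case: ex_minnP => N; rewrite L0 /= => h _ Nn.
by apply: le_trans h _; rewrite ler_wpM2r ?exprn_ge0 ?(ltW L0) // ler_nat.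
Qed.

Lemma threshold_loop_exec (L : R) k (s : nat -> R) : 0 < L -> (k <= threshold L)%N ->
  s 0%N = k%:R -> s 2 = L ->
  exists s', exec threshold_loop s s' /\ s' 0%N = (threshold L)%:R.
Proof.
move=> L0; move e: (threshold L - k)%N => d; elim: d k s e => [|d IH] k s e kN s0 s2.
  have kE : k = threshold L by apply/eqP; rewrite eqn_leq kN -subn_eq0 e.
  exists s; split; last by rewrite s0 kE.
  apply: exec_while_false; rewrite reval_pow2 /= s0 s2 -leNgt.
  have -> : k%:R * (L * (L * L)) = k%:R * L ^+ 3 by ring.
  by apply: threshold_spec; rewrite // kE.
have kN' : (k < threshold L)%N by rewrite -subn_gt0 e.
have [||||s' [ex s'0]] := IH k.+1 (reg_update s 0 (reval s (RAdd (RReg 0) ROne))).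
- by rewrite subnS e.
- by [].
- by rewrite /reg_update /= s0 natr1.
- by rewrite /reg_update.
exists s'; split => //; apply: exec_while_true ex; last exact: exec_assign.
rewrite reval_pow2 /= s0 s2 ltNge; apply/negP => h; move: kN'.
rewrite /threshold; case: ex_minnP => N _ Nmin; rewrite ltnNge => /negP; apply.
apply: Nmin; rewrite L0 /=; apply: le_trans h _.
by have -> : k%:R * (L * (L * L)) = k%:R * L ^+ 3 by ring.
Qed.

Lemma threshold_programP (x y : R) : x <> y ->
  computes threshold_program [:: x; y] (threshold `|x - y|).
Proof.
move=> /eqP xy; have L0 : 0 < `|x - y| by rewrite normr_gt0 subr_eq0.
pose s0 : nat -> R := fun i => [:: x; y]`_i.
pose s1 := reg_update s0 2 `|x - y|.
pose s2 := reg_update s1 0 (reval s1 (RSub ROne ROne)).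
have [||s3 [ex e]] := @threshold_loop_exec `|x - y| 0 s2 L0 (leq0n _).
- by rewrite /s2 /reg_update /= subrr.
- by rewrite /s2 /s1 /reg_update.
exists s3; split => //; apply: (exec_seq (s' := s1)); last first.
  by apply: exec_seq ex; exact: exec_assign.
have [h|h] := ltP x y.
  apply: exec_if_true => //.
  have -> : s1 = reg_update s0 2 (reval s0 (RSub (RReg 1) (RReg 0))).
    by rewrite /s1 /= ltr0_norm ?subr_lt0 // opprB.
  exact: exec_assign.
apply: exec_if_false; first by rewrite /= -leNgt.
have -> : s1 = reg_update s0 2 (reval s0 (RSub (RReg 0) (RReg 1))).
  by rewrite /s1 /= ger0_norm ?subr_ge0.
exact: exec_assign.
Qed.

End ThresholdProgram.

(** * Sequences and their prime periods *)

Section Orbits.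
Context {R : realType}.
Implicit Types (a b : R) (z : R * R) (u : nat -> R).

Definition lyness_orbit a b z (n : nat) : R :=
  if odd n then (iter n./2 (lyness_map a b) z).1 else (iter n.-1./2 (lyness_map a b) z).2.

Lemma lyness_orbit_odd a b z i :
  lyness_orbit a b z i.*2.+1 = (iter i (lyness_map a b) z).1.
Proof. by rewrite /lyness_orbit /= odd_double /= uphalf_double. Qed.

Lemma lyness_orbit_even a b z i :
  lyness_orbit a b z i.*2.+2 = (iter i (lyness_map a b) z).2.
Proof. by rewrite /lyness_orbit /= odd_double /= uphalf_double. Qed.

Variant positive_parity : nat -> Type :=
  | PositiveOdd i : positive_parity i.*2.+1
  | PositiveEven i : positive_parity i.*2.+2.

Lemma positive_parityP n : (0 < n)%N -> positive_parity n.
Proof.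
case: n => // n _; rewrite -[n]odd_double_half; case: (odd n) => /=.
  by rewrite add1n; exact: PositiveEven.
by rewrite add0n; exact: PositiveOdd.
Qed.

Lemma lyness_orbit_sequence a b z : quadrant z -> lyness_sequence a b (lyness_orbit a b z).
Proof.
move=> z0; have /andP[z1 z2] := z0; split; rewrite ?(lyness_orbit_odd a b z 0) ?(lyness_orbit_even a b z 0) //.
move=> n /positive_parityP[] i; rewrite /lyness_coef /= odd_double /=.
  by rewrite -doubleS lyness_orbit_odd lyness_orbit_even lyness_orbit_odd.
by rewrite -doubleS lyness_orbit_even lyness_orbit_odd lyness_orbit_even.
Qed.

Lemma lyness_sequence_orbit a b u n : lyness_sequence a b u -> (0 < n)%N ->
  u n = lyness_orbit a b (u 1%N, u 2) n.
Proof.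
move=> [u1 u2 uE]; have e i : (u i.*2.+1, u i.*2.+2) = iter i (lyness_map a b) (u 1%N, u 2).
  elim: i => //= i <-; rewrite /lyness_map /lyness_step /= doubleS.
  have e1 := uE i.*2.+1 isT; have e2 := uE i.*2.+2 isT.
  by rewrite e2 e1 /lyness_coef /= odd_double.
by move=> /positive_parityP[] i; rewrite ?lyness_orbit_odd ?lyness_orbit_even -e.
Qed.

Lemma is_period_orbit a b z d :
  is_period (lyness_orbit a b z) (2 * d) <-> iter d (lyness_map a b) z = z.
Proof.
rewrite mul2n; split => [h|h n].
  have := h 1%N isT; have := h 2 isT; rewrite !(addSn, add0n).
  rewrite lyness_orbit_odd lyness_orbit_even.
  rewrite (lyness_orbit_odd a b z 0) (lyness_orbit_even a b z 0) /= => e2 e1.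
  by rewrite [LHS]surjective_pairing e1 e2 -surjective_pairing.
move=> /positive_parityP[] i; rewrite !addSn -doubleD !(lyness_orbit_odd, lyness_orbit_even);
  by rewrite iterD h.
Qed.

(** An odd shift exchanges the coefficients: [u 3] is obtained from [u 1] and [u 2] with [a] and
    also with [b]. *)
Lemma odd_period_eq a b u k : 0 < a -> 0 < b -> lyness_sequence a b u -> is_period u k -> odd k -> a = b.
Proof.
move=> a0 b0 su pk ok; have [u1 u2 uE] := su.
have e1 := uE 1%N isT; have e2 := uE (1 + k)%N isT.
have p3 : u (1 + k).+2 = u 3 by rewrite -(pk 3 isT).
have p2 : u (1 + k).+1 = u 2 by rewrite -(pk 2 isT).
rewrite p3 p2 (pk 1%N isT) e1 in e2.
move: e2; rewrite /lyness_coef /= ok /= => /(mulIf _) h.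
by apply: (addIr (u 2)); apply: h; rewrite invr_neq0 // gt_eqF.
Qed.

Lemma prime_period_orbit a b z p : (0 < p)%N -> iter p (lyness_map a b) z = z ->
  (forall d, iter d (lyness_map a b) z = z -> (p %| d)%N) ->
  (forall k, odd k -> ~ is_period (lyness_orbit a b z) k) ->
  prime_period (lyness_orbit a b z) (2 * p).
Proof.
move=> p0 zE min_p noodd; split; first by rewrite muln_gt0.
  exact/is_period_orbit.
move=> j j0 pj; have [oj|ej] := boolP (odd j); first by case: (noodd j oj).
rewrite -[j]odd_double_half (negPf ej) add0n -mul2n in j0 pj *.
rewrite leq_mul2l dvdn_leq //; first by rewrite muln_gt0 in j0; case/andP: j0.
by apply: min_p; exact/is_period_orbit.
Qed.

Lemma prime_period_map a b z p : prime_period (lyness_orbit a b z) (2 * p) ->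
  [/\ (0 < p)%N, iter p (lyness_map a b) z = z &
      forall d, (0 < d)%N -> iter d (lyness_map a b) z = z -> (p <= d)%N].
Proof.
move=> [p0 pp pmin]; split; first by rewrite muln_gt0 in p0.
  exact/is_period_orbit.
move=> d d0 /is_period_orbit pd.
by have := pmin (2 * d)%N; rewrite muln_gt0 d0 leq_mul2l /=; apply.
Qed.

End Orbits.

(** * The case of equal parameters: exclusion of odd periods *)

Section Autonomous.
Context {R : realType} (a : R) (c : R * R).
Hypotheses (a0 : 0 < a) (cc : critical a a c).
Implicit Types (z : R * R).

Let cq : quadrant c. Proof. by case/and3P: cc. Qed.
Let c_gt1 : 1 < c.1 * c.2. Proof. exact: critical_prod_gt1 cc. Qed.
Let F := lyness_map a a.
Let rot := rotation a a c.
Let ol := ortho_log c.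
Let step := lyness_step a.
Let pi0 : 0 < pi :> R. Proof. exact: pi_gt0. Qed.

Definition half_rotation n z : R := winding (fun i => ol (iter i step z)) n.

Lemma critical_diag : c.1 = c.2.
Proof using a0 cc.
have sw : critical a a (c.2, c.1).
  by case/and3P: cc => /andP[c1 c2] e1 e2; rewrite /critical /quadrant /= c1 c2 e1 e2.
by have /(congr1 fst) := critical_uniq a0 a0 cc sw.
Qed.

Lemma step_neq z : quadrant z -> z != c -> step z != z.
Proof using a0 cc.
move=> z0 zc; have := critical_map_neq a0 a0 cc z0 zc.
by apply: contra => /eqP e; apply/eqP; rewrite /lyness_map -/step !e.
Qed.

Lemma iter_step_double n z : iter (n.*2) step z = iter n F z.
Proof using Type. by elim: n => //= n ->. Qed.

Lemma quadrant_iter_step n z : quadrant z -> quadrant (iter n step z).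
Proof using a0. by move=> z0; elim: n => //= n IH; exact: quadrant_step. Qed.

Lemma iter_step_neq n z : quadrant z -> z != c -> iter n step z != c.
Proof using a0 cc.
move=> z0 zc; rewrite -(odd_double_half n) iterD iter_step_double.
have w0 := quadrant_iter n./2 a0 a0 z0.
have wc := iter_neq_critical n./2 a0 a0 cc z0 zc.
case: (odd n) => //=; have sq := quadrant_step a0 w0.
apply/eqP => e; have := level_gt_critical a0 a0 cc w0 wc.
by rewrite -(lyness_inv_step a a0 w0) -/step e ltxx.
Qed.

Lemma apart_step n z : quadrant z -> z != c -> apart (ol (iter n step z)) (ol (iter n.+1 step z)).
Proof using a0 cc.
move=> z0 zc; have w0 := quadrant_iter_step n z0; have wc := iter_step_neq n z0 zc.
apply: (apart_level a0 a0 cc) => //=; first exact: quadrant_step.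
  exact: step_neq.
exact: lyness_inv_step.
Qed.

Lemma cvg_half_rotation (T : Type) (G : set_system T) {FG : Filter G} (f : T -> R * R) z n :
  quadrant z -> z != c ->
  (fun t => (f t).1) @ G --> z.1 -> (fun t => (f t).2) @ G --> z.2 ->
  (fun t => half_rotation n (f t)) @ G --> half_rotation n z.
Proof using a0 cc.
move=> z0 zc f1 f2.
have cv i : (fun t => (iter i step (f t)).1) @ G --> (iter i step z).1 /\
    (fun t => (iter i step (f t)).2) @ G --> (iter i step z).2.
  elim: i => //= i [h1 h2]; exact: (@cvg_step R T G FG a _ _ (quadrant_iter_step i z0) h1 h2).
have co i : (fun t => (ol (iter i step (f t))).1) @ G --> (ol (iter i step z)).1 /\
    (fun t => (ol (iter i step (f t))).2) @ G --> (ol (iter i step z)).2.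
  by have [h1 h2] := cv i; exact: (cvg_ortho_log c (quadrant_iter_step i z0) h1 h2).
elim: n => [|n IH].
  by rewrite /half_rotation /winding big_ord0; under eq_fun do rewrite big_ord0; exact: cvg_cst.
rewrite /half_rotation /winding big_ord_recr /=; under eq_fun do rewrite big_ord_recr /=.
apply: cvgD; first exact: IH.
have [h1 h2] := co n; have [h3 h4] := co n.+1.
exact: (@cvg_angle R T G FG (fun t => ol (iter n step (f t))) (fun t => ol (iter n.+1 step (f t))) _ _ (apart_step n z0 zc) h1 h2 h3 h4).
Qed.

(* Near the critical point the step is almost a rotation by less than pi.     *)
Lemma half_rotation_near z : quadrant z -> z != c ->
  \forall s \near (0 : R)^'+, half_rotation 2 (toward c z s) < 2 * pi.
Proof using a0 cc.
move=> z0 zc; have /andP[c1 c2] := cq.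
have /and3P[_ /eqP cE1 /eqP cE2] := cc.
pose p := ((z.1 - c.1) / c.1, (z.2 - c.2) / c.2).
have p0 : p != (0, 0) by exact: relative_displacement_neq0.
pose f := toward c z.
pose P i := iter i (diff_step (slope1 c)) p.
have s12 : slope2 c = slope1 c by rewrite /slope1 /slope2 critical_diag.
have P0 i : P i != (0, 0).
  elim: i => //= i; apply: contraNneq; case: (P i) => x y [e1 e2].
  by move: e2; rewrite /= e1 mulr0 sub0r => /eqP; rewrite oppr_eq0 => /eqP ->.
have cr i : 0 < cross (ortho_coord c (P i)) (ortho_coord c (P i.+1)).
  have /= := P0 i; case: (P i) => x y /= xy.
  rewrite cross_ortho /= mulNr oppr_gt0 pmulr_rlt0; last first.
    by rewrite mulr_gt0 // sqrtr_gt0 ?slope2_gt0 ?ortho_disc_gt0.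
  have m0 := slope1_gt0 cq; have m1 := slope_prod_lt1 cq c_gt1; rewrite s12 in m1.
  set m := slope1 c in m0 m1 *.
  have m2 : m < 1 by nra.
  have xy2 : 0 < x ^+ 2 + y ^+ 2.
    rewrite lt0r addr_ge0 ?sqr_ge0 // andbT paddr_eq0 ?sqr_ge0 // !sqrf_eq0.
    by apply: contra xy => /andP[/eqP -> /eqP ->].
  have m3 : 0 < 1 - m by rewrite subr_gt0.
  have := mulr_gt0 m3 xy2; have := mulr_gt0 m0 xy2.
  by have := mulr_ge0 (ltW m0) (sqr_ge0 (x - y)); lra.
have Pa i : apart (ortho_coord c (P i)) (ortho_coord c (P i.+1)).
  apply: apart_intro; rewrite ?ortho_neq0 // => l l0 e1 e2.
  have := cr i; rewrite /cross e1 e2.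
  rewrite [X in 0 < X](_ : _ = 0) ?ltxx //; ring.
have l0 := @near_inv_gt0 R.
have stepc : step c = c.
  by rewrite /step /lyness_step -cE1 expr2 mulfK ?gt_eqF // -critical_diag [RHS]surjective_pairing critical_diag.
have cv i : [/\ (fun s => (iter i step (f s)).1) @ (0 : R)^'+ --> c.1,
    (fun s => (iter i step (f s)).2) @ (0 : R)^'+ --> c.2,
    (fun s => s^-1 * ((iter i step (f s)).1 - c.1)) @ (0 : R)^'+ --> c.1 * (P i).1 &
    (fun s => s^-1 * ((iter i step (f s)).2 - c.2)) @ (0 : R)^'+ --> c.2 * (P i).2].
  elim: i => [|i [h1 h2 h3 h4]]; first by split; rewrite /P /=;
    [exact: cvg_affine0|exact: cvg_affine0|exact: cvg_affine_quotient|exact: cvg_affine_quotient].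
  have FF : Filter (0 : R)^'+ by exact: at_right_proper_filter.
  have [k1 k2] := @cvg_step R _ _ FF a _ c cq h1 h2; rewrite -/step stepc in k1 k2.
  split=> //; first by rewrite critical_diag.
  have k := cvg_quotient_step c1 cE1 h1 h3 h4.
  have diag (X : R -> R) y : (fun s => s^-1 * (X s - c.1)) @ (0 : R)^'+ --> c.1 * y ->
      (fun s => s^-1 * (X s - c.2)) @ (0 : R)^'+ --> c.2 * y by rewrite critical_diag.
  by apply: (diag (fun s => (iter i.+1 step (f s)).2) (P i.+1).2); exact (k FF).
have lg i : (fun s => s^-1 * (log_coord c (iter i step (f s))).1) @ (0 : R)^'+ --> (P i).1 /\
    (fun s => s^-1 * (log_coord c (iter i step (f s))).2) @ (0 : R)^'+ --> (P i).2.
  have [h1 h2 h3 h4] := cv i; split.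
    exact: (cvg_log_quotient l0 c1 h1 h3).
  exact: (cvg_log_quotient l0 c2 h2 h4).
have an i : \forall s \near (0 : R)^'+, angle (ol (iter i step (f s))) (ol (iter i.+1 step (f s))) < pi.
  pose h j s := ortho_coord c (s^-1 * (log_coord c (iter j step (f s))).1, s^-1 * (log_coord c (iter j step (f s))).2).
  have hc j : (fun s => (h j s).1) @ (0 : R)^'+ --> (ortho_coord c (P j)).1 /\
      (fun s => (h j s).2) @ (0 : R)^'+ --> (ortho_coord c (P j)).2.
    by have [l1 l2] := lg j; exact: cvg_ortho.
  have [q1 q2] := hc i; have [q3 q4] := hc i.+1.
  have FF : Filter (0 : R)^'+ by exact: at_right_proper_filter.
  have lim := @cvg_angle R R _ FF (h i) (h i.+1) _ _ (Pa i) q1 q2 q3 q4.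
  have lt_pi := angle_ltpi (Pa i) (cr i).
  near=> s.
  have s0 : 0 < s^-1 by near: s.
  have <- : angle (h i s) (h i.+1 s) = angle (ol (iter i step (f s))) (ol (iter i.+1 step (f s))).
    by rewrite /h !ortho_scale angle_scale.
  by near: s; exact: (cvgr_lt _ lim).
near=> s; rewrite /half_rotation /winding big_ord_recl big_ord1 mulr_natl mulr2n.
by apply: ltrD; [have := near (an 0%N) s|have := near (an 1%N) s]; apply.
Unshelve. all: by end_near. Qed.

(** Both quantities are lifts of the angle from [z] to [F z]. *)
Lemma half_rotation_mod z : quadrant z -> z != c ->
  exists m : nat, `|half_rotation 2 z - rot 1 z| = m%:R * (2 * pi).
Proof using a0 cc.
move=> z0 zc; apply: cos_eq1; rewrite ?normr_ge0 // cos_norm cosB.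
have [h1 h2] := cos_sin_winding (v := fun i => ol (iter i step z)) 2 (fun i => apart_step i z0 zc).
have [h3 h4] := cos_sin_winding (v := fun i => ol (iter i F z)) 1 (fun i => apart_iter a0 a0 cc i z0 zc).
rewrite -/(half_rotation 2 z) in h1 h2; rewrite -/(rotation a a c 1 z) -/rot in h3 h4.
have v0 : 0 < nrm (ol z) by rewrite nrm_gt0; exact: (ortho_log_neq0 a0 a0 cc).
have w0 : 0 < nrm (ol (F z)).
  rewrite nrm_gt0; apply: (ortho_log_neq0 a0 a0 cc); first exact: quadrant_map.
  exact: (iter_neq_critical 1 a0 a0 cc).
have N0 : nrm (ol z) * nrm (ol (F z)) != 0 by rewrite gt_eqF // mulr_gt0.
have ec : cos (half_rotation 2 z) = cos (rot 1 z) by apply: (mulfI N0); rewrite [LHS]h1 [RHS]h3.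
have es : sin (half_rotation 2 z) = sin (rot 1 z) by apply: (mulfI N0); rewrite [LHS]h2 [RHS]h4.
by rewrite ec es -!expr2 cos2Dsin2.
Qed.

(** On the segment to [c] the difference is continuous with values in the multiples of [2 * pi], and
    near [c] it is 0 by [half_rotation_near]. *)
Lemma half_rotation2E z : quadrant z -> z != c -> half_rotation 2 z = rot 1 z.
Proof using a0 cc.
move=> z0 zc; pose f := toward c z; have fE : f 1 = z := toward1 c z.
have fq s : 0 <= s <= 1 -> quadrant (f s) by exact: quadrant_toward.
have fc s : 0 < s -> f s != c by move=> s0; exact: toward_neq.
pose g s := half_rotation 2 (f s) - rot 1 (f s).
have gc s : 0 < s <= 1 -> {for s, continuous g}.
  move=> /andP[s0 s1]; have q := fq s; rewrite (ltW s0) s1 in q.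
  apply: cvgB; [apply: cvg_half_rotation|apply: (cvg_rotation a0 a0 cc)];
    rewrite ?fc ?q //; exact: continuous_affine.
have p2 : 0 < 2 * pi :> R by rewrite mulr_gt0.
have gm s : 0 < s <= 1 -> exists m : nat, `|g s| = m%:R * (2 * pi).
  by move=> /andP[s0 s1]; apply: half_rotation_mod; rewrite ?fc ?fq ?(ltW s0).
have small s : 0 < s <= 1 -> `|g s| < 2 * pi -> g s = 0.
  move=> s01 gs; have [m mE] := gm s s01; case: m mE => [|m] mE.
    by apply/eqP; rewrite -normr_eq0 mE mul0r.
  by move: gs; rewrite mE gtr_pMl // ltrn1.
have [s [s0 s1 hs]] : exists s : R, [/\ 0 < s, s < 1 & half_rotation 2 (f s) < 2 * pi].
  near (0 : R)^'+ => s; exists s; split.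
  - by near: s; exact: nbhs_right_gt.
  - by near: s; exact: nbhs_right_lt.
  - by near: s; exact: half_rotation_near.
have gs0 : g s = 0.
  apply: small; first by rewrite s0 ltW.
  have r0 := rotation_ge0 a a c 1 (f s); have r1 := rotation_lt a a c (n := 1) (f s) isT.
  have w0 := winding_ge0 (fun i => ol (iter i step (f s))) 2.
  rewrite -/(half_rotation 2 (f s)) in w0; rewrite mul1r in r1.
  by rewrite /g /rot ltr_norml; apply/andP; split; lra.
apply/eqP; rewrite -subr_eq0 -[z]fE -/(g 1); apply/negPn/negP => g1.
have [|m mE] := gm 1; first by rewrite ltr01 lexx.
have m0 : (0 < m)%N by case: m mE => // /eqP; rewrite mul0r normr_eq0 (negPf g1).
(* A nonzero difference at [z] is at least [2 * pi] in absolute value, so the value [pi] would be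
   taken on the way. *)
have big : pi <= `|g 1|.
  rewrite mE; have : 1 * (2 * pi) <= m%:R * (2 * pi) :> R by rewrite ler_pM2r // ler1n.
  by have := pi0; lra.
have half x : s <= x <= 1 -> `|g x| != pi.
  move=> /andP[sx x1]; have [|k kE] := gm x; first by rewrite (lt_le_trans s0).
  rewrite kE; case: k {kE} => [|k]; first by rewrite mul0r lt_eqF.
  rewrite gt_eqF //; apply: lt_le_trans (_ : 1 * (2 * pi) <= _); first by have := pi0; lra.
  by rewrite ler_pM2r // ler1n.
have [||x xs gx] := @ivt_sign R (fun x => `|g x|) s 1 pi (ltW s1).
- move=> x /andP[sx x1]; apply: (@continuous_comp _ _ _ g (fun t => `|t|)); last exact: norm_continuous.
  by apply: gc; rewrite (lt_le_trans s0).
- by rewrite gs0 normr0 sub0r mulNr oppr_le0 mulr_ge0 ?subr_ge0 // ltW.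
by have := half x xs; rewrite gx eqxx.
Unshelve. all: by end_near. Qed.

Lemma half_rotation_double n z : quadrant z -> z != c -> half_rotation n.*2 z = rot n z.
Proof using a0 cc.
move=> z0 zc; elim: n => [|n IH]; first by rewrite /half_rotation /rot /rotation /winding !big_ord0.
have split2 m : half_rotation (m + 2) z = half_rotation m z + half_rotation 2 (iter m step z).
  rewrite /half_rotation /winding big_split_ord /=; congr (_ + _).
  by apply: eq_bigr => i _ /=; rewrite -!iterD addnC.
rewrite doubleS -addn2 split2 IH half_rotation2E ?quadrant_iter_step ?iter_step_neq //.
by rewrite iter_step_double -[n.+1]addn1 /rot rotationD.
Qed.

(** An odd return time [k] would be [j * p], and going around twice in [2 * k] single steps gives
    [j * q = 2 * m], although [j] and [q] are odd. *)
Lemma no_odd_step_period p q k z : (0 < p)%N -> coprime (2 * p) q -> quadrant z -> z != c ->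
  rot p z = q%:R * (2 * pi) -> odd k -> iter k step z <> z.
Proof using a0 cc.
move=> p0; rewrite coprimeMl => /andP[q2 pq] z0 zc rE ok kE.
have FkE : iter k F z = z by rewrite -iter_step_double -addnn iterD !kE.
have /dvdnP[j jE] := prime_rotation a0 a0 cc p0 pq z0 zc rE FkE.
have [m mE] : exists m : nat, half_rotation k z = m%:R * (2 * pi).
  by apply: winding_closed => [i|]; [exact: apart_step|rewrite kE].
have pE : iter p F z = z := rotation_multiple a0 a0 cc z0 zc rE.
have e1 : rot k z = j%:R * rot p z by rewrite jE mulnC /rot rotation_periodic.
have e2 : rot k z = 2 * half_rotation k z.
  rewrite -half_rotation_double // -addnn /half_rotation /winding big_split_ord /= mulr_natl mulr2n.
  by congr (_ + _); apply: eq_bigr => i _ /=; rewrite addnC iterD kE.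
have p2 : 2 * pi != 0 :> R by rewrite gt_eqF // mulr_gt0.
have : (j * q)%:R * (2 * pi) = (2 * m)%:R * (2 * pi) :> R.
  by rewrite !natrM -!mulrA -rE -mE -e1 e2.
move/(mulIf p2)/eqP; rewrite eqr_nat => /eqP jq.
have : odd (j * q) by rewrite oddM; move: ok; rewrite jE oddM => /andP[-> _]; rewrite -coprime2n.
by rewrite jq oddM.
Qed.

End Autonomous.

(** * Continua of periodic initial conditions *)

Section PeriodicContinua.
Context {R : realType} (a b : R) (c : R * R).
Hypotheses (a0 : 0 < a) (b0 : 0 < b) (cc : critical a b c).
Implicit Types (z : R * R) (p q : nat).

Let F := lyness_map a b.
Let rot := rotation a b c.

Lemma iter_step_orbit (d : R) n z : iter n (lyness_step d) z =
  (lyness_orbit d d z n.+1, lyness_orbit d d z n.+2).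
Proof using Type.
have e k : iter k (lyness_map d d) z = iter k.*2 (lyness_step d) z.
  by elim: k => //= k ->.
rewrite -{1}(odd_double_half n) iterD -e -[in RHS](odd_double_half n).
case: (odd n) => /=.
  rewrite add1n lyness_orbit_even -[n./2.*2.+3]/((n./2.+1).*2.+1) lyness_orbit_odd.
  by rewrite /= /lyness_map /lyness_step.
by rewrite add0n lyness_orbit_odd lyness_orbit_even -surjective_pairing.
Qed.

(** Coprimality of [p] and [q] gives minimality under [F]; odd periods are excluded by [a <> b] or,
    when [a = b], by the oddness of [q]. *)
Lemma rotation_prime_period p q z : (0 < p)%N -> quadrant z -> z != c ->
  rot p z = q%:R * (2 * pi) -> (a <> b /\ coprime p q) \/ coprime (2 * p) q ->
  prime_period (lyness_orbit a b z) (2 * p).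
Proof using a0 b0 cc.
move=> p0 z0 zc rE cop.
have pq : coprime p q by case: cop => [[]|] //; rewrite coprimeMl => /andP[].
apply: prime_period_orbit => //.
- exact: (rotation_multiple a0 b0 cc z0 zc rE).
- by move=> d; exact: (prime_rotation a0 b0 cc p0 pq z0 zc rE).
move=> k ok pk.
have ab := odd_period_eq a0 b0 (lyness_orbit_sequence a b z0) pk ok.
case: cop => [[/(_ ab)]//|cop].
move: rE cop pk; rewrite /rot -ab => rE cop pk.
have cca : critical a a c by move: cc; rewrite -ab.
apply: (no_odd_step_period a0 cca p0 cop z0 zc rE ok).
rewrite iter_step_orbit -[k.+1]add1n -[k.+2]add2n (pk 1%N isT) (pk 2 isT).
by rewrite (lyness_orbit_odd a a z 0) (lyness_orbit_even a a z 0) -surjective_pairing.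
Qed.

(** The excluded points are those fixed by the switch of [y] and [(b + x) / y]. If [z] and [F z]
    were both such points, then [F z = z]. *)
Lemma rotation_off_switch p q z : (0 < p)%N -> quadrant z -> z != c ->
  rot p z = q%:R * (2 * pi) -> exists w, [/\ quadrant w, w != c,
    rot p w = q%:R * (2 * pi) & w.2 ^+ 2 != b + w.1].
Proof using a0 b0 cc.
move=> p0 z0 zc rE; have [e|ne] := eqVneq (z.2 ^+ 2) (b + z.1); last by exists z.
have zE := rotation_multiple a0 b0 cc z0 zc rE.
have Fq : quadrant (F z) by exact: quadrant_map.
exists (F z); split => //; first exact: (iter_neq_critical 1 a0 b0 cc).
  by rewrite -rE; exact: (@rotation_shift _ a b c p 1 z zE).
have := critical_map_neq a0 b0 cc z0 zc; rewrite -/F.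
apply: contra => /eqP e'; apply/eqP; move: e' Fq.
case: z z0 e {zc rE zE} => x y /andP[/= x0 y0] e.
rewrite /F /lyness_map /lyness_step /=; set x' := (a + y) / x.
move=> e' /andP[/= x'0 y'0].
have y'E : (b + x') / y = y.
  apply: (mulIf (lt0r_neq0 y'0)); rewrite -expr2 e'.
  by rewrite mulrCA mulfV ?gt_eqF // mulr1.
have x'x : b + x' = b + x by rewrite -e expr2 -{2}y'E mulrC divfK ?gt_eqF.
by rewrite y'E; congr pair; apply: (addrI b).
Qed.

(** A piece of the arc of [porism_arc]. Each of the finitely many smaller periods fails at [w]
    because two terms differ, and this persists nearby, so the prime period is the same along the
    piece. *)
Lemma periodic_continuum p q z : (0 < p)%N -> quadrant z -> z != c ->
  rot p z = q%:R * (2 * pi) -> (a <> b /\ coprime p q) \/ coprime (2 * p) q ->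
  exists C : set (R * R), continuum C /\ C `<=` initial_conditions_of_period a b (2 * p).
Proof using a0 b0 cc.
move=> p0 z0' zc' rE' cop.
have [w [w0 wc rE wne]] := rotation_off_switch p0 z0' zc' rE'.
have [_ _ pmin] := rotation_prime_period p0 w0 wc rE cop.
have wE := rotation_multiple a0 b0 cc w0 wc rE.
have [Y [Yw [r r0 hY]]] := porism_arc a0 b0 w0 wne wE.
set x0 := w.1 in Yw hY.
have x0r : `|x0 - x0| < r by rewrite subrr normr0.
have wY : w = (x0, Y x0) by rewrite Yw -surjective_pairing.
have [cY _ _] := hY x0 x0r.
pose u n t := lyness_orbit a b (t, Y t) n.
have cu n : u n @ x0 --> u n x0.
  have q0 : quadrant (x0, Y x0) by rewrite -wY.
  have [h1 h2] : (forall i, (fun t => (iter i F (t, Y t)).1) @ x0 --> (iter i F (x0, Y x0)).1) /\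
     (forall i, (fun t => (iter i F (t, Y t)).2) @ x0 --> (iter i F (x0, Y x0)).2).
    by split => i; have [] := cvg_iter a0 b0 i q0 (f := fun t => (t, Y t)) cvg_id cY.
  by rewrite /u /lyness_orbit; case: (odd n).
have near_prime : \forall t \near x0, forall j : 'I_(2 * p), (0 < j)%N ->
    ~ is_period (lyness_orbit a b (t, Y t)) j.
  pose P (j : 'I_(2 * p)) (t : R) := (0 < j)%N -> ~ is_period (lyness_orbit a b (t, Y t)) j.
  suff h j : \forall t \near x0, P j t by exact: (@filter_forall R _ P (nbhs x0) _ h).
  have [j0|j0] := posnP j; first by near=> t; rewrite /P j0.
  have /existsNP[n /not_implyP[n0 nj]] : ~ is_period (lyness_orbit a b w) j.
    by move=> /(pmin j j0); rewrite leqNgt ltn_ord.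
  have lim : (fun t => u (n + j)%N t - u n t) @ x0 --> u (n + j)%N x0 - u n x0.
    by apply: cvgB; exact: cu.
  have ne : u (n + j)%N x0 - u n x0 != 0.
    by rewrite subr_eq0; apply/eqP; rewrite /u -wY.
  have pos : 0 < `|u (n + j)%N x0 - u n x0| by rewrite normr_gt0.
  have lim' : (fun t => `|u (n + j)%N t - u n t|) @ x0 --> `|u (n + j)%N x0 - u n x0|.
    exact: cvg_norm.
  have far : \forall t \near x0, 0 < `|u (n + j)%N t - u n t| by move/cvgr_gt: lim'; apply.
  near=> t; rewrite /P => _ pj; have : 0 < `|u (n + j)%N t - u n t| by near: t.
  by rewrite normr_gt0 subr_eq0 /u pj // eqxx.
have /nbhs_ballP[s /= s0 hs] := near_prime.
pose d := Num.min r s / 2.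
have m0 : 0 < Num.min r s by rewrite lt_min r0.
have d0 : 0 < d by rewrite divr_gt0.
have dr t : x0 <= t <= x0 + d -> `|t - x0| < r /\ `|x0 - t| < s.
  move=> /andP[t1 t2]; rewrite [`|x0 - t|]distrC ger0_norm ?subr_ge0 //.
  have h : t - x0 < Num.min r s by rewrite /d in t2 d0; lra.
  by move: h; rewrite lt_min => /andP[].
exists ((fun t => (t, Y t)) @` `[x0, x0 + d]).
have cpair : {within `[x0, x0 + d], continuous (fun t => (t, Y t))}.
  apply: continuous_in_subspaceT => t; rewrite inE /= in_itv /= => /dr[tr _].
  have [cYt _ _] := hY t tr.
  have idt : (fun x : R => x) @ t --> t by exact: cvg_id.
  exact (cvg_pair idt cYt).
split; first split.
- by apply: continuous_compact => //; exact: segment_compact.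
- by apply: connected_continuous_connected => //; exact: segment_connected.
- exists (x0, Y x0), (x0 + d, Y (x0 + d)); split.
  + by exists x0 => //=; rewrite in_itv /= lexx lerDl ltW.
  + by exists (x0 + d) => //=; rewrite in_itv /= lexx lerDl ltW.
  + by move=> [e _]; move: d0; rewrite -[d](addKr x0) -e addNr ltxx.
- move=> _ [t /= + <-]; rewrite in_itv /= => /dr[tr ts].
  have [_ tq tE] := hY t tr.
  exists (lyness_orbit a b (t, Y t)); split; first exact: lyness_orbit_sequence.
    by rewrite (lyness_orbit_odd a b _ 0) (lyness_orbit_even a b _ 0).
  split; [by rewrite muln_gt0|exact/is_period_orbit|].
  move=> j j0 pj; rewrite leqNgt; apply/negP => jp.
  exact: (hs t ts (Ordinal jp) j0 pj).
Unshelve. all: by end_near. Qed.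

End PeriodicContinua.

(** * The even periods that occur *)

Lemma periodic_rotation_choice (p : nat) : (0 < p)%N -> p \notin [:: 1; 2; 3; 4; 5; 6; 10]%N ->
  exists q : nat, [/\ coprime p q, (p < 3 * q)%N, (2 * q < p)%N & (5 * q != 2 * p)%N].
Proof.
move=> p0; rewrite !inE !negb_or => /and5P[p1 p2 p3 p4 /and3P[p5 p6 p10]].
(* The choice is [q = (p - 1) / 2] for odd [p], [p / 2 - 1] when 4 divides [p], and [p / 2 - 2]
   otherwise. *)
have [op|ep] := boolP (odd p).
  have [m mE] : exists m, p = (2 * m + 1)%N by exists p./2; lia.
  exists m; rewrite mE; split; [|lia|lia|lia].
  by rewrite coprime_sym /coprime addnC addnC gcdnMDl gcdn1.
have [e4|ne4] := boolP (4 %| p)%N.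
  have [m mE] : exists m, p = (4 * m + 4)%N by exists (p %/ 4 - 1)%N; lia.
  exists (2 * m + 1)%N; rewrite mE; split; [|lia|lia|lia].
  have -> : (4 * m + 4 = 2 * (2 * m + 1) + 2)%N by lia.
  by rewrite coprime_sym /coprime gcdnMDl -/(coprime _ _) coprimen2 addn1 /= oddM.
have [m mE] : exists m, p = (4 * m + 6)%N by exists (p %/ 4 - 1)%N; lia.
exists (2 * m + 1)%N; rewrite mE; split; [|lia|lia|lia].
have -> : (4 * m + 6 = 2 * (2 * m + 1) + 4)%N by lia.
by rewrite coprime_sym /coprime gcdnMDl -/(coprime _ _) (coprimeXr 2 (n := 2)) // coprimen2 addn1 /= oddM.
Qed.

Section RotationNumberAtCriticalPoint.
Context {R : realType}.
Implicit Types (a b : R) (c : R * R) (p q : nat).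

Lemma critical_pointE a b c : 0 < a -> 0 < b -> critical a b c -> critical_point a b = c.
Proof.
move=> a0 b0 cc; apply: xget_unique.
  by have /and3P[/andP[c1 c2] /eqP e1 /eqP e2] := cc.
move=> [x y] /= [x0 y0 e1 e2]; apply: (critical_uniq a0 b0) cc.
by rewrite /critical /quadrant /= x0 y0 e1 e2 !eqxx.
Qed.

Lemma sigmaE a b c : 0 < a -> 0 < b -> critical a b c ->
  critical_angle c = sigma a b * (2 * pi).
Proof.
move=> a0 b0 cc; rewrite /sigma (critical_pointE a0 b0 cc).
case: c cc => x y cc; rewrite -/(critical_angle (x, y)).
by rewrite mulrAC mulVf ?mul1r // gt_eqF // mulr_gt0 ?pi_gt0.
Qed.

(** [critical_angle] depends only on the product of the coordinates of [c], and [c] can be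
    prescribed by taking [a = x ^+ 2 - y] and [b = y ^+ 2 - x]. With [c = (l ^+ 5, l ^+ 3)] and
    [l > 1] both are positive and distinct, and [l ^+ 8] is the required product. *)
Lemma rotation_realization (r : R) : 1 / 3 < r < 1 / 2 ->
  exists a b c, [/\ 0 < a, 0 < b, a <> b, critical a b c & critical_angle c = r * (2 * pi)].
Proof.
move=> /andP[r1 r2]; have pi0 := @pi_gt0 R.
set t := r * (2 * pi).
have t1 : 2 * pi / 3 < t by rewrite /t; nra.
have t2 : t < pi by rewrite /t; nra.
have it : t \in `[0, pi] by rewrite in_itv /=; apply/andP; split; lra.
have i1 : 2 * pi / 3 \in `[0, (pi : R)] by rewrite in_itv /=; apply/andP; split; lra.
have ip : (pi : R) \in `[0, pi] by rewrite in_itv /= lexx andbT ltW.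
have c1 : cos t < - (1 / 2).
  have <- : cos (2 * pi / 3) = - (1 / 2) :> R.
    have -> : 2 * pi / 3 = pi / 3 + pi / 3 :> R by field.
    by rewrite cosD -!expr2 sin2cos2 cos_pi_third; field.
  by rewrite (ltr_cos i1 it).
have c2 : -1 < cos t by rewrite -cospi (ltr_cos it ip).
pose P := (2 + 2 * cos t)^-1.
have P1 : 1 < P by rewrite /P invf_gt1; lra.
have sq1 (x : R) : 1 < x -> 1 < Num.sqrt x by move=> x1; rewrite -sqrtr1 ltr_sqrt //; lra.
pose l := Num.sqrt (Num.sqrt (Num.sqrt P)).
have l1 : 1 < l by rewrite /l; apply: (sq1); apply: (sq1); apply: (sq1).
have lP : l ^+ 8 = P.
  rewrite (exprM l 2 4) (exprM _ 2 2) /l !sqr_sqrtr ?sqrtr_ge0 //.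
  by lra.
have l0 : 0 < l by lra.
exists (l ^+ 10 - l ^+ 3), (l ^+ 6 - l ^+ 5), (l ^+ 5, l ^+ 3).
have lX m n : (m < n)%N -> l ^+ m < l ^+ n by move=> mn; rewrite ltr_eXn2l.
have a0 : 0 < l ^+ 10 - l ^+ 3 by rewrite subr_gt0 lX.
have b0 : 0 < l ^+ 6 - l ^+ 5 by rewrite subr_gt0 lX.
split=> //.
- by have := lX 6%N 10%N isT; have := lX 3%N 5%N isT; lra.
- by rewrite /critical /quadrant /= !exprn_gt0 // -!exprM !subrK !eqxx.
rewrite /critical_angle /= -exprD lP /P invrK.
have -> : 2^-1 * (- 2 + (2 + 2 * cos t)) = cos t by field.
by rewrite cosK.
Qed.

Lemma sigma_gt0 a b c : 0 < a -> 0 < b -> critical a b c -> 0 < sigma a b.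
Proof.
move=> a0 b0 cc; have p2 : 0 < 2 * pi :> R by rewrite mulr_gt0 ?pi_gt0.
have /and3P[cq _ _] := cc; have c1 := critical_prod_gt1 a0 b0 cc.
by have /andP[+ _] := critical_angle_itv cq c1; rewrite (sigmaE a0 b0 cc) pmulr_lgt0.
Qed.

Lemma exists_rotation_between a b c p q : 0 < a -> 0 < b -> critical a b c -> (0 < p)%N ->
  (p%:R * sigma a b < q%:R /\ q%:R < p%:R * (2 / 5) :> R) \/
  (p%:R * (2 / 5) < q%:R :> R /\ q%:R < p%:R * sigma a b) ->
  exists z, [/\ quadrant z, z != c & rotation a b c p z = q%:R * (2 * pi)].
Proof.
move=> a0 b0 cc p0 h; apply: exists_rotation => //.
have p2 : 0 < 2 * pi :> R by rewrite mulr_gt0 ?pi_gt0.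
rewrite (sigmaE a0 b0 cc) mulrA -mulrBl.
by case: h => -[h1 h2]; [rewrite pmulr_llt0|rewrite nmulr_llt0];
  rewrite ?(pmulr_llt0 _ p2) ?(pmulr_lgt0 _ p2); lra.
Qed.

Lemma nonresonant_continuum a b p : 0 < a -> 0 < b -> sigma a b <> 2 / 5 ->
  (threshold (`|sigma a b - 2 / 5|)%R < p)%N ->
  exists C : set (R * R), continuum C /\ C `<=` initial_conditions_of_period a b (2 * p).
Proof.
move=> a0 b0 /eqP s25 hp; have [c cc] := critical_exists a0 b0.
have p0 : (0 < p)%N by exact: leq_ltn_trans hp.
have s0 := sigma_gt0 a0 b0 cc.
have L0 : 0 < `|sigma a b - 2 / 5| by rewrite normr_gt0 subr_eq0.
have hL := threshold_spec L0 (ltnW hp).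
have [q [cop qb]] : exists q, coprime (2 * p) q /\
    ((p%:R * sigma a b < q%:R /\ q%:R < p%:R * (2 / 5) :> R) \/
     (p%:R * (2 / 5) < q%:R :> R /\ q%:R < p%:R * sigma a b)).
  have [lo|hi] : sigma a b < 2 / 5 \/ 2 / 5 < sigma a b.
    by move: s25; rewrite neq_lt => /orP.
  - rewrite ltr0_norm ?subr_lt0 // opprB in hL.
    have [q [cop q1 q2]] := coprime_in_interval (ltW s0) lo hL.
    by exists q; split => //; left.
  - rewrite gtr0_norm ?subr_gt0 // in hL.
    have [|q [cop q1 q2]] := coprime_in_interval _ hi hL; first by lra.
    by exists q; split => //; right.
have [z [z0 zc zE]] := exists_rotation_between a0 b0 cc p0 qb.
by apply: (periodic_continuum a0 b0 cc p0 z0 zc zE); right.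
Qed.

Lemma resonant_continuum a b : 0 < a -> 0 < b -> (a, b) <> (1, 1) -> sigma a b = 2 / 5 ->
  exists N : nat, forall p, (N < p)%N ->
    exists C : set (R * R), continuum C /\ C `<=` initial_conditions_of_period a b (2 * p).
Proof.
move=> a0 b0 ab s25; have [c cc] := critical_exists a0 b0.
have phi := sigmaE a0 b0 cc; rewrite s25 in phi.
have [|d d0 hd] := resonant_rotation a0 b0 cc ab; first by rewrite phi; field.
(* The cap at 1 keeps [(2 - e) / 5] nonnegative, as [coprime_in_interval] demands of its lower
   bound. *)
pose e := Num.min d 1; have e0 : 0 < e by rewrite lt_min d0 ltr01.
have ed : e <= d by rewrite ge_min lexx.
have e1 : e <= 1 by rewrite ge_min lexx orbT.
exists (threshold (e / 5)) => p hp.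
have p0 : (0 < p)%N by exact: leq_ltn_trans hp.
have pR : 0 < p%:R :> R by rewrite ltr0n.
have L0 : 0 < e / 5 by rewrite divr_gt0.
have hL := threshold_spec L0 (ltnW hp).
suff [q [cop [z [z0 zc zE]]]] : exists q, coprime (2 * p) q /\
    exists z, [/\ quadrant z, z != c & rotation a b c p z = q%:R * (2 * pi)].
  by apply: (periodic_continuum a0 b0 cc p0 z0 zc zE); right.
have pe : p%:R * e <= p%:R * d by rewrite ler_pM2l.
case: hd => hd.
- have [|||q [cop q1 q2]] := @coprime_in_interval R p (2 / 5) ((2 + e) / 5).
  + lra.
  + lra.
  + by have -> : (2 + e) / 5 - 2 / 5 = e / 5 by field.
  by exists q; split => //; apply: hd; lra.
- have [|||q [cop q1 q2]] := @coprime_in_interval R p ((2 - e) / 5) (2 / 5).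
  + lra.
  + lra.
  + by have -> : 2 / 5 - (2 - e) / 5 = e / 5 by field.
  by exists q; split => //; apply: hd; lra.
Qed.

Lemma prime_period_agree (u v : nat -> R) k : (forall n, (0 < n)%N -> u n = v n) ->
  prime_period u k -> prime_period v k.
Proof.
move=> uv [k0 pk mk].
have ip j : (is_period u j) <-> (is_period v j).
  by split => h n n0; have := h n n0; rewrite !uv // ltn_addr.
by split => // [|j j0 /ip]; [exact/ip|exact: mk].
Qed.

(** For [p = 2, 3, 4, 6] no fraction [q / p] lies in []1/3, 1/2[]; for [p = 10] the orbit already
    closes after five iterates. *)
Lemma excluded_periods p : p \in [:: 2; 3; 4; 6; 10]%N -> ~ @lyness_prime_periods R (2 * p).
Proof.
move=> pl [a [b [u [a0 b0 su pu]]]].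
have [c cc] := critical_exists a0 b0.
pose z := (u 1%N, u 2); have z0 : quadrant z by case: su => *; apply/andP.
have {pu} : prime_period (lyness_orbit a b z) (2 * p).
  by apply: prime_period_agree pu => n n0; exact: lyness_sequence_orbit.
move/prime_period_map => [p0 zE pmin].
have zc : z != c.
  apply/eqP => e; have := pmin 1%N isT; rewrite e /= => h.
  have : (p <= 1)%N by apply: h; apply/eqP; rewrite critical_fixed //; have /and3P[] := cc.
  by move: pl; rewrite !inE => /or4P[/eqP->|/eqP->|/eqP->|/orP[/eqP->|/eqP->]].
have [q qE] := rotation_closed a0 b0 cc z0 zc zE.
have [q1 q2] := periodic_rotation_range a0 b0 cc p0 z0 zc zE qE.
have p10 : p = 10%N.
  by move: pl q1 q2; rewrite !inE => /or4P[/eqP->|/eqP->|/eqP->|/orP[/eqP->|/eqP->]]; lia.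
rewrite p10 in zE pmin.
by have := pmin 5 isT (periodic10 a0 b0 cc z0 zE).
Qed.

(** The critical point is fixed by the map, and [a <> b] excludes odd periods; the value [2 / 5] is
    an arbitrary one in []1/3, 1/2[]. *)
Lemma realized_period2 : @lyness_prime_periods R 2.
Proof.
have [|a [b [c [a0 b0 ab cc _]]]] := @rotation_realization (2 / 5).
  by apply/andP; split; lra.
have /and3P[cq _ _] := cc.
exists a, b, (lyness_orbit a b c); split => //; first exact: lyness_orbit_sequence.
have c1 : iter 1 (lyness_map a b) c = c by apply/eqP; rewrite /= critical_fixed.
have dv d : iter d (lyness_map a b) c = c -> (1 %| d)%N by rewrite dvd1n.
apply: (prime_period_orbit _ c1 dv) => // k ok pk; apply: ab.
exact: (odd_period_eq a0 b0 (lyness_orbit_sequence a b cq) pk ok).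
Qed.

(** The only [q / 5] in []1/3, 1/2[] is [2 / 5], which the intermediate value argument does not
    reach. Hence an explicit cycle, through a rational point on the level where [torsion5] vanishes
    for [a = 2], [b = 1 / 3]. *)
Lemma realized_period10 : @lyness_prime_periods R 10.
Proof.
pose a : R := 2; pose b : R := 3^-1; pose z : R * R := (65 / 9, 7 / 3).
have a0 : 0 < a by rewrite /a; lra.
have b0 : 0 < b by rewrite /b; lra.
have z0 : quadrant z by rewrite /quadrant /=; apply/andP; split; lra.
have e1 : lyness_map a b z = (3 / 5, 2 / 5).
  by rewrite /lyness_map /lyness_step /a /b /=; congr pair; field.
have e2 : lyness_map a b (3 / 5, 2 / 5) = (4, 65 / 6).
  by rewrite /lyness_map /lyness_step /a /b /=; congr pair; field.
have e3 : lyness_map a b (4, 65 / 6) = (77 / 24, 17 / 52).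
  by rewrite /lyness_map /lyness_step /a /b /=; congr pair; field.
have e4 : lyness_map a b (77 / 24, 17 / 52) = (66 / 91, 68 / 21).
  by rewrite /lyness_map /lyness_step /a /b /=; congr pair; field.
have e5 : lyness_map a b (66 / 91, 68 / 21) = z.
  by rewrite /lyness_map /lyness_step /a /b /z /=; congr pair; field.
have per : iter 5 (lyness_map a b) z = z by rewrite /= e1 e2 e3 e4 e5.
have ne : lyness_map a b z <> z.
  by rewrite e1 /z => /(congr1 fst) /= h; lra.
exists a, b, (lyness_orbit a b z); split => //; first exact: lyness_orbit_sequence.
apply: (@prime_period_orbit _ a b z 5) => //.
  move=> d; rewrite {1}(divn_eq d 5) addnC iterD.
  have -> : iter (d %/ 5 * 5) (lyness_map a b) z = z.
    by elim: (d %/ 5)%N => [|k IH] //; rewrite mulSn addnC iterD per.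
  have ne2 : iter 2 (lyness_map a b) z <> z.
    by move=> h; apply: ne; move: per; rewrite (iterD 3 2) h (iterD 1 2) h.
  have ne3 : iter 3 (lyness_map a b) z <> z.
    move=> h; apply: ne; have h6 : iter 6 (lyness_map a b) z = z by rewrite (iterD 3 3) !h.
    by rewrite iterS per in h6.
  have ne4 : iter 4 (lyness_map a b) z <> z.
    by move=> h; apply: ne; move: per; rewrite (iterD 1 4) h.
  rewrite /dvdn; have := ltn_pmod d (isT : 0 < 5)%N.
  by case: (d %% 5)%N => [|[|[|[|[|k]]]]].
move=> k ok pk; have := odd_period_eq a0 b0 (lyness_orbit_sequence a b z0) pk ok.
by move/eqP; rewrite gt_eqF // /a /b; lra.
Qed.

(** The parameters are chosen so that [q / p] lies between [sigma] and [2 / 5]: [sigma] is halfway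
    from [q / p] to the end of []1/3, 1/2[] on the side away from [2 / 5]. *)
Lemma realized_period p : (0 < p)%N -> p \notin [:: 1; 2; 3; 4; 5; 6; 10]%N ->
  @lyness_prime_periods R (2 * p).
Proof.
move=> p0 pl; have [q [cop q1 q2 q3]] := periodic_rotation_choice p0 pl.
have pR : 0 < p%:R :> R by rewrite ltr0n.
have h1 : p%:R < 3 * q%:R :> R by rewrite -natrM ltr_nat.
have h2 : 2 * q%:R < p%:R :> R by rewrite -natrM ltr_nat.
pose x : R := q%:R / p%:R.
have qx : q%:R = p%:R * x by rewrite /x mulrCA mulfV ?mulr1 // gt_eqF.
have x1 : 1 / 3 < x by rewrite /x ltr_pdivlMr //; lra.
have x2 : x < 1 / 2 by rewrite /x ltr_pdivrMr //; lra.
have x3 : x != 2 / 5.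
  apply: contra q3 => /eqP x25; have : 5 * q%:R = 2 * p%:R :> R by rewrite qx x25; field.
  by move/eqP; rewrite -!natrM eqr_nat.
suff [a [b [c [a0 b0 ab cc qb]]]] : exists a b c, [/\ 0 < a, 0 < b, a <> b, critical a b c &
    (p%:R * sigma a b < q%:R /\ q%:R < p%:R * (2 / 5) :> R) \/
     (p%:R * (2 / 5) < q%:R :> R /\ q%:R < p%:R * sigma a b)].
  have [z [z0 zc zE]] := exists_rotation_between a0 b0 cc p0 qb.
  exists a, b, (lyness_orbit a b z); split => //; first exact: lyness_orbit_sequence.
  by apply: (rotation_prime_period a0 b0 cc p0 z0 zc zE); left.
have p2 : 2 * pi != 0 :> R by rewrite gt_eqF // mulr_gt0 ?pi_gt0.
have [lo|hi] : x < 2 / 5 \/ 2 / 5 < x by move: x3; rewrite neq_lt => /orP.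
- have [|a [b [c [a0 b0 ab cc ce]]]] := @rotation_realization ((1 / 3 + x) / 2).
    by apply/andP; split; lra.
  have se : sigma a b = (1 / 3 + x) / 2 by apply: (mulIf p2); rewrite -ce (sigmaE a0 b0 cc).
  exists a, b, c; split => //; left; rewrite se qx !ltr_pM2l //; split; lra.
- have [|a [b [c [a0 b0 ab cc ce]]]] := @rotation_realization ((1 / 2 + x) / 2).
    by apply/andP; split; lra.
  have se : sigma a b = (1 / 2 + x) / 2 by apply: (mulIf p2); rewrite -ce (sigmaE a0 b0 cc).
  exists a, b, c; split => //; right; rewrite se qx !ltr_pM2l //; split; lra.
Qed.

End RotationNumberAtCriticalPoint.

Theorem corollary3 (R : realType) :
  (exists p0 : R -> R -> nat,
     (forall a b : R, 0 < a -> 0 < b -> (a, b) <> (1, 1) ->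
        forall p : nat, (p0 a b < p)%N ->
          exists C : set (R * R),
            continuum C /\ C `<=` initial_conditions_of_period a b (2 * p)%N) /\
     (exists c : rprog,
        forall a b : R, 0 < a -> 0 < b -> (a, b) <> (1, 1) ->
          sigma a b <> 2 / 5 -> computes c [:: sigma a b; 2 / 5] (p0 a b)))
  /\
  ((forall k : nat, (0 < k)%N -> ~~ odd k ->
      (@lyness_prime_periods R k <-> k \notin [:: 4; 6; 8; 12; 20]%N)) /\
   (forall (a b : R) (u : nat -> R) (k : nat),
      0 < a -> 0 < b -> a <> b -> lyness_sequence a b u ->
      prime_period u k -> odd k -> k = 1%N)).
Proof.
split; last split.
- pose good a b (N : nat) := forall p, (N < p)%N ->
    exists C : set (R * R), continuum C /\ C `<=` initial_conditions_of_period a b (2 * p).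
  (* In the resonant case the bound is merely chosen; [resonant_continuum] shows that the set is
     nonempty when [(a, b) <> (1, 1)]. *)
  exists (fun a b => if sigma a b == 2 / 5 then xget 0%N [set N | good a b N]
                     else threshold `|sigma a b - 2 / 5|); split.
    move=> a b a0 b0 ab p; case: eqP => [s25|s25]; last exact: nonresonant_continuum.
    have [N hN] := resonant_continuum a0 b0 ab s25.
    by case: xgetP => [M _ hM|/(_ N)//]; exact: hM.
  exists threshold_program => a b _ _ _ s25.
  by case: eqP => // _; exact: threshold_programP.
- move=> k k0 ek; have kE : k = (2 * k./2)%N by rewrite mul2n even_halfK.
  rewrite kE in k0 *; set p := k./2 in k0 *; clearbody p.
  have p0 : (0 < p)%N by rewrite muln_gt0 in k0.
  split=> [pk|kl].
    apply/negP => kl; apply: (@excluded_periods R p) => //.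
    by move: kl; rewrite !inE; lia.
  have [p1|p1] := eqVneq p 1%N; first by rewrite p1; exact: realized_period2.
  have [p5|p5] := eqVneq p 5%N; first by rewrite p5; exact: realized_period10.
  by apply: realized_period => //; move: kl; rewrite !inE; lia.
- move=> a b u k a0 b0 ab su [_ pk _] ok.
  by case: ab; exact: (odd_period_eq a0 b0 su pk ok).
Qed.
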